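(* Let $\mu$ be a probability measure on $\mathbb{C}$ with a continuous and compactly supported density function (with respect to Lebesgue measure). Let $z_1,z_2,\dots$ be independent random variables with distribution $\mu$, and let $p_n(z)=\prod_{k=1}^n (z-z_k)$. Define $$A = \left\{ z \in \mathbb{C}: \int_{\mathbb{C}} \log|x-z|\, d\mu(x) > \int_{\mathbb{C}} \log|x|\, d\mu(x) \right\},$$ $$B = \left\{ z \in \mathbb{C}: \int_{\mathbb{C}} \log|x-z|\, d\mu(x) = \int_{\mathbb{C}} \log|x|\, d\mu(x) \right\}.$$ Then there is a probability measure $\nu$ on $\mathbb{C}$ such that $\nu=\mu$ on $A$ (that is, $\nu|_A=\mu|_A$), the remaining mass $1-\mu(A)$ of $\nu$ is supported on $B$ (that is, $\nu(B)=1-\mu(A)$), and the distribution of the set $\{z\in\mathbb{C}: p_n(z)=p_n(0)\}$ converges to $\nu$ in distribution, in probability, as $n\to\infty$.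
   Context: The distribution of $\{z: p_n(z)=p_n(0)\}$ means the random empirical measure $\nu_n=\frac1n\sum_{k=1}^n\delta_{w_k}$, where $w_1,\dots,w_n$ are the solutions of $p_n(w)=p_n(0)$ counted with multiplicity. Convergence of $\nu_n$ to $\nu$ in distribution, in probability, means that for every bounded continuous $f:\mathbb{C}\to\mathbb{R}$ the random variables $\int f\,d\nu_n$ converge in probability to $\int f\,d\nu$. *)

(* Defs.v *)
From HB Require Import structures.
From mathcomp Require Import all_boot all_order all_algebra finmap.
From mathcomp Require Import complex lra.
From mathcomp Require Import all_classical all_reals all_analysis.

Set Implicit Arguments.
Unset Strict Implicit.
Unset Printing Implicit Defensive.

Import Order.TTheory GRing.Theory Num.Theory.
Import numFieldNormedType.Exports.

Local Open Scope classical_set_scope.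
Local Open Scope ring_scope.
Local Open Scope complex_scope.

(* The metric topology of the norm on R[i], which the library only provides on
   the alias R[i]^o and on abstract numeric fields. *)
HB.instance Definition _ (R : rcfType) :=
  PseudoPointedMetric.copy R[i] (R[i]^o).

(* The Borel sigma-algebra of R[i]. *)
HB.instance Definition _ (R : realType) :=
  Measurable.copy R[i] (g_sigma_algebraType (@open R[i])).

Definition toC (R : realType) (p : R * R) : R[i] := p.1 +i* p.2.

Lemma open_toC (R : realType) (U : set R[i]) (p : R * R) :
  open U -> U (toC p) -> exists2 e : R, 0 < e &
    forall q : R * R, `|p.1 - q.1| < e -> `|p.2 - q.2| < e -> U (toC q).
Proof.
rewrite openE => /(_ (toC p)) + Up => /(_ Up) /nbhs_ballP[[e e'] /= e0 eU].
have /andP[/eqP e'0 e_gt0] : (e' == 0) && (0 < e) by [].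
subst e'; exists (e / 2); first by rewrite divr_gt0.
case: p {Up} eU => x y eU [x' y'] /= xx' yy'; apply: eU.
rewrite /ball /= /toC /=.
have -> : (x +i* y - (x' +i* y')) = (x - x')%:C + 'i * (y - y')%:C.
  by simpc.
apply: (le_lt_trans (ler_normD _ _)).
rewrite normrM (_ : `|'i| = 1 :> R[i]) ?mul1r; last first.
  by rewrite normc_def /= expr0n add0r expr1n sqrtr1.
rewrite !normc_def /= expr0n !addr0 !sqrtr_sqr.
by rewrite -rmorphD ltcR (splitr e) ltrD.
Qed.

Lemma measurable_toC (R : realType) : measurable_fun setT (@toC R).
Proof.
apply: (@measurability _ _ _ _ _ _ (@open R[i])) => // _ [U oU <-].
rewrite setTI.
pose Q (k : rat * rat * rat) : set (R * R) :=
  `]ratr k.1.1 - ratr k.2, ratr k.1.1 + ratr k.2[%classic `*`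
  `]ratr k.1.2 - ratr k.2, ratr k.1.2 + ratr k.2[%classic.
rewrite (_ : _ @^-1` _ =
    \bigcup_(k in [set k | Q k `<=` @toC R @^-1` U]) Q k); last first.
  apply/seteqP; split => [p Up|p [k]]; last exact.
  have [e e0 eU] := open_toC oU Up.
  have e4 : 0 < e / 4 by rewrite divr_gt0.
  have [r] := rat_in_itvoo e4.
  rewrite in_itv /= => /andP[r0 re].
  have [a] := @rat_in_itvoo R (p.1 - ratr r) (p.1 + ratr r) ltac:(lra).
  have [b] := @rat_in_itvoo R (p.2 - ratr r) (p.2 + ratr r) ltac:(lra).
  rewrite !in_itv /= => /andP[b1 b2] /andP[a1 a2].
  exists (a, b, r); last by rewrite /Q /= !in_itv /=; split; apply/andP; split; lra.
  move=> q [] /=; rewrite !in_itv /= => /andP[q1 q2] /andP[q3 q4].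
  by apply: eU; rewrite ltr_norml; apply/andP; split; lra.
rewrite bigcup_mkcond; apply: countable_bigcupT_measurable => // k.
by case: ifP => // _; exact: measurableX.
Qed.

HB.instance Definition _ (R : realType) :=
  @isMeasurableFun.Build _ _ _ _ (@toC R) (@measurable_toC R).

Definition lebesgueC (R : realType) : set R[i] -> \bar R :=
  pushforward (@lebesgue_measure R \x @lebesgue_measure R)%E (@toC R).

Section lebesgueC_measure.
Context (R : realType).

Let lebesgueC0 : lebesgueC (set0 : set R[i]) = 0%E.
Proof. by rewrite /lebesgueC /pushforward preimage_set0 measure0. Qed.

Let lebesgueC_ge0 (E : set R[i]) : (0 <= lebesgueC E)%E.
Proof.
exact: (@measure_ge0 _ _ _ (@lebesgue_measure R \x @lebesgue_measure R)%E).
Qed.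

Let lebesgueC_sigma_additive : semi_sigma_additive (@lebesgueC R).
Proof.
move=> F mF tF mUF; rewrite /lebesgueC /pushforward preimage_bigcup.
have mtoC E : measurable E -> measurable (@toC R @^-1` E).
  by move=> mE; rewrite -[X in measurable X]setTI; exact: measurable_toC.
apply: (@measure_semi_sigma_additive _ _ _
    (@lebesgue_measure R \x @lebesgue_measure R)%E).
- by move=> n; exact: mtoC.
- apply/trivIsetP => /= i j _ _ ij; rewrite -preimage_setI.
  by move/trivIsetP : tF => /(_ _ _ _ _ ij) ->//; rewrite preimage_set0.
- by rewrite -preimage_bigcup; exact: mtoC.
Qed.

HB.instance Definition _ := isMeasure.Build _ _ _ (@lebesgueC R)
  lebesgueC0 lebesgueC_ge0 lebesgueC_sigma_additive.

End lebesgueC_measure.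

Definition has_density (R : realType) (mu : set R[i] -> \bar R)
    (rho : R[i] -> R) :=
  (forall z, 0 <= rho z) /\
  forall E : set R[i], measurable E ->
    mu E = (\int[@lebesgueC R]_(z in E) (rho z)%:E)%E.

Definition compactly_supported (R : realType) (rho : R[i] -> R) :=
  compact (closure [set z | rho z != 0]).

(* [lne] maps 0 to -oo; [normc] is the modulus with values in R. *)
Definition log_potential (R : realType) (mu : probability R[i] R) (z : R[i]) :
    \bar R :=
  (\int[mu]_x lne (ComplexField.Normc.normc (x - z))%:E)%E.

Definition mutually_independent d (T : measurableType d) d'
    (T' : measurableType d') (R : realType) (P : probability T R)
    (X : nat -> T -> T') :=
  forall (J : {fset nat}) (E : nat -> set T'),
    (forall k, measurable (E k)) ->
    P (\bigcap_(k in [set` J]) (X k @^-1` E k)) =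
    (\prod_(k <- J) P (X k @^-1` E k))%E.

Definition cvg_in_probability d (T : measurableType d) (R : realType)
    (P : probability T R) (X : nat -> T -> R) (c : R) :=
  forall eps : R, 0 < eps ->
    P [set w | eps <= `|X n w - c|] @[n --> \oo] --> 0%E.

(* The solutions w of p(w) = p(0), listed with multiplicity. *)
Definition level_roots (F : closedFieldType) (p : {poly F}) : seq F :=
  sval (closed_field_poly_normal (p - (p.[0])%:P)).

Definition empirical_measure (R : realType) (s : seq R[i]) :
    {measure set R[i] -> \bar R} :=
  mscale ((size s)%:R^-1)%:nng (msum (fun k => \d_(s`_k)) (size s)).

Definition random_poly (R : realType) (z : nat -> R[i]) (n : nat) :
    {poly R[i]} :=
  \prod_(k < n) ('X - (z k)%:P).

(* Main.v *)
Require Import Defs.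
From HB Require Import structures.
From mathcomp Require Import all_boot all_order all_algebra finmap.
From mathcomp Require Import complex zify ring lra.
From mathcomp Require Import all_classical all_reals all_analysis.
From mathcomp Require Import measurable_realfun.

Set Implicit Arguments.
Unset Strict Implicit.
Unset Printing Implicit Defensive.

Import Order.TTheory GRing.Theory Num.Theory.
Import numFieldNormedType.Exports.

Local Open Scope classical_set_scope.
Local Open Scope ring_scope.
Local Open Scope complex_scope.

(* Write U u for the integral of log |x - u| against mu, V = max (U, U 0), and
   q_n(u) = p_n(u) - p_n(0), so that q_n(u) is the product of the u - w over the
   solutions w of p_n(w) = p_n(0).

   By the law of large numbers n^-1 log |p_n(u)| is close to U u, and one step of
   randomness (q_n is affine in the last variable) excludes cancellation between
   p_n(u) and p_n(0), so the mean of |n^-1 log |q_n(u)| - V u| tends to 0, with a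
   bound integrable in u on discs.  Integrating against a bounded compactly
   supported F, the average over the solutions w of the potential
   logpot F w = \int F(u) log |u - w| du converges in probability to \int F V.
   Potentials logpot F are dense among continuous functions on discs, and the
   solutions stay in a fixed disc, so the averages of every continuous f converge
   in probability to a positive functional of f, which is a measure nu by the
   Riesz representation theorem.

   If f has compact support in an open set W, then F can be taken supported in W
   with zero integral.  When W lies in {U > U 0}, V = U on W and Fubini gives
   \int F V = \int F U = \int (logpot F) dmu, close to \int f dmu, hence nu = mu
   there; when W lies in {U < U 0}, \int F V = U 0 * \int F = 0, hence nu = 0. *)

(** * The complex plane as a metric measure space *)

(** The obstacle is cancellation: knowing p_n(u) and p_n(0) to exponential accuracy says little
    about their difference where U u is close to U 0. Because the last variable has a bounded
    density, the logarithm of an affine function of it is, in mean, within O(1) of the logarithm of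
    its larger coefficient, a cost of O(1/n) after division by n. Bounds in mean, integrated over u,
    are enough, since an average of [logpot F] sees q_n only through an integral in u, for which the
    singularities of the logarithm form a null set.

    Testing against potentials takes the place of the distributional Laplacian of V. Derivatives and
    circle integrals are replaced by averages over the solutions of b^N = e^N, for which the mean of
    log |v - b| is exactly N^-1 log |v^N - e^N|. Second moments of [lg], uniform over centres in a
    disc, are the one integrability input: they bound variances, dominate integrands and control the
    averages near the circle.

    The restriction of nu to B is never computed: its mass is what the regions above and below the
    level leave over. *)

Notation nc := ComplexField.Normc.normc.

Section complex_modulus.
Context {R : realType}.
Implicit Types (z u v : R[i]).

Lemma nc_ge0 z : 0 <= nc z.
Proof. by case: z => x y /=; rewrite sqrtr_ge0. Qed.

Lemma ncM u v : nc (u * v) = nc u * nc v.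
Proof. exact: ComplexField.Normc.normcM. Qed.

Lemma ncN z : nc (- z) = nc z.
Proof. exact: normcN. Qed.

Lemma ncB u v : nc (u - v) = nc (v - u).
Proof. by rewrite -ncN opprB. Qed.

Lemma nc_triangle u v : nc (u + v) <= nc u + nc v.
Proof. exact: le_normcD. Qed.

Lemma nc_subr u v : nc (u - v) <= nc u + nc v.
Proof. by rewrite -(ncN v) nc_triangle. Qed.

Lemma nc_triangleB u v w : nc (u - w) <= nc (u - v) + nc (v - w).
Proof. by rewrite (_ : u - w = (u - v) + (v - w)) ?nc_triangle // addrA subrK. Qed.

Lemma nc_dist u v : `|nc u - nc v| <= nc (u - v).
Proof.
rewrite ler_norml; have := nc_triangle (u - v) v; have := nc_triangle (v - u) u.
by rewrite !subrK ncB => *; apply/andP; split; lra.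
Qed.

Lemma nc_real (x : R) : nc x%:C = `|x|.
Proof. by rewrite /= expr0n /= addr0 sqrtr_sqr. Qed.

Lemma ncX z n : nc (z ^+ n) = nc z ^+ n.
Proof.
elim: n => [|n IH]; first by rewrite !expr0 ComplexField.Normc.normc1.
by rewrite !exprS ncM IH.
Qed.

Lemma nc_prod I (r : seq I) (P : pred I) (F : I -> R[i]) :
  nc (\prod_(i <- r | P i) F i) = \prod_(i <- r | P i) nc (F i).
Proof.
elim/big_rec2: _ => [|i x y _ <-]; first exact: ComplexField.Normc.normc1.
exact: ncM.
Qed.

Lemma nc_eq0 z : (nc z == 0) = (z == 0).
Proof.
apply/eqP/eqP => [|->]; first exact: ComplexField.Normc.eq0_normc.
exact: ComplexField.Normc.normc0.
Qed.

Lemma nc_gt0 z : (0 < nc z) = (z != 0).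
Proof. by rewrite lt_def nc_ge0 nc_eq0 andbT. Qed.

Lemma nc0 : nc (0 : R[i]) = 0.
Proof. exact: ComplexField.Normc.normc0. Qed.

Lemma Re_le_nc z : `|complex.Re z| <= nc z.
Proof.
by case: z => x y /=; rewrite -sqrtr_sqr ler_wsqrtr // lerDl sqr_ge0.
Qed.

Lemma Im_le_nc z : `|complex.Im z| <= nc z.
Proof.
by case: z => x y /=; rewrite -sqrtr_sqr ler_wsqrtr // lerDr sqr_ge0.
Qed.

Lemma nc_le_ReIm z : nc z <= `|complex.Re z| + `|complex.Im z|.
Proof.
case: z => x y /=; rewrite -[leRHS]ger0_norm ?addr_ge0// -sqrtr_sqr.
rewrite ler_wsqrtr // sqrrD !real_normK ?num_real //.
by rewrite lerD2r lerDl mulrn_wge0 // mulr_ge0.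
Qed.

Lemma nbhs_ncP z (A : set R[i]) :
  nbhs z A <-> exists2 e : R, 0 < e & forall v, nc (z - v) < e -> A v.
Proof.
split=> [/nbhs_ballP[[e e'] /= e0 eA]|[e e0 eA]].
  have /andP[/eqP e'0 e_gt0] : (e' == 0) && (0 < e) by [].
  by subst e'; exists e => // v zv; apply: eA; rewrite /ball /= ltcR.
apply/nbhs_ballP; exists e%:C => /=; first by rewrite ltcR.
by move=> v zv; apply: eA; rewrite /ball /= ltcR in zv.
Qed.

Lemma open_ncP (A : set R[i]) : open A <->
  forall z, A z -> exists2 e : R, 0 < e & forall v, nc (z - v) < e -> A v.
Proof.
rewrite openE; split => [oA z /oA /nbhs_ncP//|oA z /oA Az]; exact/nbhs_ncP.
Qed.

Lemma cvg_ncP (f : R[i] -> R) z : {for z, continuous f} <->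
  forall e : R, 0 < e -> exists2 d : R, 0 < d & forall v, nc (z - v) < d -> `|f z - f v| < e.
Proof.
split=> [/cvgrPdist_lt fz e /fz /nbhs_ncP//|fz].
apply: (cvgrPdist_lt (F := nbhs z) _ _).2 => e /fz ?; exact/nbhs_ncP.
Qed.

Lemma lipschitz_nc_continuous (f : R[i] -> R) (k : R) :
  (forall u v, `|f u - f v| <= k * nc (u - v)) -> continuous f.
Proof.
move=> fk z; apply/cvg_ncP => e e0.
have k1 : 0 < `|k| + 1 by rewrite ltr_wpDl.
exists (e / (`|k| + 1)); first by rewrite divr_gt0.
move=> v zv; apply: (le_lt_trans (fk _ _)).
rewrite (@le_lt_trans _ _ ((`|k| + 1) * nc (z - v)))//.
  by rewrite ler_wpM2r ?nc_ge0// (le_trans (ler_norm _))// lerDl.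
by rewrite mulrC -ltr_pdivlMr.
Qed.

Lemma continuous_nc : continuous (@nc R).
Proof.
by apply: (@lipschitz_nc_continuous _ 1) => u v; rewrite mul1r nc_dist.
Qed.

Lemma continuous_Re : continuous (@complex.Re R).
Proof.
apply: (@lipschitz_nc_continuous _ 1) => u v; rewrite mul1r.
by apply: le_trans (Re_le_nc _); case: u v => [a b] [c d].
Qed.

Lemma continuous_Im : continuous (@complex.Im R).
Proof.
apply: (@lipschitz_nc_continuous _ 1) => u v; rewrite mul1r.
by apply: le_trans (Im_le_nc _); case: u v => [a b] [c d].
Qed.

Lemma open_measurableC (A : set R[i]) : open A -> measurable A.
Proof. by move=> oA; exact: sub_sigma_algebra. Qed.

Lemma continuous_measurableC (f : R[i] -> R) :
  continuous f -> measurable_fun setT f.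
Proof.
move=> cf; apply: (measurability _ (RGenOpens.measurableE R)) => //.
move=> _ [_ [a [b ->]]] <-; rewrite setTI; apply: open_measurableC.
by apply: open_comp => // z _; exact: cf.
Qed.

End complex_modulus.

Section complex_measurability.
Context {R : realType} {d : measure_display} {X : measurableType d}.
Implicit Types f g : X -> R[i].

Lemma measurable_funC f : measurable_fun setT f <->
  measurable_fun setT (@complex.Re R \o f) /\ measurable_fun setT (@complex.Im R \o f).
Proof.
split=> [mf|[mRe mIm]].
  by split; apply: measurableT_comp => //; apply: continuous_measurableC;
    [exact: continuous_Re|exact: continuous_Im].
rewrite (_ : f = @toC R \o (fun x => (complex.Re (f x), complex.Im (f x)))); last first.
  by apply/funext => x /=; rewrite /toC /=; case: (f x).
apply: measurableT_comp; first exact: measurable_toC.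
exact: measurable_fun_pair.
Qed.

Lemma measurable_addC f g : measurable_fun setT f -> measurable_fun setT g ->
  measurable_fun setT (fun x => f x + g x).
Proof.
move=> /measurable_funC[f1 f2] /measurable_funC[g1 g2]; apply/measurable_funC.
split.
- rewrite (_ : _ \o _ = (@complex.Re R \o f) \+ (@complex.Re R \o g)); first exact: measurable_funD.
  by apply/funext => x /=; case: (f x) (g x) => ? ? [].
- rewrite (_ : _ \o _ = (@complex.Im R \o f) \+ (@complex.Im R \o g)); first exact: measurable_funD.
  by apply/funext => x /=; case: (f x) (g x) => ? ? [].
Qed.

Lemma measurable_oppC f : measurable_fun setT f ->
  measurable_fun setT (fun x => - f x).
Proof.
move=> /measurable_funC[f1 f2]; apply/measurable_funC; split.
- rewrite (_ : _ \o _ = \- (@complex.Re R \o f)); last first.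
    by apply/funext => x /=; case: (f x).
  exact: measurable_funN.
- rewrite (_ : _ \o _ = \- (@complex.Im R \o f)); last first.
    by apply/funext => x /=; case: (f x).
  exact: measurable_funN.
Qed.

Lemma measurable_subC f g : measurable_fun setT f -> measurable_fun setT g ->
  measurable_fun setT (fun x => f x - g x).
Proof. by move=> mf mg; apply: measurable_addC => //; exact: measurable_oppC. Qed.

Lemma measurable_mulC f g : measurable_fun setT f -> measurable_fun setT g ->
  measurable_fun setT (fun x => f x * g x).
Proof.
move=> /measurable_funC[f1 f2] /measurable_funC[g1 g2]; apply/measurable_funC.
split.
- rewrite (_ : _ \o _ = ((@complex.Re R \o f) \* (@complex.Re R \o g)) \- ((@complex.Im R \o f) \* (@complex.Im R \o g))).
    by apply: measurable_funB; exact: measurable_funM.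
  by apply/funext => x /=; case: (f x) (g x) => ? ? [].
- rewrite (_ : _ \o _ = ((@complex.Re R \o f) \* (@complex.Im R \o g)) \+ ((@complex.Im R \o f) \* (@complex.Re R \o g))).
    by apply: measurable_funD; exact: measurable_funM.
  by apply/funext => x /=; case: (f x) (g x) => ? ? [].
Qed.

Lemma measurable_prodC (I : Type) (s : seq I) (F : I -> X -> R[i]) :
  (forall i, measurable_fun setT (F i)) ->
  measurable_fun setT (fun x => \prod_(i <- s) F i x).
Proof.
move=> mF; elim: s => [|i s IH].
  by rewrite (_ : (fun _ => _) = cst 1) //; apply/funext => x; rewrite big_nil.
rewrite (_ : (fun _ => _) = fun x => F i x * \prod_(j <- s) F j x).
  exact: measurable_mulC.
by apply/funext => x; rewrite big_cons.
Qed.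

End complex_measurability.

Lemma measurable_nc_sub {R : realType} (a : R[i]) :
  measurable_fun setT (fun z : R[i] => nc (z - a)).
Proof.
apply: (measurableT_comp (continuous_measurableC (@continuous_nc R))).
exact: measurable_subC.
Qed.

Lemma measurable_set1C {R : realType} (a : R[i]) : measurable [set a].
Proof.
rewrite (_ : [set a] = setT `&` (fun z => nc (z - a)) @^-1` [set 0]); last first.
  rewrite setTI; apply/seteqP; split => z /= => [->|/eqP]; first by rewrite subrr; exact: nc0.
  by rewrite nc_eq0 subr_eq0 => /eqP.
exact: (measurable_nc_sub a measurableT (measurable_set1 0)).
Qed.

Section lebesgueC_theory.
Context {R : realType}.
Local Notation leb := (@lebesgue_measure R).
Local Notation lam := (@lebesgueC R).

Definition disc (r : R) : set R[i] := [set z | nc z <= r].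

Lemma measurable_disc (r : R) : measurable (disc r).
Proof.
rewrite (_ : disc r = setT `&` @nc R @^-1` `]-oo, r]%classic); last first.
  by apply/seteqP; split => z /=; rewrite in_itv /= ?setTI// => -[].
exact: (continuous_measurableC (@continuous_nc R)).
Qed.

Lemma lebesgueC_product (A B : set R) : measurable A -> measurable B ->
  lam [set z | A (complex.Re z) /\ B (complex.Im z)] = (leb A * leb B)%E.
Proof.
move=> mA mB; rewrite /lebesgueC /pushforward -product_measure1E//; congr (_ _).
Qed.

Definition box (r : R) : set R[i] :=
  [set z | `[- r, r]%classic (complex.Re z) /\ `[- r, r]%classic (complex.Im z)].

Lemma measurable_box (r : R) : measurable (box r).
Proof.
apply: measurableI; rewrite -[X in measurable X]setTI.
- by apply: (continuous_measurableC continuous_Re).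
- by apply: (continuous_measurableC continuous_Im).
Qed.

Lemma lebesgueC_box (r : R) : (lam (box r) < +oo)%E.
Proof.
have fin : (leb `[(- r)%R, r] < +oo)%E.
  by rewrite lebesgue_measure_itv; case: ifP => // _; rewrite /= -EFinB ltry.
by rewrite lebesgueC_product//; apply: lte_mul_pinfty => //; rewrite ge0_fin_numE.
Qed.

Lemma disc_sub_box (r : R) : disc r `<=` box r.
Proof.
move=> z /= zr; rewrite /box /= !in_itv /= -!ler_norml.
by split; [apply: le_trans zr; exact: Re_le_nc|apply: le_trans zr; exact: Im_le_nc].
Qed.

Lemma lebesgueC_disc (r : R) : (lam (disc r) < +oo)%E.
Proof.
apply: le_lt_trans (lebesgueC_box r); apply: le_measure; rewrite ?inE.
- exact: measurable_disc.
- exact: measurable_box.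
- exact: disc_sub_box.
Qed.

Lemma bigcup_disc : \bigcup_(n : nat) disc (n%:R : R) = [set: R[i]].
Proof.
apply/seteqP; split => // z _; exists (Num.truncn (nc z)).+1 => //=.
by rewrite /disc /= ltW// truncnS_gt// nc_ge0.
Qed.

Lemma sigma_finite_lebesgueC : sigma_finite [set: R[i]] lam.
Proof.
exists (fun n => disc n%:R); first by rewrite bigcup_disc.
by move=> n; split; [exact: measurable_disc|exact: lebesgueC_disc].
Qed.
HB.instance Definition _ := @Measure_isSigmaFinite.Build _ _ _ lam sigma_finite_lebesgueC.

End lebesgueC_theory.

(** The pushforward packaged as a measure, so that uniqueness theorems and change of variables apply
    to it. *)
Definition pushm d1 d2 (X : measurableType d1) (Y : measurableType d2)
    (R : realType) (m : {measure set X -> \bar R}) (phi : X -> Y)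
    (mphi : measurable_fun setT phi) : {measure set Y -> \bar R} :=
  measure_function_pushforward__canonical__measure_function_Measure m mphi.

(** * Translation invariance of planar Lebesgue measure *)

Section translation.
Context {R : realType}.
Local Notation leb := (@lebesgue_measure R).
Local Notation lam := (@lebesgueC R).

(** The translated measure gives every half-open interval its length, which characterises Lebesgue
    measure. *)
Lemma lebesgue_measure_shift (a : R) (A : set R) : measurable A ->
  leb ((fun x => x + a) @^-1` A) = leb A.
Proof.
move=> mA.
have mphi : measurable_fun [set: measurableTypeR R] (fun x : R => x + a : measurableTypeR R).
  exact: measurable_funD.
rewrite (_ : leb _ = pushm leb mphi A)//; apply/esym/lebesgue_measure_unique => //.
move=> _ [[x y]] _ <-; rewrite /= /pushforward.
rewrite (_ : _ @^-1` _ = `]x - a, y - a]%classic); last first.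
  apply/seteqP; split => z /=; rewrite !in_itv /= => /andP[? ?]; apply/andP; split; lra.
rewrite !lebesgue_measure_itv /= !lte_fin ltrD2r.
by case: ifP => // _; rewrite -!EFinB opprB addrA subrK.
Qed.

(** Pulled back to R * R, the translated measure agrees with the product measure on rectangles, by
    the one-dimensional case in each coordinate. *)
Lemma lebesgueC_shift (a : R[i]) (A : set R[i]) : measurable A ->
  lam ((fun z => z + a) @^-1` A) = lam A.
Proof.
have toCD (p : R * R) : toC p + a = toC (p.1 + complex.Re a, p.2 + complex.Im a).
  by rewrite /toC; case: p a => ? ? [].
move=> mA; pose phi (p : R * R) := (p.1 + complex.Re a, p.2 + complex.Im a).
have mphi : measurable_fun [set: measurableTypeR R * measurableTypeR R]
    (phi : _ -> measurableTypeR R * measurableTypeR R).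
  by apply: measurable_fun_pair; exact: measurable_funD.
have mtoC : measurable (@toC R @^-1` A).
  by rewrite -[X in measurable X]setTI; exact: measurable_toC.
rewrite /lebesgueC /pushforward.
rewrite (_ : _ @^-1` _ = phi @^-1` (@toC R @^-1` A)); last first.
  by apply/seteqP; split => p /=; rewrite toCD.
have -> : (leb \x leb)%E (phi @^-1` (@toC R @^-1` A)) = pushm (leb \x leb)%E mphi (@toC R @^-1` A) by [].
apply/esym/product_measure_unique => // {mtoC mA}A1 A2 mA1 mA2.
rewrite /= /pushforward.
rewrite (_ : _ @^-1` _ = ((fun x => x + complex.Re a) @^-1` A1) `*`
  ((fun x => x + complex.Im a) @^-1` A2))//.
have mshift b (B : set R) : measurable B -> measurable ((fun x : R => x + b) @^-1` B).
  move=> mB; rewrite -[X in measurable X]setTI.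
  have mb : measurable_fun setT (fun x : R => x + b) by exact: measurable_funD.
  exact: mb.
rewrite product_measure1E; try exact: mshift.
by congr (_ * _)%E; exact: lebesgue_measure_shift.
Qed.

Lemma ge0_integral_shiftC (a : R[i]) (f : R[i] -> \bar R) :
  measurable_fun setT f -> (forall u, 0 <= f u)%E ->
  (\int[lam]_u f (u + a)%R = \int[lam]_u f u)%E.
Proof.
move=> mf f0.
have mphi : measurable_fun setT (fun z : R[i] => z + a) by exact: measurable_addC.
rewrite [RHS](eq_measure_integral (pushm lam mphi)).
  by rewrite -[in LHS](preimage_setT (fun z : R[i] => z + a)) (ge0_integral_pushforward mphi lam measurableT mf).
by move=> A mA _; rewrite /= /pushforward lebesgueC_shift.
Qed.

Lemma integral_shiftC (a : R[i]) (f : R[i] -> \bar R) :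
  measurable_fun setT f -> (\int[lam]_u f (u + a)%R = \int[lam]_u f u)%E.
Proof.
move=> mf; rewrite integralE [RHS]integralE; congr (_ - _)%E.
  rewrite -(ge0_integral_shiftC a (measurable_funepos mf) (funepos_ge0 f)).
  by apply: eq_integral => u _; rewrite !funeposE.
rewrite -(ge0_integral_shiftC a (measurable_funeneg mf) (funeneg_ge0 f)).
by apply: eq_integral => u _; rewrite !funenegE.
Qed.

(** Every section of the circle at a fixed real part has at most two points, so the product measure
    integrates zero. *)
Lemma lebesgueC_circle0 (r : R) : lam [set z | nc z = r] = 0%E.
Proof.
have mC : measurable [set z : R[i] | nc z = r].
  rewrite -[X in measurable X]setTI.
  exact: (continuous_measurableC (@continuous_nc R) measurableT (measurable_set1 r)).
rewrite /lebesgueC /pushforward /= /product_measure1.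
rewrite integral0_eq// => x _ /=; apply: countable_lebesgue_measure0.
pose s := Num.sqrt (r ^+ 2 - x ^+ 2).
apply: (@sub_countable _ _ _ [set s; - s]); last first.
  by apply: finite_set_countable; apply: finite_set2.
apply: subset_card_le => y; rewrite /xsection /= inE /= => xyr.
have : y ^+ 2 = s ^+ 2.
  have xy0 : 0 <= x ^+ 2 + y ^+ 2 by rewrite addr_ge0 ?sqr_ge0.
  have r2 : x ^+ 2 + y ^+ 2 = r ^+ 2 by rewrite -xyr sqr_sqrtr.
  by rewrite sqr_sqrtr -r2 addrAC subrr add0r ?sqr_ge0.
by move/eqP; rewrite eqf_sqr => /orP[]/eqP; [left|right].
Qed.

Lemma lebesgueC_set1 (a : R[i]) : lam [set a] = 0%E.
Proof.
have m0 := measurable_set1C (0 : R[i]).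
have -> : [set a] = (fun z => z - a) @^-1` [set 0].
  by apply/seteqP; split => z /=; [move->; rewrite subrr|move/subr0_eq].
rewrite lebesgueC_shift//; apply/eqP; rewrite -measure_le0 -(lebesgueC_circle0 0).
apply: le_measure; rewrite ?inE//; last by move=> z ->; exact: nc0.
rewrite -[X in measurable X]setTI.
exact: (continuous_measurableC (@continuous_nc R) measurableT (measurable_set1 0)).
Qed.

End translation.

(** * The logarithm of the modulus *)

(** Since [ln] is 0 off the positive reals, [lg 0 = 0] rather than minus infinity. Identities such
    as [lgM] therefore ask for nonzero arguments, and are used almost everywhere. *)
Definition lg (R : realType) (z : R[i]) : R := ln (nc z).

Section log_integrability.
Context {R : realType}.
Local Notation leb := (@lebesgue_measure R).
Local Notation lam := (@lebesgueC R).

Lemma measurable_lg : measurable_fun setT (@lg R).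
Proof.
apply: (measurableT_comp (@measurable_ln R)).
exact: (continuous_measurableC (@continuous_nc R)).
Qed.

Lemma lgM (u v : R[i]) : u != 0 -> v != 0 -> lg (u * v) = lg u + lg v.
Proof. by move=> u0 v0; rewrite /lg ncM lnM ?posrE ?nc_gt0. Qed.

Lemma lg_prod (I : eqType) (r : seq I) (F : I -> R[i]) :
  (forall i, i \in r -> F i != 0) ->
  lg (\prod_(i <- r) F i) = \sum_(i <- r) lg (F i).
Proof.
elim: r => [|i r IH] F0.
  by rewrite !big_nil /lg ComplexField.Normc.normc1 ln1.
have Fr j : j \in r -> F j != 0 by move=> jr; rewrite F0// in_cons jr orbT.
rewrite !big_cons lgM ?IH ?F0 ?mem_head//.
by rewrite prodf_seq_neq0; apply/allP => j /Fr ->.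
Qed.

Lemma lgN (u : R[i]) : lg (- u) = lg u.
Proof. by rewrite /lg ncN. Qed.

Lemma lebesgueC_disc_le (r : R) : 0 <= r -> (lam (disc r) <= ((2 * r) ^+ 2)%:E)%E.
Proof.
move=> r0; apply: (@le_trans _ _ (lam (box r))).
  apply: le_measure; rewrite ?inE; [exact: measurable_disc|exact: measurable_box|].
  exact: disc_sub_box.
rewrite lebesgueC_product//.
have -> : leb `[- r, r]%classic = (2 * r)%:E.
  rewrite lebesgue_measure_itv /= lte_fin; case: ifPn => [_|].
    by rewrite -EFinB opprK mulr2n mulrDl mul1r.
  by rewrite -leNgt => rr; congr (_%:E); lra.
by rewrite -EFinM expr2.
Qed.

(** Choose the dyadic scale 2^-(m+1) < t <= 2^-m; then |ln t| <= (m+1) ln 2 <= m+1. The induction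
    starts at a scale below t and climbs until it reaches t. *)
Lemma ln_sq_dyadic (t : R) : 0 < t -> t <= 1 ->
  exists m, t <= 2 ^- m /\ ln t ^+ 2 <= (m.+1%:R) ^+ 2.
Proof.
move=> t0 t1.
have [m] : exists m, 2 ^- m.+1 < t.
  exists (Num.truncn t^-1); rewrite -[ltRHS]invrK ltf_pV2 ?posrE ?invr_gt0 ?exprn_gt0//.
  apply: (@lt_le_trans _ _ (Num.truncn t^-1).+1%:R).
    by rewrite truncnS_gt// invr_ge0 ltW.
  by rewrite -natrX ler_nat ltnW// ltn_expl.
have bound k : 2 ^- k.+1 < t -> ln t ^+ 2 <= (k.+1%:R) ^+ 2.
  move=> kt; have lnt0 : ln t <= 0 by exact: ln_le0.
  have ln21 : ln (2 : R) <= 1 by have := @le_ln1Dx R 1; rewrite (_ : 1 + 1 = 2) //; apply; lra.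
  have : - k.+1%:R <= ln t.
    apply: le_trans (_ : ln (2 ^- k.+1) <= _); last first.
      by rewrite ler_ln ?posrE ?invr_gt0 ?exprn_gt0// ltW.
    rewrite lnV ?posrE ?exprn_gt0// lnXn// lerN2 -[leRHS]mulr1 -[leLHS]mulr_natl.
    by rewrite ler_wpM2l.
  move=> kl; rewrite -[leLHS]sqrrN ler_sqr ?nnegrE//; lra.
elim: m => [|m IH] mt.
  by exists 0%N; rewrite expr0 invr1; split => //; exact: bound.
have [tm|tm] := leP t (2 ^- m.+1); last exact: IH.
by exists m.+1; split => //; exact: bound.
Qed.

(** Since the sum of 2k+1 over k <= m is (m+1)^2, the function lg^2 is dominated by the sum of
    (2k+1) times the indicators of the discs of radius 2^-k. The k-th term has integral at most
    (2k+1) (2 * 2^-k)^2 <= 16 / 2^(k+1), by the area of the circumscribed square; these bounds add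
    up to 16. *)
Lemma lg_sq_disc1 : (\int[lam]_(u in disc 1) ((lg u) ^+ 2)%:E <= 16%:E)%E.
Proof.
pose g k (u : R[i]) : \bar R := ((2 * k%:R + 1) * \1_(disc (2 ^- k)) u)%:E.
have g0 k u : (0 <= g k u)%E.
  by rewrite lee_fin mulr_ge0// addr_ge0// mulr_ge0.
have mg k : measurable_fun setT (g k).
  apply/measurable_EFinP; apply: measurable_funM => //.
  by apply: measurable_indic; exact: measurable_disc.
have mlg : measurable_fun setT (fun u : R[i] => (lg u ^+ 2)%:E).
  by apply/measurable_EFinP; apply: measurable_funX; exact: measurable_lg.
apply: (@le_trans _ _ (\int[lam]_(u in disc 1) (\sum_(k <oo) g k u))%E).
  apply: ge0_le_integral => //.
  - exact: measurable_disc.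
  - by move=> u _; rewrite lee_fin sqr_ge0.
  - exact: measurable_funTS.
  - apply: measurable_funTS; apply: ge0_emeasurable_sum => // *; exact: g0.
  move=> u u1; have [->|u0] := eqVneq u 0.
    rewrite /lg nc0 ln0// expr0n /=; apply: nneseries_ge0 => k _ _; exact: g0.
  have [m [um lm]] := @ln_sq_dyadic (nc u) ltac:(by rewrite nc_gt0) u1.
  apply: le_trans (_ : (\sum_(0 <= k < m.+1) g k u <= _)%E); last first.
    by apply: nneseries_lim_ge => k _ _; exact: g0.
  rewrite sumEFin lee_fin; apply: (le_trans lm).
  rewrite big_nat (eq_bigr (fun k : nat => 2 * k%:R + 1)) => [|k /andP[_ km]]; last first.
    rewrite indicE mem_set ?mulr1//; apply: le_trans um _.
    by rewrite lef_pV2 ?posrE ?exprn_gt0// ler_weXn2l// ler1n.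
  rewrite -big_nat; elim: m {um lm} => [|m IH]; first by rewrite big_nat1 mulr0 add0r expr1n.
  rewrite big_nat_recr//=; apply: le_trans (lerD IH (lexx _)).
  by rewrite -[m.+2%:R]natr1; nra.
rewrite integral_nneseries//; last 2 first.
- exact: measurable_disc.
- by move=> k; exact: measurable_funTS.
apply: (@le_trans _ _ (\sum_(0 <= k <oo) ((16 : R) / (2 ^ k.+1)%:R)%:E)%E); last first.
  by apply: epsilon_trick0.
apply: lee_nneseries => [k _ _|k _]; first by apply: integral_ge0 => u _; exact: g0.
apply: (@le_trans _ _ (((2 * k%:R + 1) * ((2 * 2 ^- k) ^+ 2))%:E)).
  rewrite (eq_integral (fun u => (2 * k%:R + 1)%:E * (\1_(disc (2 ^- k)) u)%:E)%E); last first.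
    by move=> u _; rewrite /g EFinM.
  rewrite ge0_integralZl_EFin ?addr_ge0 ?mulr_ge0//; last 2 first.
  - exact: measurable_disc.
  - by apply/measurable_EFinP; apply: measurable_indic; exact: measurable_disc.
  rewrite integral_indic; [|exact: measurable_disc..].
  rewrite EFinM lee_wpmul2l ?lee_fin ?addr_ge0// ?mulr_ge0//.
  have p0 : (0 : R) <= 2 ^- k by rewrite invr_ge0 exprn_ge0.
  apply: le_trans (lebesgueC_disc_le p0); apply: le_measure; rewrite ?inE.
  - by apply: measurableI; exact: measurable_disc.
  - exact: measurable_disc.
  - by move=> u [].
rewrite lee_fin natrX (exprS 2 k).
have k2 : 2 * k%:R + 1 <= 2 * 2 ^+ k :> R.
  have : (2 * k + 1 <= 2 * 2 ^ k)%N by have := @ltn_expl 2 k isT; lia.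
  by rewrite -(ler_nat R) natrD !natrM natrX.
have p0 : (0 : R) < 2 ^+ k by rewrite exprn_gt0.
set p := 2 ^+ k in p0 k2 *.
have -> : 16 / (2 * p) = (8 * p) * (p^-1) ^+ 2 by field; rewrite gt_eqF.
rewrite exprMn mulrA ler_wpM2r ?sqr_ge0//; lra.
Qed.

Lemma lg_sq_disc (M : R) : (\int[lam]_(u in disc M) ((lg u) ^+ 2)%:E < +oo)%E.
Proof.
have mlg : measurable_fun setT (fun u : R[i] => (lg u ^+ 2)%:E).
  by apply/measurable_EFinP; apply: measurable_funX; exact: measurable_lg.
have mD : measurable (disc 1 `|` disc M : set R[i]).
  by apply: measurableU; exact: measurable_disc.
apply: (@le_lt_trans _ _ (\int[lam]_(u in disc 1 `|` disc M) ((lg u) ^+ 2)%:E)%E).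
  apply: ge0_subset_integral => //; first exact: measurable_disc.
  - exact: measurable_funTS.
  - by move=> u _; rewrite lee_fin sqr_ge0.
rewrite -(@setDUK _ (disc 1) (disc 1 `|` disc M)); last by move=> u; left.
rewrite setDUl setDv set0U.
have mDD : measurable (disc M `\` disc 1 : set R[i]).
  by apply: measurableD; exact: measurable_disc.
rewrite ge0_integral_setU//; last 4 first.
- exact: measurable_disc.
- exact: measurable_funTS.
- by move=> u _; rewrite lee_fin sqr_ge0.
- by apply/disj_setPS => u [] ? [].
apply: lte_add_pinfty.
  by apply: le_lt_trans lg_sq_disc1 _; exact: ltry.
apply: (@le_lt_trans _ _ (\int[lam]_(u in disc M `\` disc 1) ((ln M) ^+ 2)%:E)%E).
  apply: ge0_le_integral => //.
  - by move=> u _; rewrite lee_fin sqr_ge0.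
  - exact: measurable_funTS.
  - move=> u [uM /negP]; rewrite -ltNge => u1; rewrite lee_fin.
    have l0 : 0 <= lg u by rewrite ln_ge0// ltW.
    have lM : lg u <= ln M.
      have u00 := lt_trans ltr01 u1; by rewrite ler_ln ?posrE//; exact: lt_le_trans uM.
    by rewrite ler_sqr ?nnegrE//; exact: le_trans lM.
rewrite integral_cst//; apply: lte_mul_pinfty; rewrite ?lee_fin ?sqr_ge0//.
apply: le_lt_trans (lebesgueC_disc M); apply: le_measure; rewrite ?inE//.
exact: measurable_disc.
Qed.

(** Translation by [a] carries [disc M] into [disc (M + M)], so one constant serves all centres
    [a]. *)
Lemma lg_sq_shift (M : R) : exists2 C : R, 0 <= C & forall a, nc a <= M ->
  (\int[lam]_(u in disc M) ((lg (u - a)) ^+ 2)%:E <= C%:E)%E.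
Proof.
exists (fine (\int[lam]_(u in disc (M + M)) ((lg u) ^+ 2)%:E)%E).
  by apply: fine_ge0; apply: integral_ge0 => u _; rewrite lee_fin sqr_ge0.
move=> a aM.
rewrite fineK; last first.
  rewrite ge0_fin_numE ?lg_sq_disc//.
  by apply: integral_ge0 => u _; rewrite lee_fin sqr_ge0.
have mlg : measurable_fun setT (fun u : R[i] => (lg u ^+ 2)%:E).
  by apply/measurable_EFinP; apply: measurable_funX; exact: measurable_lg.
have msub : measurable_fun setT (fun u : R[i] => u - a) by exact: measurable_subC.
rewrite [leLHS]integral_mkcond [leRHS]integral_mkcond.
have mR (f : R[i] -> \bar R) r : measurable_fun setT f -> measurable_fun setT (f \_ (disc r)).
  by move=> mf; apply/(measurable_restrictT _ _).1 => //; [exact: measurable_disc|exact: measurable_funTS].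
rewrite -(@ge0_integral_shiftC _ (- a) (_ \_ (disc (M + M)))); last 2 first.
- exact: mR.
- by move=> u; rewrite patchE; case: ifP => // _; rewrite lee_fin sqr_ge0.
apply: ge0_le_integral => //.
- by move=> u _; rewrite patchE; case: ifP => // _; rewrite lee_fin sqr_ge0.
- by apply: mR; exact: (measurableT_comp mlg msub).
- exact: (measurableT_comp (mR _ _ mlg) msub).
move=> u _; rewrite !patchE; case: ifPn => [uM|_].
  rewrite mem_set// /disc /=; apply: le_trans (nc_subr _ _) _.
  by rewrite lerD//; move: uM; rewrite inE.
by case: ifP => // _; rewrite lee_fin sqr_ge0.
Qed.

End log_integrability.

(** * Compactness of discs and uniform continuity *)

Section complex_compactness.
Context {R : realType}.

Lemma compact_disc (r : R) : compact (disc r).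
Proof.
have cbox : compact (box r).
  rewrite (_ : box r = @toC R @` (`[- r, r]%classic `*` `[- r, r]%classic)); last first.
    apply/seteqP; split => [z [z1 z2]|_ [[x y] [/= xr yr] <-]]; last by split.
    by exists (complex.Re z, complex.Im z) => //; case: z {z1 z2}.
  apply: continuous_compact; last by apply: compact_setX; exact: segment_compact.
  apply: continuous_subspaceT => p U /nbhs_ncP[e e0 eU].
  exists (ball p.1 (e / 2), ball p.2 (e / 2)) => /=.
    by split; apply: nbhsx_ballx; rewrite divr_gt0.
  move=> q [/= q1 q2]; apply: eU; apply: le_lt_trans (nc_le_ReIm _) _.
  rewrite [ltRHS]splitr; apply: ltrD; exact: le_lt_trans q1 || exact: le_lt_trans q2.
apply: (subclosed_compact _ cbox (@disc_sub_box _ r)).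
rewrite (_ : disc r = @nc R @^-1` [set x | x <= r])//.
by apply: preimage_closed => [z _|]; [exact: continuous_nc|exact: closed_le].
Qed.

(** Only [u] is confined to the disc: [v] may leave it. A radius of continuity at each centre is
    halved, one half for the move to [u] and one for the move to [v]. *)
Lemma unif_continuous_disc (f : R[i] -> R) (r : R) : continuous f ->
  forall e : R, 0 < e -> exists2 d : R, 0 < d &
    forall u v : R[i], nc u <= r -> nc (u - v) < d -> `|f u - f v| < e.
Proof.
move=> cf e e0.
have e20 : 0 < e / 2 by rewrite divr_gt0.
have ncov := (compact_near_coveringP _).1 (@compact_disc r).
pose P (d : R) (u : R[i]) := forall v, nc (u - v) < d -> `|f u - f v| < e.
have : \forall d \near 0^'+, disc r `<=` P d.
  apply: ncov => u _.
  have [d d0 df] := (cvg_ncP f u).1 (cf u) _ e20.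
  exists ([set v | nc (u - v) < d / 2], [set d' | d' < d / 2]) => /=.
    split; last by apply: nbhs_right_lt; rewrite divr_gt0.
    by apply/nbhs_ncP; exists (d / 2); rewrite ?divr_gt0.
  move=> [v d'] [/= uv d'd] w vw.
  rewrite (_ : f v - f w = (f u - f w) - (f u - f v)); last by ring.
  apply: le_lt_trans (ler_normB _ _) _; rewrite [ltRHS]splitr; apply: ltrD; apply: df.
    apply: le_lt_trans (nc_triangleB u v w) _; rewrite [ltRHS]splitr ltrD//.
    exact: lt_trans d'd.
  by apply: lt_trans uv _; rewrite ltr_pdivrMr// mulr2n mulrDr mulr1 ltrDl.
move=> H.
have [d [d0 dP]] : exists d : R, 0 < d /\ disc r `<=` P d.
  near (0:R)^'+ => d; exists d; split; first by near: d; exact: nbhs_right_gt.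
  by near: d.
by exists d => // u v ur uv; exact: (dP _ ur).
Unshelve. all: by end_near. Qed.

Lemma bounded_on_disc (f : R[i] -> R) (r : R) : continuous f ->
  exists2 K : R, 0 <= K & forall u : R[i], nc u <= r -> `|f u| <= K.
Proof.
move=> cf.
have /compact_bounded : compact (f @` disc r).
  by apply: continuous_compact; [exact: continuous_subspaceT|exact: compact_disc].
move=> [K [_ KB]]; exists (`|K| + 1); first by rewrite addr_ge0.
move=> u ur; apply: (KB (`|K| + 1)); last by exists u.
by rewrite (le_lt_trans (ler_norm _))// ltrDl.
Qed.

End complex_compactness.

(** * Densities of logarithmic potentials *)

Section compactly_supported_bounded.
Context {R : realType}.
Local Notation lam := (@lebesgueC R).
Implicit Types g h : R[i] -> R.

(** Domination by a multiple of a disc indicator records bound and support together, which makes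
    stability under sums and translations immediate. *)
Definition bounded_on_support g := measurable_fun setT g /\
  exists M K : R, 0 <= K /\ forall u, `|g u| <= K * \1_(disc M) u.

Local Notation bcs := bounded_on_support.

Lemma bcs_measurable g : bcs g -> measurable_fun setT g.
Proof. by case. Qed.

Lemma indic_disc_le (M M' : R) u : M <= M' -> \1_(disc M) u <= \1_(disc M') u :> R.
Proof.
move=> MM'; rewrite !indicE; case: (boolP (u \in disc M)) => [|_]; last exact: ler0n.
by rewrite inE => uM; rewrite mem_set// /disc /= (le_trans uM).
Qed.

Lemma bcsD g h : bcs g -> bcs h -> bcs (fun u => g u + h u).
Proof.
move=> [mg [M [K [K0 gK]]]] [mh [M' [K' [K'0 hK]]]]; split.
  exact: measurable_funD.
exists (Num.max M M'), (K + K'); split; first exact: addr_ge0.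
move=> u; apply: le_trans (ler_normD _ _) _; rewrite mulrDl; apply: lerD.
  by apply: le_trans (gK u) _; rewrite ler_wpM2l// indic_disc_le// le_max lexx.
by apply: le_trans (hK u) _; rewrite ler_wpM2l// indic_disc_le// le_max lexx orbT.
Qed.

Lemma bcsZ (c : R) g : bcs g -> bcs (fun u => c * g u).
Proof.
move=> [mg [M [K [K0 gK]]]]; split; first exact: measurable_funM.
exists M, (`|c| * K); split; first exact: mulr_ge0.
by move=> u; rewrite normrM -mulrA ler_wpM2l.
Qed.

Lemma bcs_shift (a : R[i]) g : bcs g -> bcs (fun u => g (u + a)).
Proof.
move=> [mg [M [K [K0 gK]]]]; split.
  by apply: measurableT_comp mg _; exact: measurable_addC.
exists (M + nc a), K; split => // u; apply: le_trans (gK _) _.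
rewrite ler_wpM2l// !indicE; case: (boolP (u + a \in disc M)) => [|_]; last exact: ler0n.
rewrite inE => uM; rewrite mem_set// /disc /=.
by have := nc_subr (u + a) a; rewrite addrK => /le_trans; apply; rewrite lerD2r.
Qed.

Lemma bcs_sum (I : Type) (s : seq I) (G : I -> R[i] -> R) :
  (forall i, bcs (G i)) -> bcs (fun u => \sum_(i <- s) G i u).
Proof.
move=> bG; elim: s => [|i s IH].
  split; first by under eq_fun do rewrite big_nil; exact: measurable_cst.
  by exists 0, 0; split => // u; rewrite big_nil normr0 mul0r.
rewrite (_ : (fun _ => _) = fun u => G i u + \sum_(j <- s) G j u); first exact: bcsD.
by apply/funext => u; rewrite big_cons.
Qed.

(** The common dominating function: as |x| <= 1 + x^2, it controls both g and g * lg (u - w) for any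
    bounded [g] supported in the disc. *)
Lemma integrable_disc_lg_sq (M : R) (w : R[i]) :
  lam.-integrable setT (fun u => (\1_(disc M) u * (1 + lg (u - w) ^+ 2))%:E).
Proof.
have [C C0 Cw] := lg_sq_shift (Num.max M (nc w)).
have mlg : measurable_fun setT (fun u : R[i] => 1 + lg (u - w) ^+ 2).
  apply: measurable_funD => //; apply: measurable_funX.
  by apply: (measurableT_comp measurable_lg); exact: measurable_subC.
apply/integrableP; split.
  apply/measurable_EFinP; apply: measurable_funM => //.
  by apply: measurable_indic; exact: measurable_disc.
apply: (@le_lt_trans _ _ (\int[lam]_(u in disc (Num.max M (nc w)))
    (1 + (lg (u - w) ^+ 2)%:E))%E).
  rewrite [leRHS]integral_mkcond; apply: ge0_le_integral => //.
  - apply/measurable_EFinP; apply: measurableT_comp => //.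
    apply: measurable_funM => //.
    by apply: measurable_indic; exact: measurable_disc.
  - apply/(measurable_restrictT _ _).1 => //; first exact: measurable_disc.
    by apply: measurable_funTS; under eq_fun do rewrite -EFinD; exact/measurable_EFinP.
  move=> u _; rewrite patchE indicE; case: (boolP (u \in disc M)) => uM.
    rewrite mem_set; last first.
      by rewrite inE in uM; apply: (le_trans uM); rewrite le_max lexx.
    by rewrite mul1r /= ger0_norm ?EFinD// addr_ge0 ?sqr_ge0.
  rewrite mul0r /= normr0; case: ifP => // _.
  by rewrite -EFinD lee_fin addr_ge0 ?sqr_ge0.
rewrite ge0_integralD//.
- rewrite integral_cst ?mul1e; last exact: measurable_disc.
  apply: lte_add_pinfty; first exact: lebesgueC_disc.
  apply: le_lt_trans (ltry C); apply: Cw; by rewrite le_max lexx orbT.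
- exact: measurable_disc.
- by move=> u _; rewrite lee_fin sqr_ge0.
- apply: measurable_funTS; apply/measurable_EFinP; apply: measurable_funX.
  by apply: (measurableT_comp measurable_lg); exact: measurable_subC.
Qed.

Lemma ler_norm_sqr1 (x : R) : `|x| <= 1 + x ^+ 2.
Proof. rewrite -real_normK ?num_real//; have := normr_ge0 x; nra. Qed.

Lemma bcs_integrable_lg g (w : R[i]) : bcs g ->
  lam.-integrable setT (fun u => (g u * lg (u - w))%:E).
Proof.
move=> [mg [M [K [K0 gK]]]].
apply: (le_integrable _ _ _ (integrableZl measurableT K (integrable_disc_lg_sq M w))) => //.
  apply/measurable_EFinP; apply: measurable_funM => //.
  by apply: (measurableT_comp measurable_lg); exact: measurable_subC.
move=> u _ /=; rewrite lee_fin normrM.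
rewrite [leRHS]ger0_norm; last by rewrite !mulr_ge0// addr_ge0// sqr_ge0.
by rewrite mulrA; apply: ler_pM => //; exact: ler_norm_sqr1.
Qed.

Lemma bcs_integrable g : bcs g -> lam.-integrable setT (EFin \o g).
Proof.
move=> [mg [M [K [K0 gK]]]].
apply: (le_integrable _ _ _ (integrableZl measurableT K (integrable_disc_lg_sq M 0))) => //.
  exact/measurable_EFinP.
move=> u _ /=; rewrite lee_fin.
rewrite [leRHS]ger0_norm; last by rewrite !mulr_ge0// addr_ge0// sqr_ge0.
apply: le_trans (gK u) _; rewrite ler_wpM2l// -[leLHS]mulr1 ler_wpM2l//.
by rewrite lerDl sqr_ge0.
Qed.

End compactly_supported_bounded.

(** * Circle means of the logarithm by roots of unity *)

Section circle_average.
Context {R : realType}.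
Local Notation lam := (@lebesgueC R).

(** The hypothesis gives |a|^N <= (1 - eta) |b|^N, hence eta |b|^N <= |a^N - b^N| <= 2 |b|^N; taking
    logarithms and dividing by N leaves an error O(1/N). *)
Lemma lg_powB (N : nat) (a b : R[i]) (eta : R) : 0 < eta -> eta < 1 ->
  (0 < N)%N -> b != 0 -> nc a <= (1 - eta) * nc b ->
  `|N%:R^-1 * lg (a ^+ N - b ^+ N) - lg b| <= (ln 2 - ln eta) / N%:R.
Proof.
move=> e0 e1 N0 b0 ab.
have bp : 0 < nc b by rewrite nc_gt0.
have bN : 0 < nc b ^+ N by rewrite exprn_gt0.
have NR : 0 < N%:R :> R by rewrite ltr0n.
have aN : nc (a ^+ N) <= (1 - eta) * nc b ^+ N.
  rewrite ncX; apply: le_trans (_ : ((1 - eta) * nc b) ^+ N <= _).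
    by apply: lerXn2r; rewrite ?nnegrE ?nc_ge0// (le_trans _ ab)// nc_ge0.
  rewrite exprMn; apply: ler_wpM2r; first exact: ltW.
  case: N {NR bN} N0 => // N _; rewrite exprS.
  by apply: ler_piMr; [lra|apply: exprn_ile1; lra].
set t := nc (a ^+ N - b ^+ N).
have tl : eta * nc b ^+ N <= t.
  have := nc_triangleB (b ^+ N) (a ^+ N) 0; rewrite !subr0 ncB -/t ncX; lra.
have tu : t <= 2 * nc b ^+ N.
  have := nc_subr (a ^+ N) (b ^+ N); rewrite -/t (ncX b); nra.
have t0 : 0 < t by apply: lt_le_trans tl; rewrite mulr_gt0.
have lnbN : ln (nc b ^+ N) = N%:R * lg b by rewrite lnXn// mulr_natl.
have l1 : ln eta + N%:R * lg b <= ln t.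
  by rewrite -lnbN -lnM ?posrE// ler_ln ?posrE// mulr_gt0.
have l2 : ln t <= ln 2 + N%:R * lg b.
  by rewrite -lnbN -lnM ?posrE// ler_ln ?posrE// mulr_gt0.
have leta : ln eta <= 0 by apply: ln_le0; exact: ltW.
have l20 : 0 <= ln (2 : R) by rewrite ln_ge0// ler1n.
rewrite (_ : _ - _ = (ln t - N%:R * lg b) / N%:R); last first.
  by rewrite /lg -/t; field; rewrite gt_eqF.
have NV : 0 <= N%:R^-1 :> R by rewrite invr_ge0.
rewrite normrM [X in _ * X]ger0_norm//; apply: ler_wpM2r => //.
by rewrite ler_norml; apply/andP; split; lra.
Qed.

(** The list comes from splitting X^N - e^N over the algebraically closed field; taking moduli in
    w^N = e^N gives |w| = e. *)
Lemma unity_roots_seq (e : R) (N : nat) : 0 < e -> (0 < N)%N ->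
  exists s : seq R[i], [/\ size s = N, (forall w, w \in s -> nc w = e) &
    forall v : R[i], v ^+ N - e%:C ^+ N = \prod_(w <- s) (v - w)].
Proof.
move=> e0 N0.
pose p : {poly R[i]} := 'X^N - (e%:C ^+ N)%:P.
have [s ps] := closed_field_poly_normal p.
have lp : lead_coef p = 1 by rewrite lead_coefDl ?lead_coefXn// size_polyXn size_polyN size_polyC; case: (_ != 0); rewrite ?ltnS.
rewrite lp scale1r in ps.
have pv v : v ^+ N - e%:C ^+ N = \prod_(w <- s) (v - w).
  have -> : v ^+ N - e%:C ^+ N = p.[v] by rewrite /p !hornerE.
  by rewrite ps horner_prod; apply: eq_bigr => w _; rewrite !hornerE.
exists s; split => //.
  have : size p = N.+1 by rewrite size_XnsubC.
  by rewrite ps size_prod_XsubC => -[].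
move=> w ws; apply/eqP; rewrite -(@eqrXn2 _ N)// ?nc_ge0 ?ltW//.
have /eqP : w ^+ N - e%:C ^+ N = 0.
  rewrite pv; apply/eqP; rewrite prodf_seq_eq0; apply/hasP; exists w => //=.
  by rewrite subrr.
by rewrite subr_eq0 => /eqP wN; rewrite -ncX wN ncX nc_real ger0_norm ?ltW.
Qed.

Lemma measurable_nc_preimage (P : set R) : measurable P -> measurable [set v : R[i] | P (nc v)].
Proof.
move=> mP; rewrite -[X in measurable X]setTI.
exact: (continuous_measurableC (@continuous_nc R) measurableT mP).
Qed.

(** A neighbourhood of the circle of radius [e], in multiplicative form: off it [lg_powB] applies,
    with [v] either the smaller or the larger base. *)
Definition annulus (e eta : R) : set R[i] :=
  [set v | (1 - eta) * e < nc v /\ (1 - eta) * nc v < e].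

Lemma measurable_annulus (e eta : R) : measurable (annulus e eta).
Proof.
apply: (measurable_nc_preimage (P := [set x | (1 - eta) * e < x /\ (1 - eta) * x < e])).
apply: measurableI.
  rewrite [X in measurable X](_ : _ = `](1 - eta) * e, +oo[%classic)//.
  by apply/seteqP; split => x /=; rewrite in_itv /= andbT.
rewrite -[X in measurable X]setTI.
have : measurable_fun setT (fun x : R => (1 - eta) * x) by exact: measurable_funM.
move=> /(_ measurableT `]-oo, e[%classic (measurable_itv _)).
by congr measurable; apply/seteqP; split => x /= -[_]; rewrite in_itv.
Qed.

(** For eta = 1/(m+2) the annuli decrease to the circle of radius [e], which is null; continuity
    from above concludes. *)
Lemma annulus_small (e d : R) : 0 < e -> 0 < d ->
  exists eta : R, [/\ 0 < eta, eta < 1 & (lam (annulus e eta) <= d%:E)%E].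
Proof.
move=> e0 d0; pose h (m : nat) : R := m.+2%:R^-1.
have h0 m : 0 < h m by rewrite invr_gt0.
have h1 m : h m < 1 by rewrite invf_lt1// ltr1n.
have hle m n : (m <= n)%N -> h n <= h m by move=> mn; rewrite lef_pV2 ?posrE// ler_nat ltnS.
have capE : \bigcap_n annulus e (h n) = [set v | nc v = e].
  apply/seteqP; split => [v /= H|v /= ve n _]; last first.
    by rewrite /annulus /= ve; split; rewrite -[ltRHS]mul1r ltr_pM2r//; have := h0 n; lra.
  have aux x y : (forall n, (1 - h n) * x < y) -> 0 <= x -> x <= y.
    move=> H1 x0; rewrite leNgt; apply/negP => yx.
    have xp : 0 < x.
      have y0 : 0 <= y by apply: le_trans (ltW (H1 0%N)); rewrite mulr_ge0//; have := h1 0%N; lra.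
      exact: le_lt_trans yx.
    (* For this [n], x / n.+2 < x - y, which contradicts (1 - h n) * x < y. *)
    pose n := Num.truncn (x / (x - y)).
    have nlt : x / (x - y) < n.+2%:R.
      apply: (@lt_trans _ _ n.+1%:R); last by rewrite ltr_nat.
      by rewrite truncnS_gt// divr_ge0// subr_ge0 ltW.
    have := H1 n; rewrite /h.
    have n0 : 0 < n.+2%:R :> R by [].
    rewrite ltr_pdivrMr ?subr_gt0// in nlt.
    have nV : n.+2%:R * n.+2%:R^-1 = 1 :> R by rewrite mulfV// gt_eqF.
    have nV0 : 0 < n.+2%:R^-1 :> R by rewrite invr_gt0.
    set a := n.+2%:R in n0 nlt nV *; set b := a^-1 in nV nV0 *.
    move=> Hn; have : x * b < x - y by nra.
    nra.
  apply/eqP; rewrite eq_le; apply/andP; split; apply: aux; rewrite ?nc_ge0 ?(ltW e0)//.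
    by move=> n; have [] := H n I.
  by move=> n; have [] := H n I.
have cvg0 : (lam (annulus e (h n)) @[n --> \oo] --> 0)%E.
  rewrite -(lebesgueC_circle0 e) -capE; apply: nonincreasing_cvg_mu.
  - apply: le_lt_trans (lebesgueC_disc (2 * e)); apply: le_measure; rewrite ?inE.
    + exact: measurable_annulus.
    + exact: measurable_disc.
    + move=> v [_]; rewrite /h /disc /=; lra.
  - by move=> n; exact: measurable_annulus.
  - rewrite capE; exact: (measurable_nc_preimage (P := [set e])).
  - move=> m n mn; apply/subsetPset => v []; have := hle _ _ mn; have := nc_ge0 v.
    rewrite /annulus /= => *; split; nra.
have /fine_cvgP[_ /cvgrPdist_lt /(_ _ d0)[n _ /(_ n (leqnn n))]] := cvg0.
rewrite /= sub0r normrN => nd; exists (h n); split => //.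
have fin : lam (annulus e (h n)) \is a fin_num.
  rewrite ge0_fin_numE//; apply: le_lt_trans (lebesgueC_disc (e / (1 - h n))).
  apply: le_measure; rewrite ?inE; [exact: measurable_annulus|exact: measurable_disc|].
  move=> v [_]; rewrite /disc /= ler_pdivlMr ?subr_gt0// mulrC; exact: ltW.
rewrite -(fineK fin) lee_fin; apply: ltW; apply: le_lt_trans nd; exact: ler_norm.
Qed.

End circle_average.

Section circle_average_L1.
Context {R : realType}.
Local Notation lam := (@lebesgueC R).

Definition lnmax (e : R) (v : R[i]) : R := ln (Num.max (nc v) e).

(* For s the N solutions of b^N = e^N, the average of lg (v - b) over s is
   N^-1 * lg (v^N - e^N), which tends to lnmax e v off the circle nc v = e.
   Such finite averages replace integration over the circle. *)
Definition circle_error (e : R) (s : seq R[i]) (v : R[i]) : R :=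
  (size s)%:R^-1 * (\sum_(w <- s) lg (v - w)) - lnmax e v.

Lemma measurable_lnmax (e : R) : 0 < e -> measurable_fun setT (lnmax e).
Proof.
move=> e0; apply: (measurableT_comp (@measurable_ln R)).
by apply: measurable_maxr => //; exact: (continuous_measurableC (@continuous_nc R)).
Qed.

Lemma measurable_lg_shift (w : R[i]) : measurable_fun setT (fun v : R[i] => lg (v - w)).
Proof. by apply: (measurableT_comp measurable_lg); exact: measurable_subC. Qed.

Lemma measurable_circle_error (e : R) s : 0 < e ->
  measurable_fun setT (circle_error e s).
Proof.
move=> e0; apply: measurable_funB; last exact: measurable_lnmax.
apply: measurable_funM => //; apply: measurable_sum => w; exact: measurable_lg_shift.
Qed.

(** Off the annulus the first term suffices, by [lg_powB]. On it, each logarithm is bounded by |x|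
    <= 1/sg + sg x^2: the large constant 1/sg is paid on a small set, and the quadratic term has
    small weight. *)
Lemma circle_error_le (e r eta sg : R) (s : seq R[i]) v : 0 < e -> e <= r ->
  0 < eta -> eta < 1 -> 0 < sg -> (0 < size s)%N ->
  (forall w, w \in s -> nc w = e) ->
  (forall v : R[i], v ^+ (size s) - e%:C ^+ (size s) = \prod_(w <- s) (v - w)) ->
  nc v <= r ->
  `|circle_error e s v| <= (ln 2 - ln eta) / (size s)%:R +
     (sg^-1 + (`|ln e| + `|ln r|)) * \1_(annulus e eta) v +
     sg / (size s)%:R * \sum_(w <- s) lg (v - w) ^+ 2.
Proof.
move=> e0 er eta0 eta1 sg0 s0 sw sv vr.
have NR : 0 < (size s)%:R :> R by rewrite ltr0n.
have leta : ln eta <= 0 by apply: ln_le0; exact: ltW.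
have l20 : 0 <= ln (2 : R) by rewrite ln_ge0// ler1n.
have L0 : 0 <= (ln 2 - ln eta) / (size s)%:R by apply: divr_ge0 => //; lra.
have S0 : 0 <= sg / (size s)%:R * \sum_(w <- s) lg (v - w) ^+ 2.
  rewrite mulr_ge0 ?divr_ge0 ?sumr_ge0// ?ltW// => w _; exact: sqr_ge0.
have ec : nc (e%:C : R[i]) = e by rewrite nc_real ger0_norm ?ltW.
have e0c : e%:C != 0 :> R[i] by rewrite -nc_gt0 ec.
have lgp : nc v != e ->
    \sum_(w <- s) lg (v - w) = lg (v ^+ (size s) - e%:C ^+ (size s)).
  move=> ve; rewrite sv lg_prod// => w /sw we; rewrite subr_eq0.
  by apply: contraNN ve => /eqP ->; rewrite we.
case: (boolP (v \in annulus e eta)) => vA; rewrite indicE; last first.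
  rewrite (negbTE vA) mulr0 addr0.
  apply: le_trans (_ : (ln 2 - ln eta) / (size s)%:R <= _); last by rewrite lerDl.
  have [v1|v1] := leP (nc v) ((1 - eta) * e).
    have ve : nc v <= e by apply: le_trans v1 _; rewrite ler_piMl ?ltW//; lra.
    rewrite /circle_error /lnmax max_r// lgp; last by rewrite lt_eqF//; apply: le_lt_trans v1 _; nra.
    have -> : ln e = lg (e%:C : R[i]) by rewrite /lg ec.
    by apply: lg_powB; rewrite ?ec.
  have v2 : e <= (1 - eta) * nc v.
    by rewrite leNgt; apply/negP => v2; move: vA; rewrite notin_setE; apply.
  have ve : e < nc v by nra.
  rewrite /circle_error /lnmax max_l ?(ltW ve)// lgp ?gt_eqF//.
  rewrite -(lgN (_ - _)) opprB; apply: lg_powB; rewrite ?ec//.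
  by rewrite -nc_gt0 (lt_trans e0).
rewrite vA mulr1.
have Mr : `|lnmax e v| <= `|ln e| + `|ln r|.
  have me : e <= Num.max (nc v) e by rewrite le_max lexx orbT.
  have mr : Num.max (nc v) e <= r by rewrite ge_max vr.
  have m0 := lt_le_trans e0 me.
  have l1 : ln e <= lnmax e v by rewrite ler_ln ?posrE.
  have l2 : lnmax e v <= ln r by rewrite ler_ln ?posrE//; exact: lt_le_trans mr.
  have n1 := normr_ge0 (ln e); have n2 := normr_ge0 (ln r).
  have n3 := ler_norm (ln r); have := ler_norm (- ln e); rewrite normrN => n4.
  by rewrite ler_norml; apply/andP; split; lra.
have sgV : 0 < sg^-1 by rewrite invr_gt0.
have amgm x : `|x| <= sg^-1 + sg * x ^+ 2.
  rewrite -real_normK ?num_real//; have n0 := normr_ge0 x.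
  have sV : sg * sg^-1 = 1 by rewrite mulfV// gt_eqF.
  set a := `|x| in n0 *; set b := sg^-1 in sgV sV *.
  have : 0 <= (sg * a - 1) ^+ 2 * b by rewrite mulr_ge0 ?sqr_ge0 ?ltW.
  nra.
rewrite /circle_error; apply: le_trans (ler_normB _ _) _.
rewrite -addrA -[leLHS]add0r; apply: lerD => //.
rewrite [leRHS]addrAC; apply: lerD => //.
rewrite normrM ger0_norm; last by rewrite invr_ge0.
apply: le_trans (_ : (size s)%:R^-1 * \sum_(w <- s) (sg^-1 + sg * lg (v - w) ^+ 2) <= _).
  rewrite ler_wpM2l ?invr_ge0//; apply: le_trans (ler_norm_sum _ _ _) _.
  by apply: ler_sum => w _; exact: amgm.
rewrite big_split /= big_const_seq count_predT iter_addr_0 -mulr_sumr mulrDr.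
by rewrite -[sg^-1 *+ size s]mulr_natl mulKf ?gt_eqF// lerD2l mulrA (mulrC _^-1).
Qed.

(** The parameters are chosen in the order [sg], [eta], [N], each making one term of
    [circle_error_le] at most d/3. The quadratic term is bounded independently of N because
    [lg_sq_shift] is uniform over the centres in [s]. *)
Lemma circle_error_small (e r d : R) : 0 < e -> e <= r -> 0 < d ->
  exists s : seq R[i], [/\ (0 < size s)%N, (forall w, w \in s -> nc w = e) &
    (\int[lam]_(v in disc r) (`|circle_error e s v|)%:E <= d%:E)%E].
Proof.
move=> e0 er d0.
have [C C0 Cs] := @lg_sq_shift R r.
have d3 : 0 < d / 3 by rewrite divr_gt0.
pose sg := d / 3 / (C + 1).
have sg0 : 0 < sg by rewrite divr_gt0// ltr_wpDl.
have sgC : sg * C <= d / 3.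
  by rewrite /sg -mulrA ler_piMr ?(ltW d3)// mulrC ler_pdivrMr ?mul1r ?lerDl// ltr_wpDl.
pose D := sg^-1 + (`|ln e| + `|ln r|).
have D0 : 0 < D by rewrite /D ltr_wpDr ?addr_ge0// invr_gt0.
have dD : 0 < d / 3 / D by rewrite divr_gt0.
have [eta [eta0 eta1 annD]] := annulus_small e0 dD.
pose L := ln 2 - ln eta.
have L0 : 0 <= L.
  have : ln eta <= 0 by apply: ln_le0; exact: ltW.
  have : 0 <= ln (2 : R) by rewrite ln_ge0// ler1n.
  by rewrite /L; lra.
pose A := fine (lam (disc r)).
have AE : lam (disc r) = A%:E by rewrite fineK// ge0_fin_numE ?lebesgueC_disc.
have A0 : 0 <= A by rewrite fine_ge0.
pose N := (Num.truncn (L * A / (d / 3))).+1.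
have NL : L / N%:R * A <= d / 3.
  rewrite mulrAC ler_pdivrMr ?ltr0n// -ler_pdivrMl// mulrC ltW//.
  by rewrite truncnS_gt// divr_ge0 ?mulr_ge0// ltW.
have [s [sN sw sv]] := @unity_roots_seq R e N e0 isT.
rewrite -sN in NL sv.
have s0 : (0 < size s)%N by rewrite sN.
exists s; split => //.
pose q (v : R[i]) := \sum_(w <- s) lg (v - w) ^+ 2.
have mq : measurable_fun setT q.
  by apply: measurable_sum => w; apply: measurable_funX; exact: measurable_lg_shift.
have q0 v : 0 <= q v by apply: sumr_ge0 => w _; exact: sqr_ge0.
have mdr : measurable (disc r : set R[i]) by exact: measurable_disc.
have mA := @measurable_annulus R e eta.
have c0 : 0 <= sg / (size s)%:R by rewrite divr_ge0// ltW.
apply: (@le_trans _ _ (\int[lam]_(v in disc r) (((L / (size s)%:R)%:E +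
    D%:E * (\1_(annulus e eta) v)%:E) + (sg / (size s)%:R)%:E * (q v)%:E))%E).
  apply: ge0_le_integral => //.
  - by apply/measurable_EFinP; apply: measurableT_comp => //; apply: measurable_funTS;
      exact: measurable_circle_error.
  - rewrite (_ : (fun _ => _) = EFin \o (fun v => L / (size s)%:R +
      D * \1_(annulus e eta) v + sg / (size s)%:R * q v)); last exact/funext.
    apply/measurable_EFinP; apply: measurable_funTS; apply: measurable_funD.
      by apply: measurable_funD => //; apply: measurable_funM => //; exact: measurable_indic.
    exact: measurable_funM.
  - move=> v vr; rewrite -!EFinM -!EFinD lee_fin.
    exact: (@circle_error_le e r eta sg s v).
have mind : measurable_fun (disc r) (fun v : R[i] => (\1_(annulus e eta) v : R)%:E).
  by apply/measurable_EFinP; exact: measurable_indic.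
have mqr : measurable_fun (disc r) (fun v => (q v)%:E).
  by apply/measurable_EFinP; exact: measurable_funTS.
rewrite ge0_integralD//; last 4 first.
- by move=> v _; rewrite adde_ge0 ?mule_ge0 ?lee_fin ?divr_ge0// ?(ltW D0).
- by apply: emeasurable_funD => //; exact: measurable_funeM.
- by move=> v _; rewrite mule_ge0 ?lee_fin.
- exact: measurable_funeM.
rewrite ge0_integralD//; last 3 first.
- by move=> v _; rewrite lee_fin divr_ge0.
- by move=> v _; rewrite mule_ge0 ?lee_fin ?(ltW D0).
- exact: measurable_funeM.
rewrite integral_cst// ge0_integralZl_EFin ?(ltW D0)//.
rewrite ge0_integralZl_EFin//; last by move=> v _; rewrite lee_fin.
rewrite integral_indic//.
have -> : d%:E = ((d / 3)%:E + (d / 3)%:E + (d / 3)%:E)%E.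
  by rewrite -!EFinD; congr (_%:E); field.
apply: leeD; first apply: leeD.
- by apply: (@le_trans _ _ ((L / (size s)%:R)%:E * A%:E)%E); [rewrite -AE|rewrite -EFinM lee_fin].
- apply: (@le_trans _ _ (D%:E * (d / 3 / D)%:E)%E).
    rewrite lee_wpmul2l ?lee_fin ?(ltW D0)//; apply: le_trans annD.
    by apply: le_measure; rewrite ?inE//; exact: measurableI.
  by rewrite -EFinM lee_fin mulrC divfK// gt_eqF.
apply: (@le_trans _ _ ((sg / (size s)%:R)%:E * ((size s)%:R * C)%:E)%E).
  rewrite lee_wpmul2l ?lee_fin//.
  rewrite (eq_integral (fun v : R[i] => \sum_(w <- s) (lg (v - w)%R ^+ 2)%:E)%E); last first.
    by move=> v _; rewrite sumEFin.
  rewrite ge0_integral_sum//; last 2 first.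
  - move=> w; apply/measurable_EFinP; apply: measurable_funTS; apply: measurable_funX.
    exact: measurable_lg_shift.
  - by move=> w v _; rewrite lee_fin sqr_ge0.
  apply: (@le_trans _ _ (\sum_(w <- s) C%:E)%E).
    rewrite big_seq [leRHS]big_seq; apply: lee_sum => w ws; apply: Cs.
    by rewrite sw.
  by rewrite sumEFin lee_fin big_const_seq count_predT iter_addr_0 mulr_natl.
rewrite -EFinM lee_fin mulrA divfK ?gt_eqF ?ltr0n//.
Qed.

End circle_average_L1.

Section smoothing_kernel.
Context {R : realType}.
Local Notation lam := (@lebesgueC R).

Lemma norm_Rintegral_le d (T : measurableType d) (m : {measure set T -> \bar R})
    (g : T -> R) (C : R) : measurable_fun setT g ->
  (\int[m]_x (`|g x|)%:E <= C%:E)%E -> `|\int[m]_x g x| <= C.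
Proof.
move=> mg gC.
have mgE : measurable_fun setT (EFin \o g) by exact/measurable_EFinP.
have ig : m.-integrable setT (EFin \o g).
  by apply/integrableP; split => //; apply: le_lt_trans (ltry C).
rewrite -lee_fin; apply: le_trans gC.
have -> : (`|\int[m]_x g x|%:E = `| \int[m]_x (g x)%:E |)%E.
  by rewrite /Rintegral -[in RHS](fineK (integrable_fin_num measurableT ig)).
exact: le_abse_integral.
Qed.

Lemma integrable_shiftC (a : R[i]) (f : R[i] -> \bar R) :
  lam.-integrable setT f -> lam.-integrable setT (fun u => f (u + a)).
Proof.
move=> /integrableP[mf If]; apply/integrableP; split.
  by apply: measurableT_comp mf _; exact: measurable_addC.
by rewrite (@ge0_integral_shiftC _ a (fun u => `|f u|)%E)//; exact: measurableT_comp.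
Qed.

Lemma Rintegral_shiftC (a : R[i]) (f : R[i] -> R) : measurable_fun setT f ->
  \int[lam]_u f (u + a) = \int[lam]_u f u.
Proof.
move=> mf; rewrite /Rintegral -(@integral_shiftC _ a (EFin \o f))//.
exact/measurable_EFinP.
Qed.

(* The circle mean of lg minus its value: a nonnegative mollifier supported in
   disc e. *)
Definition log_kernel (e : R) (v : R[i]) : R := lnmax e v - lg v.

Lemma measurable_log_kernel (e : R) : 0 < e -> measurable_fun setT (log_kernel e).
Proof.
by move=> e0; apply: measurable_funB; [exact: measurable_lnmax|exact: measurable_lg].
Qed.

Lemma log_kernel_out (e : R) v : e <= nc v -> log_kernel e v = 0.
Proof. by move=> ev; rewrite /log_kernel /lnmax max_l// subrr. Qed.

Lemma log_kernel_ge0 (e : R) v : v != 0 -> 0 <= log_kernel e v.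
Proof.
rewrite -nc_gt0 => v0; rewrite subr_ge0 ler_ln ?posrE ?lt_max ?v0//.
by rewrite le_max lexx.
Qed.

Lemma integrable_log_kernel (e : R) : 0 < e ->
  lam.-integrable setT (EFin \o log_kernel e).
Proof.
move=> e0; have := integrableZl measurableT (`|ln e| + 1) (integrable_disc_lg_sq e 0).
apply: le_integrable => //.
  by apply/measurable_EFinP; exact: measurable_log_kernel.
move=> v _ /=; rewrite subr0 lee_fin indicE.
have l0 := sqr_ge0 (lg v); have n0 := normr_ge0 (ln e).
case: (boolP (v \in disc e)) => [|ve].
  rewrite inE /disc /= => ve; rewrite mul1r /log_kernel /lnmax max_r//.
  rewrite [leRHS]ger0_norm; last by rewrite mulr_ge0 ?addr_ge0.
  apply: le_trans (ler_normB _ _) _; have := ler_norm_sqr1 (lg v); nra.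
rewrite log_kernel_out ?normr0//; move: ve; rewrite notin_setE => /negP.
by rewrite -ltNge => /ltW.
Qed.

Definition log_kernel_mass (e : R) : R := \int[lam]_v log_kernel e v.

(** The kernel is nonnegative except perhaps at 0, where the convention [lg 0 = 0] gives it the
    value ln e. *)
Lemma integral_abs_log_kernel (e : R) : 0 < e ->
  (\int[lam]_v `|log_kernel e v|%:E = (log_kernel_mass e)%:E)%E.
Proof.
move=> e0; rewrite fineK; last first.
  exact: (integrable_fin_num measurableT (integrable_log_kernel e0)).
have mk := measurable_log_kernel e0.
apply: ae_eq_integral => //.
- by apply/measurable_EFinP; exact: measurableT_comp.
- exact/measurable_EFinP.
exists [set 0]; split; first 1 last.
- exact: lebesgueC_set1.
- move=> v /= /not_implyP[_ kv]; apply: contra_notP kv => /eqP v0.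
  by rewrite ger0_norm// log_kernel_ge0.
- rewrite (_ : [set 0] = disc (0 : R)); first exact: measurable_disc.
  apply/seteqP; split => z /=; first by move=> ->; have /eqP := @nc0 R; rewrite eq_le => /andP[].
  by rewrite /disc /= => z0; apply/eqP; rewrite -nc_eq0 eq_le z0 nc_ge0.
Qed.

(** On the square [e/8, e/4]^2 one has |v| <= e/2, so the kernel is at least ln 2 there. *)
Lemma log_kernel_mass_gt0 (e : R) : 0 < e -> 0 < log_kernel_mass e.
Proof.
move=> e0; rewrite -lte_fin -integral_abs_log_kernel//.
pose S : set R[i] := [set v | `[e / 8, e / 4]%classic (complex.Re v) /\
  `[e / 8, e / 4]%classic (complex.Im v)].
have mS : measurable S.
  apply: measurableI; rewrite -[X in measurable X]setTI.
  - by apply: (continuous_measurableC (@continuous_Re R)).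
  - by apply: (continuous_measurableC (@continuous_Im R)).
have ln20 : 0 < ln (2 : R) by rewrite ln_gt0// ltr1n.
apply: (@lt_le_trans _ _ (\int[lam]_(v in S) (ln 2)%:E)%E).
  rewrite integral_cst//=; apply: mule_gt0; first by rewrite lte_fin.
  rewrite lebesgueC_product// lebesgue_measure_itv /= lte_fin.
  have e84 : e / 8 < e / 4 by lra.
  by rewrite e84 -EFinB -EFinM lte_fin mulr_gt0 ?subr_gt0.
have mak : measurable_fun setT (fun v : R[i] => `|log_kernel e v|%:E).
  by apply/measurable_EFinP; apply: measurableT_comp => //; exact: measurable_log_kernel.
apply: (@le_trans _ _ (\int[lam]_(v in S) `|log_kernel e v|%:E)%E); last first.
  by apply: ge0_subset_integral.
apply: ge0_le_integral => //.
- by move=> v _; rewrite lee_fin ltW.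
- exact: measurable_funTS.
move=> v [/=]; rewrite !in_itv /= => /andP[x1 x2] /andP[y1 y2].
have v2 : nc v <= e / 2.
  by apply: le_trans (nc_le_ReIm _) _; rewrite !ger0_norm; lra.
have v1 : 0 < nc v.
  by apply: lt_le_trans (Re_le_nc v); rewrite ger0_norm; lra.
rewrite lee_fin; apply: le_trans (ler_norm _).
rewrite /log_kernel /lnmax max_r; last lra.
rewrite -ln_div ?posrE// ler_ln ?posrE//; last by rewrite divr_gt0.
by rewrite ler_pdivlMr//; lra.
Qed.

End smoothing_kernel.

(** * Density of logarithmic potentials *)

Section potential_density.
Context {R : realType}.
Local Notation lam := (@lebesgueC R).

Definition logpot (F : R[i] -> R) (w : R[i]) : R := \int[lam]_u (F u * lg (u - w)).

(** A change of variables moves the translations from the density to the logarithm, where their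
    average over [s] is what [circle_error] measures. *)
Lemma logpot_sum_shift (f : R[i] -> R) (s : seq R[i]) (w : R[i]) :
  bounded_on_support f ->
  lam.-integrable setT (fun u => (f u * \sum_(a <- s) lg (u - w - a))%:E) /\
  logpot (fun u => \sum_(a <- s) f (u + a)) w =
  \int[lam]_u (f u * \sum_(a <- s) lg (u - w - a)).
Proof.
move=> bf; elim: s => [|a s [IHi IH]].
  split.
    by under eq_fun do rewrite big_nil mulr0; exact: integrable0.
  rewrite /logpot; apply: eq_Rintegral => u _.
  by rewrite !big_nil mul0r mulr0.
have ia : lam.-integrable setT (fun u => (f u * lg (u - w - a))%:E).
  by under eq_fun do rewrite -addrA -opprD; exact: bcs_integrable_lg.
have E : (fun u => f u * \sum_(b <- a :: s) lg (u - w - b)) =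
    (fun u => f u * lg (u - w - a) + f u * \sum_(b <- s) lg (u - w - b)).
  by apply/funext => u; rewrite big_cons mulrDr.
split.
  rewrite (_ : (fun _ => _) = EFin \o (fun u => f u * \sum_(b <- a :: s) lg (u - w - b)))//.
  by rewrite E; exact: (integrableD measurableT ia IHi).
rewrite E RintegralD// -IH.
have -> : \int[lam]_u (f u * lg (u - w - a)) = \int[lam]_u (f (u + a) * lg (u - w)).
  have mfa : measurable_fun setT (fun u => f u * lg (u - w - a)).
    by apply/measurable_EFinP; case/integrableP: ia.
  rewrite -(Rintegral_shiftC a mfa); apply: eq_Rintegral => u _.
  by congr (_ * lg _); ring.
rewrite /logpot -RintegralD//.
- by apply: eq_Rintegral => u _; rewrite big_cons mulrDl.
- by apply: bcs_integrable_lg; exact: bcs_shift.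
- by apply: bcs_integrable_lg; apply: bcs_sum => b; exact: bcs_shift.
Qed.

Lemma Rintegral_sum_shift (f : R[i] -> R) (s : seq R[i]) : bounded_on_support f ->
  \int[lam]_u (\sum_(a <- s) f (u + a)) = (size s)%:R * \int[lam]_u f u.
Proof.
move=> bf; elim: s => [|a s IH].
  rewrite mul0r /Rintegral integral0_eq// => u _; by rewrite big_nil.
rewrite (_ : (fun _ => _) = fun u => f (u + a) + \sum_(b <- s) f (u + b)); last first.
  by apply/funext => u; rewrite big_cons.
rewrite RintegralD//.
- by rewrite IH (Rintegral_shiftC a (bcs_measurable bf)) /= -natr1 addrC mulrDl mul1r.
- by apply: bcs_integrable; exact: bcs_shift.
- by apply: bcs_integrable; apply: bcs_sum => b; exact: bcs_shift.
Qed.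

(* F is a normalised discrete Laplacian of f, the mean of f over points of a
   small circle around u minus f u; its potential is close to the mollification
   of f by log_kernel. *)
Theorem logpot_dense (f : R[i] -> R) (M e r d : R) : continuous f ->
  (forall u, M < nc u -> f u = 0) -> 0 < e -> 0 < d ->
  exists F : R[i] -> R, [/\ bounded_on_support F,
    (forall u, F u != 0 -> exists2 u', nc (u' - u) <= e & f u' != 0),
    \int[lam]_u F u = 0 &
    forall w, nc w <= r -> `|f w - logpot F w| <= d].
Proof.
move=> cf fM e0 d0.
have d2 : 0 < d / 2 by rewrite divr_gt0.
have [d1 d10 fd1] := @unif_continuous_disc R f r cf _ d2.
(* The bound by [e] localises the support of F; the bound below [d1] makes f vary by less than d/2
   on the support of the kernel. *)
pose e' := Num.min (d1 / 2) e.
have e'0 : 0 < e' by rewrite lt_min e0 divr_gt0.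
have e'e : e' <= e by rewrite ge_min lexx orbT.
have e'd1 : e' < d1.
  by apply: (@le_lt_trans _ _ (d1 / 2)); [rewrite ge_min lexx|rewrite ltr_pdivrMr// ltr_pMr// ltr1n].
have [K K0 fK] := @bounded_on_disc R f M cf.
have fKM u : `|f u| <= K * \1_(disc M) u.
  rewrite indicE; case: (boolP (u \in disc M)) => [|uM]; first by rewrite inE mulr1; exact: fK.
  rewrite mulr0 fM ?normr0//; move: uM; rewrite notin_setE => /negP; by rewrite -ltNge.
have bf : bounded_on_support f.
  by split; [exact: continuous_measurableC|exists M, K].
pose c := log_kernel_mass e'.
have c0 : 0 < c by exact: log_kernel_mass_gt0.
have cd : 0 < c * (d / 2) / (K + 1) by rewrite divr_gt0 ?mulr_gt0// ltr_wpDl.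
(* [M + r] contains every u - w with u in the support of f and |w| <= r; [e'] is included because
   [circle_error_small] requires it. *)
pose rr := Num.max (M + r) e'.
have e'rr : e' <= rr by rewrite le_max lexx orbT.
have [s [s0 sw serr]] := circle_error_small e'0 e'rr cd.
have NR : (size s)%:R != 0 :> R by rewrite pnatr_eq0 -lt0n.
pose F u := c^-1 * ((size s)%:R^-1 * (\sum_(a <- s) f (u + a)) + (-1) * f u).
have bS : bounded_on_support (fun u => \sum_(a <- s) f (u + a)).
  by apply: bcs_sum => a; exact: bcs_shift.
have bF : bounded_on_support F.
  by apply: bcsZ; apply: bcsD; exact: bcsZ.
exists F; split => //.
- move=> u Fu; have [|fu] := eqVneq (f u) 0; last first.
    by exists u => //; rewrite subrr nc0 ltW.
  move=> fu; suff /hasP[a sa fa] : has (fun a => f (u + a) != 0) s.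
    by exists (u + a) => //; rewrite addrAC subrr add0r sw.
  apply: contraNT Fu => /hasPn H; rewrite /F fu mulr0 addr0 big_seq.
  by rewrite big1 ?mulr0// => a /H; rewrite negbK => /eqP.
- rewrite /F RintegralZl//; last by apply: bcs_integrable; apply: bcsD; exact: bcsZ.
  rewrite RintegralD//; try by apply: bcs_integrable; exact: bcsZ.
  rewrite !RintegralZl//; try exact: bcs_integrable.
  by rewrite Rintegral_sum_shift// mulKf// mulN1r subrr mulr0.
move=> w wr.
have [isum Esum] := logpot_sum_shift s w bf.
have ifw := bcs_integrable_lg w bf.
(* The mean of lg (u - w - a) over a in [s], minus lg (u - w), is the kernel plus the circle
   error. *)
have EF : logpot F w = c^-1 * \int[lam]_u (f u * (log_kernel e' (u - w) + circle_error e' s (u - w))).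
  rewrite /logpot (_ : (fun _ => _) = fun u => c^-1 * ((size s)%:R^-1 *
    ((\sum_(a <- s) f (u + a)) * lg (u - w)) + (-1) * (f u * lg (u - w)))); last first.
    by apply/funext => u; rewrite /F; ring.
  have iS := bcs_integrable_lg w bS.
  rewrite RintegralZl//; last first.
    exact: (integrableD measurableT (integrableZl measurableT _ iS) (integrableZl measurableT _ ifw)).
  congr (_ * _); rewrite RintegralD//; last 2 first.
  - exact: (integrableZl measurableT _ iS).
  - exact: (integrableZl measurableT _ ifw).
  rewrite !RintegralZl// -/(logpot _ w) Esum -RintegralZl// mulN1r -RintegralB//; last first.
    exact: (integrableZl measurableT _ isum).
  apply: eq_Rintegral => u _; rewrite /log_kernel /circle_error; ring.
have mk : measurable_fun setT (fun u : R[i] => log_kernel e' (u - w)).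
  by apply: measurableT_comp (measurable_log_kernel e'0) _; exact: measurable_subC.
have mce : measurable_fun setT (fun u : R[i] => circle_error e' s (u - w)).
  by apply: measurableT_comp (measurable_circle_error s e'0) _; exact: measurable_subC.
have mf := bcs_measurable bf.
have ik : lam.-integrable setT (fun u => (log_kernel e' (u - w))%:E).
  exact: (integrable_shiftC (- w) (integrable_log_kernel e'0)).
have icomb : lam.-integrable setT
    (fun u => (f u * (log_kernel e' (u - w) + circle_error e' s (u - w)))%:E).
  rewrite (_ : (fun _ => _) = (fun u => ((size s)%:R^-1)%:E *
      (f u * \sum_(a <- s) lg (u - w - a))%:E - (f u * lg (u - w))%:E)%E); last first.
    apply/funext => u; rewrite -EFinM -EFinB; congr (_%:E).
    by rewrite /log_kernel /circle_error; ring.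
  by apply: integrableB => //; exact: (integrableZl measurableT _ isum).
have Ew : c * f w = \int[lam]_u (f w * log_kernel e' (u - w)).
  rewrite RintegralZl// mulrC (Rintegral_shiftC (- w))//; exact: measurable_log_kernel.
rewrite -(ler_pM2l c0) -[X in X * `|_|](ger0_norm (ltW c0)) -normrM mulrBr EF.
rewrite mulVKf ?gt_eqF// Ew -RintegralB//; last exact: (integrableZl measurableT _ ik).
have mcomb : measurable_fun setT (fun u : R[i] => f w * log_kernel e' (u - w) -
    f u * (log_kernel e' (u - w) + circle_error e' s (u - w))).
  apply: measurable_funB; first exact: measurable_funM.
  by apply: measurable_funM => //; exact: measurable_funD.
apply: norm_Rintegral_le => //.
(* Two errors of at most c * d / 2 each: the oscillation of f weighted by the kernel, of mass c, and
   the circle error weighted by the bound K of f. *)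
apply: (@le_trans _ _ (\int[lam]_u ((d / 2)%:E * `|log_kernel e' (u - w)|%:E +
    K%:E * (\1_(disc rr) (u - w) * `|circle_error e' s (u - w)|)%:E))%E).
  apply: ge0_le_integral => //.
  - apply/measurable_EFinP; exact: measurableT_comp.
  - apply: emeasurable_funD; apply: measurable_funeM; apply/measurable_EFinP.
      exact: measurableT_comp.
    apply: measurable_funM; last exact: measurableT_comp.
    apply: (measurableT_comp (f := \1_(disc rr) : R[i] -> R)); last exact: measurable_subC.
    by apply: measurable_indic; exact: measurable_disc.
  move=> u _; rewrite -!EFinM -EFinD lee_fin.
  rewrite (_ : _ - _ = (f w - f u) * log_kernel e' (u - w) - f u * circle_error e' s (u - w)); last by ring.
  apply: le_trans (ler_normB _ _) _; rewrite !normrM; apply: lerD.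
    have [ue|ue] := ltP (nc (u - w)) e'; last by rewrite log_kernel_out// normr0 !mulr0.
    rewrite ler_wpM2r//; apply: ltW; apply: fd1 => //.
    by rewrite ncB; exact: lt_trans e'd1.
  rewrite mulrA ler_wpM2r//; apply: le_trans (fKM u) _; rewrite ler_wpM2l// !indicE.
  case: (boolP (u \in disc M)) => [|_]; last exact: ler0n.
  rewrite inE => uM; rewrite mem_set// /disc /=; apply: le_trans (nc_subr _ _) _.
  by rewrite le_max lerD.
rewrite ge0_integralD//; last 4 first.
- by move=> u _; rewrite mule_ge0 ?lee_fin ?(ltW d2).
- by apply: measurable_funeM; apply/measurable_EFinP; exact: measurableT_comp.
- by move=> u _; rewrite mule_ge0 ?lee_fin// mulr_ge0.
- apply: measurable_funeM; apply/measurable_EFinP.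
  apply: measurable_funM; last exact: measurableT_comp.
  apply: (measurableT_comp (f := \1_(disc rr) : R[i] -> R)); last exact: measurable_subC.
  by apply: measurable_indic; exact: measurable_disc.
have mak : measurable_fun setT (fun v : R[i] => `|log_kernel e' v|%:E).
  by apply/measurable_EFinP; apply: measurableT_comp => //; exact: measurable_log_kernel.
have mace : measurable_fun setT (fun v : R[i] => (\1_(disc rr) v * `|circle_error e' s v|)%:E).
  apply/measurable_EFinP; apply: measurable_funM.
    by apply: measurable_indic; exact: measurable_disc.
  by apply: measurableT_comp => //; exact: measurable_circle_error.
have -> : (c * d)%:E = ((c * (d / 2))%:E + (c * (d / 2))%:E)%E.
  by rewrite -EFinD; congr (_%:E); field.
apply: leeD.
  rewrite ge0_integralZl_EFin ?(ltW d2)//; last first.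
    by apply/measurable_EFinP; exact: measurableT_comp.
  rewrite (@ge0_integral_shiftC _ (- w) (fun v : R[i] => `|log_kernel e' v|%:E))//.
  by rewrite integral_abs_log_kernel// -EFinM mulrC.
rewrite ge0_integralZl_EFin//; last first.
  apply/measurable_EFinP.
  apply: measurable_funM; last exact: measurableT_comp.
  apply: (measurableT_comp (f := \1_(disc rr) : R[i] -> R)); last exact: measurable_subC.
  by apply: measurable_indic; exact: measurable_disc.
rewrite (@ge0_integral_shiftC _ (- w) (fun v : R[i] => (\1_(disc rr) v * `|circle_error e' s v|)%:E))//.
have -> : (\int[lam]_u (\1_(disc rr) u * `|circle_error e' s u|)%:E =
    \int[lam]_(u in disc rr) `|circle_error e' s u|%:E)%E.
  rewrite [RHS]integral_mkcond; apply: eq_integral => u _; rewrite patchE indicE.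
  by case: ifP => _; rewrite ?mul1r ?mul0r.
apply: (@le_trans _ _ (K%:E * (c * (d / 2) / (K + 1))%:E)%E).
  by rewrite lee_wpmul2l// lee_fin.
rewrite -EFinM lee_fin; have cd0 : 0 <= c * (d / 2) by rewrite mulr_ge0 ?(ltW c0) ?(ltW d2).
rewrite mulrCA; apply: ler_piMr => //.
by rewrite ler_pdivrMr ?mul1r ?lerDl// ltr_wpDl.
Qed.

End potential_density.

(** * Positive functionals supported on a disc *)

Section continuous_functions.
Context {R : realType}.
Implicit Types f g : R[i] -> R.

Lemma continuous_cstC (c : R) : continuous (fun _ : R[i] => c).
Proof. by move=> u; exact: cst_continuous. Qed.

Lemma continuous_addC f g : continuous f -> continuous g ->
  continuous (fun u => f u + g u).
Proof. by move=> cf cg u; exact: (continuousD (cf u) (cg u)). Qed.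

Lemma continuous_mulC f g : continuous f -> continuous g ->
  continuous (fun u => f u * g u).
Proof. by move=> cf cg u; exact: (continuousM (cf u) (cg u)). Qed.

Lemma continuous_subC f g : continuous f -> continuous g ->
  continuous (fun u => f u - g u).
Proof. by move=> cf cg u; exact: (continuousB (cf u) (cg u)). Qed.

Lemma continuous_minC f g : continuous f -> continuous g ->
  continuous (fun u => Num.min (f u) (g u)).
Proof. by move=> cf cg u; exact: (continuous_min (cf u) (cg u)). Qed.

Lemma continuous_sumC (I : Type) (s : seq I) (F : I -> R[i] -> R) :
  (forall i, continuous (F i)) -> continuous (fun u => \sum_(i <- s) F i u).
Proof.
move=> cF; elim: s => [|i s IH].
  by under eq_fun do rewrite big_nil; exact: continuous_cstC.
rewrite (_ : (fun _ => _) = fun u => F i u + \sum_(j <- s) F j u).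
  exact: continuous_addC.
by apply/funext => u; rewrite big_cons.
Qed.

(** The distance to the complement, or the constant 1 when the complement is empty. *)
Lemma open_distance (U : set R[i]) : open U -> exists dist : R[i] -> R,
  [/\ continuous dist, (forall u, 0 <= dist u) & forall u, U u <-> 0 < dist u].
Proof.
move=> oU; have [[w0 Uw0]|/forallNP Uall] := pselect (exists w, ~ U w); last first.
  exists (fun=> 1); split => //; first exact: continuous_cstC.
  by move=> u; split => // _; apply: contrapT; exact: Uall.
pose S u : set R := [set nc (u - w) | w in ~` U].
have hS u : has_inf (S u).
  by split; [exists (nc (u - w0)); exists w0|exists 0 => _ [w _ <-]; exact: nc_ge0].
pose dist u := inf (S u).
have distle u w : ~ U w -> dist u <= nc (u - w).
  by move=> Uw; apply: (ge_inf (hS u).2); exists w.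
have lip u v : dist u <= dist v + nc (u - v).
  rewrite -lerBlDr; apply: lb_le_inf; first exact: (hS v).1.
  move=> _ [w Uw <-]; rewrite lerBlDr addrC; apply: le_trans (distle _ _ Uw) _.
  exact: nc_triangleB.
have dist0 u : 0 <= dist u.
  by apply: lb_le_inf; [exact: (hS u).1|move=> _ [w _ <-]; exact: nc_ge0].
exists dist; split => //.
  apply: (@lipschitz_nc_continuous _ _ 1) => u v; rewrite mul1r ler_norml.
  by have := lip u v; have := lip v u; rewrite ncB => *; apply/andP; split; lra.
move=> u; split => [Uu|du].
  have [e e0 eU] := (open_ncP U).1 oU u Uu.
  apply: lt_le_trans e0 _; apply: lb_le_inf; first exact: (hS u).1.
  by move=> _ [w Uw <-]; rewrite leNgt; apply/negP => /eU.
apply: contrapT => /(distle u); rewrite subrr nc0 => ud.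
by have := lt_le_trans du ud; rewrite ltxx.
Qed.

End continuous_functions.

Section positive_functional.
Context {R : realType} (r : R) (Lam : (R[i] -> R) -> R).
Context (LamD : forall f g : R[i] -> R, continuous f -> continuous g ->
  Lam (fun u => f u + g u) = Lam f + Lam g).
Context (LamZ : forall (c : R) (f : R[i] -> R), continuous f -> Lam (fun u => c * f u) = c * Lam f).
(** Testing positivity on [disc r] alone encodes that the functional is carried by that compact
    disc, so no mass escapes to infinity. *)
Context (Lam_ge0 : forall f : R[i] -> R, continuous f -> (forall u, nc u <= r -> 0 <= f u) -> 0 <= Lam f).
Context (Lam1 : Lam (fun=> 1) = 1).

Let LamB (f g : R[i] -> R) : continuous f -> continuous g ->
  Lam (fun u => f u - g u) = Lam f - Lam g.
Proof.
move=> cf cg; have cNg : continuous (fun u => (-1) * g u).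
  by apply: continuous_mulC => //; exact: continuous_cstC.
rewrite -mulN1r -LamZ// -LamD//; congr Lam; apply/funext => u; by rewrite mulN1r.
Qed.

Let Lam_le (f g : R[i] -> R) : continuous f -> continuous g ->
  (forall u, nc u <= r -> f u <= g u) -> Lam f <= Lam g.
Proof.
move=> cf cg fg; rewrite -subr_ge0 -LamB//; apply: Lam_ge0.
  exact: continuous_subC.
by move=> u /fg; rewrite subr_ge0.
Qed.

Let Lam_cst c : Lam (fun=> c) = c.
Proof.
have := LamZ c (@continuous_cstC R 1); rewrite Lam1 mulr1 => {2}<-.
by congr Lam; apply/funext => u; rewrite mulr1.
Qed.

(** The increasing limit of [g] is at least 1 on [E]; it need not be reached at any finite index. *)
Definition exhausts (E : set R[i]) (g : nat -> R[i] -> R) :=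
  [/\ forall n, continuous (g n), forall n u, 0 <= g n u,
      forall m n u, (m <= n)%N -> g m u <= g n u &
      forall u, E u -> forall t, t < 1 -> exists n, t < g n u].

Definition exhaustion_values (E : set R[i]) : set R :=
  [set c | exists2 g, exhausts E g & forall n, Lam (g n) <= c].

(* Approximating by increasing sequences of continuous functions, rather than by
   a single one, makes the outer measure countably subadditive. *)
Definition riesz_outer (E : set R[i]) : \bar R := (inf (exhaustion_values E))%:E.

Let has_inf_values E : has_inf (exhaustion_values E).
Proof.
split; last first.
  exists 0 => c [g [cg g0 _ _] gc]; apply: le_trans (gc 0%N).
  by apply: Lam_ge0 => // u _; exact: g0.
exists 1; exists (fun _ _ => 1); last by move=> n; rewrite Lam1.
by split => // [n|u _ t t1]; [exact: continuous_cstC|exists 0%N].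
Qed.

Let outer_le E c : exhaustion_values E c -> (riesz_outer E <= c%:E)%E.
Proof. by move=> Ec; rewrite lee_fin; apply: (ge_inf (has_inf_values E).2). Qed.

Let outer_approx E (e : R) : 0 < e -> exists2 g, exhausts E g &
  forall n, Lam (g n) <= inf (exhaustion_values E) + e.
Proof.
move=> e0; have [c [g gE gc] ce] := inf_adherent e0 (has_inf_values E).
by exists g => // n; apply: le_trans (gc n) (ltW ce).
Qed.

Let riesz_outer_ge0 E : (0 <= riesz_outer E)%E.
Proof.
rewrite lee_fin; apply: lb_le_inf; first exact: (has_inf_values E).1.
move=> c [g [cg g0 _ _] gc]; apply: le_trans (gc 0%N).
by apply: Lam_ge0 => // u _; exact: g0.
Qed.

Let riesz_outer0 : riesz_outer set0 = 0%E.
Proof.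
apply/eqP; rewrite eq_le riesz_outer_ge0 andbT; apply: outer_le.
exists (fun _ _ => 0); last by move=> n; rewrite Lam_cst.
by split => // n; exact: continuous_cstC.
Qed.

Let le_riesz_outer : {homo riesz_outer : A B / A `<=` B >-> (A <= B)%E}.
Proof.
move=> A B AB; rewrite lee_fin; apply: lb_le_inf; first exact: (has_inf_values B).1.
move=> c [g [cg g0 gm gB] gc]; apply: (ge_inf (has_inf_values A).2).
by exists g => //; split => // u /AB /gB.
Qed.

Let LamS (I : Type) (s : seq I) (F : I -> R[i] -> R) :
  (forall i, continuous (F i)) ->
  Lam (fun u => \sum_(i <- s) F i u) = \sum_(i <- s) Lam (F i).
Proof.
move=> cF; elim: s => [|i s IH].
  rewrite big_nil -[RHS](Lam_cst 0); congr Lam; apply/funext => u; by rewrite big_nil.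
rewrite big_cons -IH -LamD//; last exact: continuous_sumC.
by congr Lam; apply/funext => u; rewrite big_cons.
Qed.

(** Near-optimal exhaustions of the [F i], with errors e / 2^(i+1), combine diagonally: the n-th
    function sums the first n exhaustions taken at index n, and is increasing in n. *)
Let riesz_outer_sigma_subadditive : sigma_subadditive riesz_outer.
Proof.
move=> F; apply/lee_addgt0Pr => e e0.
pose v i := inf (exhaustion_values (F i)).
have e2 i : 0 < e / (2 ^ i.+1)%:R by rewrite divr_gt0// ltr0n expn_gt0.
have /choice[g gP] : forall i, exists g : nat -> R[i] -> R, exhausts (F i) g /\
    forall n, Lam (g n) <= v i + e / (2 ^ i.+1)%:R.
  by move=> i; have [g g1 g2] := outer_approx (F i) (e2 i); exists g.
apply: le_trans (epsilon_trick xpredT _ (ltW e0)); last by move=> i; exact: riesz_outer_ge0.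
have term0 i : (0 <= riesz_outer (F i) + (e / (2 ^ i.+1)%:R)%:E)%E.
  by rewrite adde_ge0// lee_fin ltW.
set S := (X in (_ <= X)%E).
have [Sfin|Soo] := boolP (S \is a fin_num); last first.
  suff -> : S = +oo%E by rewrite leey.
  have S0 : (0 <= S)%E by apply: nneseries_ge0.
  by apply/eqP; rewrite -leye_eq leNgt -ge0_fin_numE.
rewrite -(fineK Sfin); apply: outer_le.
pose G n u := \sum_(0 <= i < n) g i n u.
have cG n : continuous (G n).
  by apply: continuous_sumC => i; have [[]] := gP i.
exists G.
  split => //.
  - by move=> n u; apply: sumr_ge0 => i _; have [[]] := gP i.
  - move=> m n u mn; rewrite /G [leRHS](big_cat_nat (n := m))//=.
    rewrite -[leLHS]addr0; apply: lerD; last first.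
      by apply: sumr_ge0 => i _; have [[]] := gP i.
    by apply: ler_sum => i _; have [[_ _ + _] _] := gP i; exact.
  - move=> u [i _ Fiu] t t1; have [[_ _ gm gF] _] := gP i.
    have [n tn] := gF u Fiu t t1.
    exists (maxn n i.+1); apply: (lt_le_trans tn).
    apply: le_trans (gm n (maxn n i.+1) u (leq_maxl _ _)) _.
    rewrite /G big_mkord.
    have im : (i < maxn n i.+1)%N by rewrite leq_max ltnSn orbT.
    rewrite (bigD1 (Ordinal im))//= lerDl; apply: sumr_ge0 => j _.
    by have [[]] := gP j.
move=> n; rewrite LamS; last by move=> i; have [[]] := gP i.
rewrite -lee_fin fineK// -sumEFin.
apply: le_trans (nneseries_lim_ge n _) => //.
apply: lee_sum => i _; rewrite -EFinD lee_fin; have [_] := gP i; exact.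
Qed.

HB.instance Definition _ := isOuterMeasure.Build R R[i] riesz_outer
  riesz_outer0 riesz_outer_ge0 le_riesz_outer riesz_outer_sigma_subadditive.

(** The functions [h j] = min(1, j dist) increase to the indicator of [U]. A near-optimal exhaustion
    [g] of [E] splits into g n * h n, which exhausts E inside U, and g n * (1 - h j) with [j]
    frozen, which exhausts E outside U. *)
Let open_caratheodory (U : set R[i]) : open U -> caratheodory_measurable riesz_outer U.
Proof.
move=> oU; apply: le_caratheodory_measurable => E.
apply/lee_addgt0Pr => e e0.
have e20 : 0 < e / 2 by rewrite divr_gt0.
have [g [cg g0 gm gE] gc] := outer_approx E e20.
set c := inf _ + _ in gc.
have [dist [cdist dist0 distU]] := open_distance oU.
pose h (j : nat) u := Num.min 1 (j%:R * dist u).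
have ch j : continuous (h j).
  apply: continuous_minC; first exact: continuous_cstC.
  by apply: continuous_mulC => //; exact: continuous_cstC.
have h0 j u : 0 <= h j u by rewrite le_min ler01 mulr_ge0.
have h1 j u : h j u <= 1 by rewrite ge_min lexx.
have hm i j u : (i <= j)%N -> h i u <= h j u.
  by move=> ij; rewrite /h le_min2// ler_wpM2r// ler_nat.
have hU u : U u -> exists j0, forall j, (j0 <= j)%N -> h j u = 1.
  move=> /distU du; exists (Num.truncn (dist u)^-1).+1 => j jd.
  rewrite /h min_l// -ler_pdivrMr// div1r ltW//.
  apply: (@lt_le_trans _ _ (Num.truncn (dist u)^-1).+1%:R); last by rewrite ler_nat.
  by rewrite truncnS_gt// invr_ge0.
have hNU j u : ~ U u -> h j u = 0.
  move=> Uu; have du : dist u = 0.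
    by apply/eqP; rewrite eq_le dist0 andbT leNgt; apply/negP => /distU.
  by rewrite /h du mulr0 min_r.
have cgh j n : continuous (fun u => g n u * h j u) by exact: continuous_mulC.
pose a := sup [set Lam (fun u => g n u * h n u) | n in [set: nat]].
have hsup : has_sup [set Lam (fun u => g n u * h n u) | n in [set: nat]].
  split; first by exists (Lam (fun u => g 0%N u * h 0%N u)); exists 0%N.
  exists c => _ [n _ <-]; apply: le_trans (gc n); apply: Lam_le => // u _.
  by rewrite ler_piMr.
have EU : (riesz_outer (E `&` U) <= a%:E)%E.
  apply: outer_le; exists (fun n u => g n u * h n u); last first.
    by move=> n; apply: (ub_le_sup hsup.2); exists n.
  split => //.
  - by move=> n u; rewrite mulr_ge0.
  - by move=> m n u mn; rewrite ler_pM//; [exact: gm|exact: hm].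
  - move=> u [Eu Uu] t t1; have [n tn] := gE u Eu t t1.
    have [j0 hj] := hU u Uu; exists (maxn n j0).
    rewrite hj ?leq_maxr// mulr1; apply: lt_le_trans tn _.
    by apply: gm; rewrite leq_maxl.
(* Freezing [j] where Lam (g j * h j) is within e/2 of its supremum [a] bounds the outer part by c -
   a + e/2; monotonicity passes to the index maxn n j. *)
have [_ [j _ <-] aj] := sup_adherent e20 hsup; rewrite -/a in aj.
have ENU : (riesz_outer (E `&` ~` U) <= (c - a + e / 2)%:E)%E.
  apply: outer_le; exists (fun n u => g n u * (1 - h j u)).
    split.
    - move=> n; apply: continuous_mulC => //; apply: continuous_subC => //.
      exact: continuous_cstC.
    - by move=> n u; rewrite mulr_ge0// subr_ge0.
    - by move=> m n u mn; rewrite ler_wpM2r ?subr_ge0//; exact: gm.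
    - move=> u [Eu Uu] t t1; have [n tn] := gE u Eu t t1.
      by exists n; rewrite hNU// subr0 mulr1.
  move=> n; apply: (@le_trans _ _ (Lam (fun u => g (maxn n j) u * (1 - h j u)))).
    apply: Lam_le; do ?[apply: continuous_mulC => //; apply: continuous_subC => //;
      exact: continuous_cstC].
    by move=> u _; rewrite ler_wpM2r ?subr_ge0//; apply: gm; rewrite leq_maxl.
  rewrite (_ : (fun u => _) = fun u => g (maxn n j) u - g (maxn n j) u * h j u); last first.
    by apply/funext => u; rewrite mulrBr mulr1.
  rewrite LamB//.
  have : Lam (fun u => g j u * h j u) <= Lam (fun u => g (maxn n j) u * h j u).
    by apply: Lam_le => // u _; rewrite ler_wpM2r//; apply: gm; rewrite leq_maxr.
  by have := gc (maxn n j); lra.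
apply: le_trans (leeD EU ENU) _; rewrite -!EFinD lee_fin /c.
by rewrite /c; set v := inf _; lra.
Qed.

Let borel_caratheodory (A : set R[i]) : measurable A -> caratheodory_measurable riesz_outer A.
Proof.
suff sub : <<s @open R[i] >> `<=` caratheodory_measurable riesz_outer by exact: sub.
apply: smallest_sub => //; split; first exact: caratheodory_measurable_set0.
- by move=> B mB; rewrite setTD; exact: caratheodory_measurable_setC.
- by move=> F mF; exact: caratheodory_measurable_bigcup.
Qed.

Let riesz_sigma_additive : semi_sigma_additive (riesz_outer : set R[i] -> \bar R).
Proof.
move=> F mF tF mUF.
apply: (@caratheodory_measure_sigma_additive R R[i] riesz_outer) => //.
  by move=> i; exact: borel_caratheodory.
exact: borel_caratheodory.
Qed.

HB.instance Definition _ := isMeasure.Build _ _ _ (riesz_outer : set R[i] -> \bar R)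
  riesz_outer0 riesz_outer_ge0 riesz_sigma_additive.

(** A Dini argument: wherever f is positive an exhaustion eventually exceeds f - e, so by
    compactness of the disc and monotonicity one index [n] has f < g n + e on all of it, and Lam
    looks no further. *)
Let Lam_le_outer (E : set R[i]) (f : R[i] -> R) : continuous f ->
  (forall u, f u <= 1) -> (forall u, 0 < f u -> E u) -> ((Lam f)%:E <= riesz_outer E)%E.
Proof.
move=> cf f1 fE; rewrite lee_fin; apply: lb_le_inf; first exact: (has_inf_values E).1.
move=> c [g [cg g0 gm gE] gc]; apply/ler_addgt0Pr => e e0.
have ncov := (compact_near_coveringP _).1 (@compact_disc R r).
have : \forall n \near \oo, disc r `<=` (fun u => f u < g n u + e).
  apply: ncov => u _.
  have [n fgn] : exists n, f u < g n u + e.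
    have [/fE Eu|fu0] := ltP 0 (f u); last first.
      by exists 0%N; apply: le_lt_trans fu0 _; rewrite ltr_wpDl.
    have [n ?] := gE u Eu (f u - e) ltac:(by have := f1 u; lra).
    by exists n; lra.
  have cgf : continuous (fun u => g n u + e - f u).
    by apply: continuous_subC => //; apply: continuous_addC => //; exact: continuous_cstC.
  have gap : 0 < g n u + e - f u by rewrite subr_gt0.
  have [d d0 dP] := (cvg_ncP _ u).1 (cgf u) _ gap.
  exists ([set v | nc (u - v) < d], [set m | (n <= m)%N]) => /=.
    split; last by exists n.
    by apply/nbhs_ncP; exists d.
  move=> [v m] [/= /dP uv nm]; have := gm n m v nm.
  have := ler_norm (g n u + e - f u - (g n v + e - f v)); lra.
move=> [n _ /(_ n (leqnn n)) nP].
apply: le_trans (_ : Lam (fun u => g n u + e) <= _).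
  apply: Lam_le => // [|u ur]; last by apply: ltW; exact: nP.
  by apply: continuous_addC => //; exact: continuous_cstC.
rewrite LamD//; last exact: continuous_cstC.
by rewrite Lam_cst lerD2r.
Qed.

Let riesz_outerT : riesz_outer [set: R[i]] = 1%E.
Proof.
apply/eqP; rewrite eq_le; apply/andP; split.
  apply: outer_le; exists (fun _ _ => 1); last by move=> n; rewrite Lam1.
  by split => // [n|u _ t t1]; [exact: continuous_cstC|exists 0%N].
rewrite -Lam1; apply: Lam_le_outer => //; exact: continuous_cstC.
Qed.

HB.instance Definition _ := Measure_isProbability.Build _ _ _
  (riesz_outer : set R[i] -> \bar R) riesz_outerT.

Let nu : probability R[i] R := riesz_outer.

Let integrable_nu (f : R[i] -> R) (K : R) : continuous f -> (forall u, `|f u| <= K) ->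
  nu.-integrable setT (EFin \o f).
Proof.
move=> cf fK; apply: measurable_bounded_integrable => //.
- by rewrite [X in (X < _)%E]riesz_outerT ltry.
- exact: continuous_measurableC.
- by exists K; split; [exact: num_real|move=> M KM u _; apply: le_trans (fK u) (ltW KM)].
Qed.

Let superlevel (f : R[i] -> R) (t : R) : set R[i] := [set u | t < f u].

Let measurable_superlevel (f : R[i] -> R) (t : R) : continuous f ->
  measurable (superlevel f t).
Proof.
move=> cf; rewrite -[superlevel f t]setTI.
have := continuous_measurableC cf measurableT (measurable_itv `]t, +oo[).
by congr measurable; apply/seteqP; split => u /= -[_]; rewrite in_itv /= andbT.
Qed.

(** Slice f into m layers of height q = 1/m. Layer i satisfies Lam (F i) <= q nu(f > iq) by
    [Lam_le_outer], while its integral is at least q nu(f > (i+1)q). The two sums telescope to a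
    difference of at most q. *)
Let Lam_le_integral (f : R[i] -> R) : continuous f -> (forall u, 0 <= f u <= 1) ->
  Lam f <= \int[nu]_u f u.
Proof.
move=> cf f01; apply/ler_addgt0Pr => e e0.
pose m := (Num.truncn e^-1).+1; pose q : R := m%:R^-1.
have m0 : 0 < m%:R :> R by rewrite ltr0n.
have q0 : 0 < q by rewrite invr_gt0.
have qe : q <= e.
  rewrite /q -[leRHS]invrK lef_pV2 ?posrE ?invr_gt0//.
  by rewrite ltW// truncnS_gt// invr_ge0 ltW.
have qm : m%:R * q = 1 by rewrite mulfV// gt_eqF.
pose F (i : nat) u := Num.min (f u) (i.+1%:R * q) - Num.min (f u) (i%:R * q).
have cF i : continuous (F i).
  by apply: continuous_subC; apply: continuous_minC => //; exact: continuous_cstC.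
have iq (i : nat) : i%:R * q <= i.+1%:R * q by rewrite ler_wpM2r ?(ltW q0)// ler_nat.
have iq1 (i : nat) : i.+1%:R * q = i%:R * q + q by rewrite -natr1 mulrDl mul1r.
have F0 i u : 0 <= F i u by rewrite subr_ge0 le_min2.
have Fq i u : F i u <= q.
  rewrite /F; have := iq1 i; have := q0; rewrite /Num.min; case: (ltP (f u) (i.+1%:R * q)) => ?; case: (ltP (f u) (i%:R * q)) => ? *; lra.
have Fpos i u : 0 < F i u -> i%:R * q < f u.
  rewrite /F; have := iq1 i; have := q0; rewrite /Num.min; case: (ltP (f u) (i.+1%:R * q)) => ?; case: (ltP (f u) (i%:R * q)) => ? *; lra.
have Ftop i u : i.+1%:R * q < f u -> F i u = q.
  rewrite /F; have := iq i; have := iq1 i; rewrite /Num.min; case: (ltP (f u) (i.+1%:R * q)) => ?; case: (ltP (f u) (i%:R * q)) => ? *; lra.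
have fF u : f u = \sum_(0 <= i < m) F i u.
  have /andP[fu0 fu1] := f01 u.
  by rewrite telescope_sumr// qm mul0r min_l// min_r// subr0.
pose v i := fine (nu (superlevel f (i%:R * q))).
have vE i : nu (superlevel f (i%:R * q)) = (v i)%:E.
  by rewrite fineK// fin_num_measure//; exact: measurable_superlevel.
have v01 i : 0 <= v i <= 1.
  by rewrite -!lee_fin -vE measure_ge0 probability_le1//; exact: measurable_superlevel.
have LF i : Lam (F i) <= q * v i.
  rewrite -ler_pdivrMl//.
  have -> : q^-1 * Lam (F i) = Lam (fun u => q^-1 * F i u) by rewrite LamZ.
  rewrite -lee_fin -vE; apply: Lam_le_outer.
  - by apply: continuous_mulC => //; exact: continuous_cstC.
  - by move=> u; rewrite ler_pdivrMl// mulr1.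
  - by move=> u; rewrite pmulr_rgt0 ?invr_gt0//; exact: Fpos.
have mF i : measurable_fun setT (fun u => (F i u)%:E).
  by apply/measurable_EFinP; exact: continuous_measurableC.
have IF i : ((q * v i.+1)%:E <= \int[nu]_u (F i u)%:E)%E.
  rewrite EFinM -vE; have mS := measurable_superlevel (i.+1%:R * q) cf.
  rewrite -integral_cst//.
  apply: (@le_trans _ _ (\int[nu]_(u in superlevel f (i.+1%:R * q)) (F i u)%:E)%E).
    apply: ge0_le_integral => //; first by move=> u _; rewrite lee_fin ltW.
      exact: measurable_funTS.
    by move=> u /Ftop ->.
  by apply: ge0_subset_integral => //= u _; rewrite lee_fin.
have If : (\int[nu]_u f u)%:E = (\sum_(0 <= i < m) \int[nu]_u (F i u)%:E)%E.
  rewrite /Rintegral fineK; last first.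
    apply: integrable_fin_num => //; apply: (@integrable_nu f 1) => // u.
    by have /andP[fu0 fu1] := f01 u; rewrite ger0_norm.
  rewrite -ge0_integral_sum//; last by move=> i u _; rewrite lee_fin.
  by apply: eq_integral => u _; rewrite fF sumEFin.
have vsum : q * \sum_(0 <= i < m) v i.+1 <= \int[nu]_u f u.
  rewrite -lee_fin If mulr_sumr -sumEFin; apply: lee_sum => i _; exact: IF.
have Lsum : Lam f <= q * \sum_(0 <= i < m) v i.
  rewrite (_ : f = fun u => \sum_(0 <= i < m) F i u); last exact/funext.
  by rewrite LamS// mulr_sumr; apply: ler_sum => i _; exact: LF.
have tel : \sum_(0 <= i < m) v i - \sum_(0 <= i < m) v i.+1 = v 0%N - v m.
  rewrite -sumrB -[RHS]opprB -telescope_sumr// -sumrN.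
  by apply: eq_bigr => i _; rewrite opprB.
have vv : v 0%N - v m <= 1 by have /andP[? ?] := v01 0%N; have /andP[? ?] := v01 m; lra.
have : q * (\sum_(0 <= i < m) v i - \sum_(0 <= i < m) v i.+1) <= q.
  by rewrite tel ler_piMr// ltW.
rewrite mulrBr; lra.
Qed.

Theorem riesz_probability : exists m : probability R[i] R,
  forall f : R[i] -> R, continuous f -> (exists M, forall u, `|f u| <= M) ->
    \int[m]_u f u = Lam f.
Proof.
exists nu => f cf [K fK].
have K0 : 0 <= K by apply: le_trans (fK 0).
have K1 : 0 < 2 * K + 1 by lra.
(* The reverse inequality comes from applying [Lam_le_integral] to 1 - h. *)
have Inu (h : R[i] -> R) : continuous h -> (forall u, 0 <= h u <= 1) -> \int[nu]_u h u = Lam h.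
  move=> ch h01; apply/eqP; rewrite eq_le Lam_le_integral// andbT.
  have c1h : continuous (fun u => 1 - h u).
    by apply: continuous_subC => //; exact: continuous_cstC.
  have := Lam_le_integral c1h.
  rewrite LamB//; last exact: continuous_cstC.
  rewrite Lam1 RintegralB//; last 2 first.
  - by apply: (@integrable_nu _ 1) => [|u]; [exact: continuous_cstC|rewrite normr1].
  - apply: (@integrable_nu _ 1) => // u; by have /andP[? ?] := h01 u; rewrite ger0_norm.
  rewrite Rintegral_cst// mul1r.
  have -> : fine (nu setT) = 1 by rewrite probability_setT.
  move=> H; have : 1 - Lam h <= 1 - \int[nu]_x h x.
    by apply: H => u; have /andP[? ?] := h01 u; apply/andP; split; lra.
  by rewrite lerD2l lerN2.
(* An affine rescaling brings a bounded f into [0, 1]; the +1 keeps the factor positive when K =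
   0. *)
pose h u := (2 * K + 1)^-1 * (f u + K).
have ch : continuous h.
  apply: continuous_mulC; first exact: continuous_cstC.
  by apply: continuous_addC => //; exact: continuous_cstC.
have h01 u : 0 <= h u <= 1.
  have := fK u; rewrite ler_norml => /andP[? ?].
  by rewrite /h; apply/andP; split; [rewrite mulr_ge0 ?invr_ge0; lra|rewrite ler_pdivrMl//; lra].
have fh : f = fun u => (2 * K + 1) * h u - K.
  by apply/funext => u; rewrite /h mulVKf ?gt_eqF// addrK.
have ih : nu.-integrable setT (EFin \o h).
  by apply: (@integrable_nu _ 1) => // u; have /andP[? ?] := h01 u; rewrite ger0_norm.
rewrite {}fh RintegralB//; last 2 first.
- exact: (integrableZl measurableT _ ih).
- apply: (@integrable_nu _ `|K|) => [|u]; [exact: continuous_cstC|by []].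
rewrite RintegralZl// Inu// LamB//; last 2 first.
- by apply: continuous_mulC => //; exact: continuous_cstC.
- exact: continuous_cstC.
rewrite (LamZ (2 * K + 1) ch) (Lam_cst K) Rintegral_cst//.
have -> : fine (nu setT) = 1 by rewrite probability_setT.
by rewrite mulr1.
Qed.

End positive_functional.

(** * The logarithmic potential of a measure of bounded density *)

Section bounded_density.
Context {R : realType}.
Local Notation lam := (@lebesgueC R).

(** From here on the density of [mu] enters only through these bounds. *)
Lemma density_bounds (mu : probability R[i] R) (rho : R[i] -> R) :
  has_density mu rho -> continuous rho -> compactly_supported rho ->
  exists Mr R0 : R, [/\ 0 <= Mr, 1 <= R0,
    forall E, measurable E -> (mu E <= Mr%:E * lam E)%E &
    mu (~` disc R0) = 0%E].
Proof.
move=> [rho0 rhoE] crho suppr.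
have /compact_bounded : compact (@nc R @` closure [set z | rho z != 0]).
  by apply: continuous_compact => //; apply: continuous_subspaceT; exact: continuous_nc.
move=> [r [_ /(_ (`|r| + 1))]]; rewrite (le_lt_trans (ler_norm _)) ?ltrDl// => /(_ isT) rb.
pose R0 := `|r| + 1.
have supp z : rho z != 0 -> nc z <= R0.
  move=> rz; apply: le_trans (ler_norm _) _; apply: rb.
  by exists z => //; exact: subset_closure.
have [K K0 Kb] := @bounded_on_disc R rho R0 crho.
have rhoK z : rho z <= K.
  have [->//|/supp zR] := eqVneq (rho z) 0.
  by apply: le_trans (ler_norm _) _; exact: Kb.
have mrho : measurable_fun setT (EFin \o rho).
  by apply/measurable_EFinP; exact: continuous_measurableC.
exists K, R0; split => //; first by rewrite /R0 lerDr.
  move=> E mE; rewrite rhoE// -integral_cst//; apply: ge0_le_integral => //.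
  - by move=> z _; rewrite lee_fin.
  - exact: measurable_funTS.
  - by move=> z _; rewrite lee_fin.
rewrite rhoE; last by apply: measurableC; exact: measurable_disc.
rewrite integral0_eq// => z /= zR; congr (_%:E); apply/eqP.
by apply: contraPT zR => /supp zR; apply.
Qed.

End bounded_density.

Section log_potential.
Context {R : realType} (mu : probability R[i] R) (Mr R0 : R).
Context (Mr0 : 0 <= Mr) (R01 : 1 <= R0).
Context (mu_le : forall E, measurable E -> (mu E <= Mr%:E * @lebesgueC R E)%E).
Context (mu_disc : mu (~` disc R0) = 0%E).
Local Notation lam := (@lebesgueC R).

Lemma bounded_density_integral_le (g : R[i] -> \bar R) :
  measurable_fun setT g -> (forall x, 0 <= g x)%E ->
  (\int[mu]_x g x <= Mr%:E * \int[lam]_(x in disc R0) g x)%E.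
Proof.
move=> mg g0.
have mD : measurable (~` disc R0 : set R[i]).
  by apply: measurableC; exact: measurable_disc.
rewrite (@ge0_negligible_integral _ _ _ _ setT (~` disc R0))//.
rewrite setTD setCK.
pose Mnn : {nonneg R} := NngNum Mr0.
rewrite [leRHS](_ : _ = integral (mscale Mnn lam) (disc R0) g); last first.
  by rewrite (ge0_integral_mscale lam (measurable_disc R0))//; exact: measurable_funTS.
by apply: ge0_le_measure_integral => //; exact: measurable_disc.
Qed.

Lemma mu_lg_sq (M : R) : exists2 C : R, 0 <= C & forall a, nc a <= M ->
  (\int[mu]_x ((lg (x - a)) ^+ 2)%:E <= C%:E)%E.
Proof.
have [C C0 Ca] := lg_sq_shift (Num.max M R0).
exists (Mr * C); first exact: mulr_ge0.
have mlg a : measurable_fun setT (fun x : R[i] => (lg (x - a) ^+ 2)%:E).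
  by apply/measurable_EFinP; apply: measurable_funX; exact: measurable_lg_shift.
move=> a aM; apply: le_trans (bounded_density_integral_le (mlg a) _) _.
  by move=> x; rewrite lee_fin sqr_ge0.
rewrite EFinM lee_wpmul2l//; apply: le_trans (Ca a _); last by rewrite le_max aM.
apply: ge0_subset_integral => //; try exact: measurable_disc.
- exact: measurable_funTS.
- by move=> x _; rewrite lee_fin sqr_ge0.
- by move=> x xR; rewrite /disc /= le_max xR orbT.
Qed.

Lemma mu_integrable_lg_sq (a : R[i]) :
  mu.-integrable setT (fun x => ((lg (x - a)) ^+ 2)%:E).
Proof.
have [C C0 /(_ a (lexx _)) Ca] := mu_lg_sq (nc a).
apply/integrableP; split.
  by apply/measurable_EFinP; apply: measurable_funX; exact: measurable_lg_shift.
apply: le_lt_trans (ltry C); apply: le_trans Ca; rewrite le_eqVlt; apply/orP; left.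
by apply/eqP; apply: eq_integral => x _ /=; rewrite ger0_norm// sqr_ge0.
Qed.

Lemma mu_integrable_cst (c : R) : mu.-integrable setT (fun=> c%:E).
Proof.
apply/integrableP; split; first exact: measurable_cst.
by rewrite /= integral_cst//= probability_setT mule1 ltry.
Qed.

Lemma mu_integrable_lg (a : R[i]) : mu.-integrable setT (fun x => (lg (x - a))%:E).
Proof.
have := integrableD measurableT (mu_integrable_cst 1) (mu_integrable_lg_sq a).
apply: le_integrable => //.
  by apply/measurable_EFinP; exact: measurable_lg_shift.
move=> x _; change (`|(lg (x - a))%:E| <= `|(1 + lg (x - a) ^+ 2)%:E|)%E.
rewrite !abse_EFin lee_fin [leRHS]ger0_norm; first exact: ler_norm_sqr1.
by rewrite addr_ge0// sqr_ge0.
Qed.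

Lemma mu_set1 (a : R[i]) : mu [set a] = 0%E.
Proof.
apply/eqP; rewrite -measure_le0; apply: le_trans (mu_le (measurable_set1C a)) _.
by rewrite lebesgueC_set1 mule0.
Qed.

Definition logpotential (z : R[i]) : R := \int[mu]_x lg (x - z).

(** [lne] and [lg] differ only at x = z, where one is -oo and the other 0; a bounded density gives
    that point no mass. *)
Lemma log_potentialE (z : R[i]) : log_potential mu z = (logpotential z)%:E.
Proof.
rewrite /logpotential /Rintegral fineK; last exact: (integrable_fin_num measurableT (mu_integrable_lg z)).
have mlg := @measurable_lg_shift R z.
apply: ae_eq_integral => //.
- rewrite (_ : (fun _ => _) = fun x : R[i] => if nc (x - z) <= 0 then -oo%E else (lg (x - z))%:E)//.
  apply: measurable_fun_ifT => //; last exact/measurable_EFinP.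
  by apply: measurable_fun_ler => //; exact: measurable_nc_sub.
- exact/measurable_EFinP.
exists [set z]; split; [exact: measurable_set1C|exact: mu_set1|].
move=> x /= /not_implyP[_ kx]; apply: contra_notP kx => /eqP xz.
by rewrite leNgt nc_gt0 subr_eq0 xz.
Qed.

(** For 0 < |v| < e < 1, log_kernel e v <= - lg v <= (lg v)^2 / (- ln e), because - lg v > - ln e.
    The factor 16 is the bound of [lg_sq_disc1]. In particular the mass tends to 0 with e. *)
Lemma log_kernel_mass_le (e : R) : 0 < e -> e < 1 ->
  log_kernel_mass e <= 16 / (- ln e).
Proof.
move=> e0 e1.
have lne0 : 0 < - ln e by rewrite oppr_gt0 ln_lt0// e0.
rewrite -lee_fin /log_kernel_mass fineK; last first.
  exact: (integrable_fin_num measurableT (integrable_log_kernel e0)).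
have mD := @measurable_disc R 1.
have mlg2 : measurable_fun setT (fun v : R[i] => (lg v ^+ 2)%:E).
  by apply/measurable_EFinP; apply: measurable_funX; exact: measurable_lg.
have ilg2 : lam.-integrable (disc 1) (fun v => (lg v ^+ 2)%:E).
  apply/integrableP; split; first exact: measurable_funTS.
  apply: le_lt_trans (lg_sq_disc 1); rewrite le_eqVlt; apply/orP; left.
  by apply/eqP; apply: eq_integral => v _ /=; rewrite ger0_norm// sqr_ge0.
have ilg2' : lam.-integrable setT (((fun v : R[i] => ((- ln e)^-1)%:E * (lg v ^+ 2)%:E) \_ (disc 1))%E).
  by apply: (integrable_mkcond _ mD).1; exact: (integrableZl mD _ ilg2).
apply: (@le_trans _ _ (\int[lam]_x ((fun v : R[i] => ((- ln e)^-1)%:E * (lg v ^+ 2)%:E) \_ (disc 1)) x)%E).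
  apply: le_integral => //; first exact: integrable_log_kernel.
  move=> v _; rewrite patchE.
  have rhs0 : (0 <= ((- ln e)^-1)%:E * (lg v ^+ 2)%:E)%E.
    by rewrite mule_ge0 ?lee_fin ?invr_ge0 ?sqr_ge0 ?(ltW lne0).
  have [ve|ev] := ltP (nc v) e; last first.
    by rewrite log_kernel_out//; case: ifP.
  rewrite mem_set; last by rewrite /disc /= ltW// (lt_trans ve).
  have [v0|v0] := eqVneq v 0.
    apply: le_trans rhs0; rewrite v0 /log_kernel /lnmax max_r; last by rewrite nc0 ltW.
    by rewrite /lg nc0 (ln0 (lexx 0)) subr0 lee_fin; lra.
  rewrite -EFinM lee_fin ler_pdivlMl// /log_kernel /lnmax max_r ?(ltW ve)//.
  have : lg v < ln e by rewrite ltr_ln ?posrE// nc_gt0.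
  by move=> *; nra.
rewrite -integral_mkcond ge0_integralZl_EFin ?invr_ge0 ?(ltW lne0)//; last 2 first.
- by move=> v _; rewrite lee_fin sqr_ge0.
- exact: measurable_funTS.
rewrite mulrC EFinM lee_wpmul2l ?lee_fin ?invr_ge0 ?(ltW lne0)//.
exact: lg_sq_disc1.
Qed.

Lemma lnmax_lipschitz (e : R) (u v : R[i]) : 0 < e ->
  `|lnmax e u - lnmax e v| <= e^-1 * nc (u - v).
Proof.
move=> e0; rewrite /lnmax.
have aux s t : e <= t -> t <= s -> `|ln s - ln t| <= e^-1 * (s - t).
  move=> et ts; have t0 : 0 < t by exact: lt_le_trans et.
  have s0 : 0 < s by exact: lt_le_trans ts.
  have lts : ln t <= ln s by rewrite ler_ln ?posrE.
  rewrite ger0_norm ?subr_ge0// -ln_div ?posrE//.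
  have -> : s / t = 1 + (s - t) / t by field; rewrite gt_eqF.
  apply: le_trans (le_ln1Dx _) _.
    by apply: (@lt_le_trans _ _ 0); [lra|rewrite divr_ge0// ?subr_ge0 // ltW].
  by rewrite mulrC ler_wpM2r ?subr_ge0// lef_pV2 ?posrE.
have := nc_dist u v; have := normr_ge0 (nc u - nc v).
have eV : 0 < e^-1 by rewrite invr_gt0.
have [uv|vu] := leP (nc v) (nc u).
  move=> _ d1; apply: le_trans (aux _ _ _ _) _.
  - by rewrite le_max lexx orbT.
  - by rewrite ge_max !le_max uv lexx orbT.
  rewrite ler_wpM2l ?(ltW eV)//; apply: le_trans d1; rewrite ger0_norm ?subr_ge0//.
  by rewrite /Num.max; case: ltP => ?; case: ltP => ?; lra.
move=> _ d1; rewrite distrC; apply: le_trans (aux _ _ _ _) _.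
- by rewrite le_max lexx orbT.
- by rewrite ge_max !le_max (ltW vu) lexx orbT.
rewrite ler_wpM2l ?(ltW eV)//; apply: le_trans d1; rewrite ltr0_norm ?subr_lt0// opprB.
by rewrite /Num.max; case: ltP => ?; case: ltP => ?; lra.
Qed.

Lemma measurable_lnmax_shift (e : R) (z : R[i]) : 0 < e ->
  measurable_fun setT (fun x : R[i] => lnmax e (x - z)).
Proof.
by move=> e0; apply: measurableT_comp (measurable_lnmax e0) _; exact: measurable_subC.
Qed.

Lemma logpotential_lnmax (e : R) (z : R[i]) : 0 < e ->
  mu.-integrable setT (fun x => (lnmax e (x - z))%:E) /\
  `|logpotential z - \int[mu]_x lnmax e (x - z)| <= Mr * log_kernel_mass e.
Proof.
move=> e0.
have mk : measurable_fun setT (fun x : R[i] => log_kernel e (x - z)).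
  by apply: measurableT_comp (measurable_log_kernel e0) _; exact: measurable_subC.
have mak : measurable_fun setT (fun v : R[i] => `|log_kernel e v|%:E).
  by apply/measurable_EFinP; apply: measurableT_comp => //; exact: measurable_log_kernel.
have mak' : measurable_fun setT (fun v : R[i] => `|log_kernel e (v - z)|%:E).
  by apply/measurable_EFinP; exact: measurableT_comp.
have kle : (\int[mu]_x `|log_kernel e (x - z)|%:E <= (Mr * log_kernel_mass e)%:E)%E.
  apply: le_trans (bounded_density_integral_le mak' _) _; first by move=> x; rewrite lee_fin.
  rewrite EFinM lee_wpmul2l//.
  rewrite -(integral_abs_log_kernel e0).
  rewrite -[leRHS](@ge0_integral_shiftC _ (- z) (fun v => `|log_kernel e v|%:E))//.
  by apply: ge0_subset_integral => //; exact: measurable_disc.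
have ik : mu.-integrable setT (fun x => (log_kernel e (x - z))%:E).
  apply/integrableP; split; first exact/measurable_EFinP.
  by apply: le_lt_trans kle _; exact: ltry.
have il := mu_integrable_lg z.
have im : mu.-integrable setT (fun x => (lnmax e (x - z))%:E).
  rewrite (_ : (fun _ => _) = (fun x => (log_kernel e (x - z))%:E + (lg (x - z))%:E)%E).
    exact: integrableD.
  by apply/funext => x; rewrite -EFinD /log_kernel subrK.
split => //; rewrite distrC /logpotential -RintegralB//.
exact: norm_Rintegral_le.
Qed.

(** Truncating the logarithm at [e] gives Lipschitz potentials that converge to [logpotential]
    uniformly in z. *)
Lemma continuous_logpotential : continuous logpotential.
Proof.
move=> z; apply/cvg_ncP => d d0.
have d3 : 0 < d / 3 by rewrite divr_gt0.
(* With e = exp(-k), the truncation error is at most 16 Mr / k, hence at most d/3. *)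
pose k := 16 * Mr / (d / 3) + 1.
have k0 : 0 < k by apply: ltr_wpDl => //; rewrite divr_ge0 ?(ltW d3)// mulr_ge0.
pose e := expR (- k).
have e0 : 0 < e by exact: expR_gt0.
have e1 : e < 1 by rewrite expR_lt1 oppr_lt0.
have near v : `|logpotential v - \int[mu]_x lnmax e (x - v)| <= d / 3.
  apply: le_trans (logpotential_lnmax v e0).2 _.
  apply: le_trans (_ : Mr * (16 / (- ln e)) <= _).
    by rewrite ler_wpM2l// log_kernel_mass_le.
  rewrite /e expRK opprK mulrA ler_pdivrMr// (mulrC Mr) -ler_pdivrMl//.
  by rewrite [leLHS]mulrC /k lerDl.
exists (d / 3 * e); first by rewrite mulr_gt0.
move=> v zv.
rewrite (_ : _ - _ = (logpotential z - \int[mu]_x lnmax e (x - z)) -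
  (logpotential v - \int[mu]_x lnmax e (x - v)) +
  (\int[mu]_x lnmax e (x - z) - \int[mu]_x lnmax e (x - v))); last by ring.
have mid : `|\int[mu]_x lnmax e (x - z) - \int[mu]_x lnmax e (x - v)| <= e^-1 * nc (z - v).
  have [[iz _] [iv _]] := (logpotential_lnmax z e0, logpotential_lnmax v e0).
  have [mz mv] := (measurable_lnmax_shift z e0, measurable_lnmax_shift v e0).
  rewrite -RintegralB//; apply: norm_Rintegral_le; first exact: measurable_funB.
  apply: (@le_trans _ _ (\int[mu]_x (e^-1 * nc (z - v))%:E)%E).
    apply: ge0_le_integral => //.
    - by apply/measurable_EFinP; apply: measurableT_comp => //; exact: measurable_funB.
    - move=> x _; rewrite lee_fin; apply: le_trans (lnmax_lipschitz _ _ e0) _.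
      by rewrite (_ : _ - _ - _ = v - z) 1?ncB//; ring.
  by rewrite integral_cst//= probability_setT mule1.
apply: le_lt_trans (ler_normD _ _) _.
have := ler_normB (logpotential z - \int[mu]_x lnmax e (x - z)) (logpotential v - \int[mu]_x lnmax e (x - v)).
have := near z; have := near v.
have : e^-1 * nc (z - v) < d / 3 by rewrite mulrC ltr_pdivrMr.
lra.
Qed.

End log_potential.

(** * Independence of the past *)

Section independence.
Context {R : realType} {d : measure_display} {T : measurableType d} (P : probability T R).
Context {d' : measure_display} {X : measurableType d'} (Z : nat -> {RV P >-> X}).
Context (Zindep : mutually_independent P Z).

Let measurable_Z k (E : set X) : measurable E -> measurable (Z k @^-1` E).
Proof. by move=> mE; rewrite -[_ @^-1` _]setTI; exact: measurable_funP. Qed.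

(** Cylinder events in the first [n] variables: a pi-system generating the sigma-algebra of the past
    before time [n]. *)
Definition past (n : nat) : set (set T) :=
  [set A | exists2 E : nat -> set X, (forall k, measurable (E k)) &
    A = \bigcap_(k in `I_n) Z k @^-1` E k].

Lemma past_measurable n : past n `<=` measurable.
Proof.
move=> _ [E mE ->]; case: n => [|n]; first by rewrite II0 bigcap_set0.
by apply: bigcap_measurable => [|k _]; [exists 0%N|exact: measurable_Z].
Qed.

Lemma past_setI n : setI_closed (past n).
Proof.
move=> _ _ [E mE ->] [F mF ->]; exists (fun k => E k `&` F k).
  by move=> k; exact: measurableI.
by rewrite -bigcapI.
Qed.

Lemma pastT n : past n setT.
Proof.
exists (fun=> setT) => //; apply/seteqP; split => // t _ k _ //.
Qed.

Lemma sigma_past_measurable n : <<s past n >> `<=` measurable.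
Proof. by apply: smallest_sub (@past_measurable n); exact: sigma_algebra_measurable. Qed.

Lemma indep_prefix n (E : nat -> set X) : (forall k, measurable (E k)) ->
  P (\bigcap_(k in `I_n) Z k @^-1` E k) = (\prod_(0 <= k < n) P (Z k @^-1` E k))%E.
Proof.
move=> mE; pose J : {fset nat} := [fset k in iota 0 n]%fset.
have -> : `I_n = [set` J].
  by apply/seteqP; split => k /=; rewrite /J inE /= mem_iota add0n.
rewrite Zindep//; apply: perm_big; apply: uniq_perm; rewrite ?fset_uniq ?iota_uniq//.
by move=> k; rewrite /J inE /= /index_iota subn0.
Qed.

(** As functions of [A], both sides are finite measures; they agree on the pi-system [past n] by
    mutual independence. *)
Lemma indep_past n (A : set T) (B : set X) : measurable B -> <<s past n >> A ->
  P (A `&` Z n @^-1` B) = (P A * P (Z n @^-1` B))%E.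
Proof.
move=> mB pA.
have mZB := measurable_Z n mB.
pose c : {nonneg R} := NngNum (fine_ge0 (measure_ge0 P (Z n @^-1` B))).
have cE : (c%:num)%:E = P (Z n @^-1` B) by rewrite /= fineK// fin_num_measure.
rewrite -cE muleC.
rewrite -[LHS]/(mrestr P mZB A) -[RHS]/(mscale c P A).
apply: (@g_sigma_algebra_measure_unique _ _ _ (past n) _ (fun=> setT)) => //.
- exact: past_measurable.
- by move=> _; exact: pastT.
- by rewrite bigcup_const.
- exact: past_setI.
- move=> _ [E mE ->]; rewrite /= /mrestr /mscale /= cE.
  pose F k := if k == n then B else E k.
  have mF k : measurable (F k) by rewrite /F; case: ifP.
  have -> : \bigcap_(k in `I_n) Z k @^-1` E k `&` Z n @^-1` B =
      \bigcap_(k in `I_n.+1) Z k @^-1` F k.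
    apply/seteqP; split => [t [Et Bt] k /=|t Ft].
      rewrite ltnS leq_eqVlt /F => /orP[/eqP ->|kn]; first by rewrite eqxx.
      by rewrite ltn_eqF//; exact: Et.
    split=> [k /= kn|]; last by have := Ft n (ltnSn n); rewrite /F eqxx.
    by have := Ft k (ltnW kn); rewrite /F ltn_eqF.
  have Fn : F n = B by rewrite /F eqxx.
  rewrite (indep_prefix n.+1 mF) (indep_prefix n mE) big_nat_recr//= Fn muleC.
  congr (_ * _)%E; apply: eq_big_nat => k /andP[_ kn]; by rewrite /F ltn_eqF.
- by move=> _; rewrite /= /mrestr setTI -ge0_fin_numE// fin_num_measure.
Qed.

(** When [Y] depends on the past only, the law of (Y, Z n) is a product measure, and Tonelli
    integrates the last variable with the past held fixed. *)
Lemma freezing n d'' (S : measurableType d'') (Y : T -> S) (h : S * X -> \bar R) :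
  measurable_fun [set: g_sigma_algebraType (past n)] Y ->
  measurable_fun setT h -> (forall p, 0 <= h p)%E ->
  (\int[P]_w h (Y w, Z n w) = \int[P]_w \int[distribution P (Z n)]_x h (Y w, x))%E.
Proof.
move=> mYp mh h0.
have mY : measurable_fun setT Y.
  by move=> _ B mB; apply: (@sigma_past_measurable n); exact: mYp.
have mYZ : measurable_fun setT (fun w => (Y w, Z n w)) by exact: measurable_fun_pair.
pose Y' : {RV P >-> S} := HB.pack Y (isMeasurableFun.Build _ _ _ _ Y mY).
pose YZ' : {RV P >-> (S * X)%type} := HB.pack (fun w => (Y w, Z n w))
  (isMeasurableFun.Build _ _ _ _ (fun w => (Y w, Z n w)) mYZ).
have -> : (\int[P]_w h (Y w, Z n w) = \int[distribution P YZ']_p h p)%E.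
  by rewrite ge0_integral_distribution.
have -> : (\int[distribution P YZ']_p h p =
    \int[distribution P Y' \x distribution P (Z n)]_p h p)%E.
  apply: eq_measure_integral => A mA _; apply/esym.
  apply: (@product_measure_unique _ _ _ _ _ (distribution P Y') (distribution P (Z n))) => //.
  move=> B C mB mC; rewrite /distribution /pushforward /=.
  rewrite -indep_past//.
  have := mYp measurableT B mB; by rewrite setTI.
rewrite fubini_tonelli1//.
rewrite ge0_integral_distribution//; first exact: measurable_fun_fubini_tonelli_F.
by move=> y; apply: integral_ge0.
Qed.

Lemma measurable_past k n : (k < n)%N ->
  measurable_fun [set: g_sigma_algebraType (past n)] (Z k).
Proof.
move=> kn _ B mB; rewrite setTI; apply: sub_sigma_algebra.
exists (fun j => if j == k then B else setT); first by move=> j; case: ifP.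
apply/seteqP; split => [t Bt j /= jn|t]; first by case: ifP => // /eqP ->.
by move=> /(_ k kn); rewrite eqxx.
Qed.

End independence.

Lemma ln2_le1 (R : realType) : ln (2 : R) <= 1.
Proof. by have := @le_ln1Dx R 1; rewrite (_ : 1 + 1 = 2) //; apply; lra. Qed.

Lemma ln_dist_le (R : realType) (s t c : R) : 0 < s -> 0 < t -> 1 <= c ->
  s <= c * t -> t <= c * s -> `|ln s - ln t| <= ln c.
Proof.
move=> s0 t0 c1 st ts; have c0 : 0 < c by exact: lt_le_trans c1.
have l1 : ln s <= ln c + ln t.
  by rewrite -lnM ?posrE// ler_ln ?posrE ?mulr_gt0.
have l2 : ln t <= ln c + ln s.
  by rewrite -lnM ?posrE// ler_ln ?posrE ?mulr_gt0.
by rewrite ler_norml; apply/andP; split; lra.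
Qed.

(** * Mean logarithm of a random affine function *)

Section affine_log.
Context {R : realType} (mu : probability R[i] R) (Mr R0 : R).
Context (Mr0 : 0 <= Mr) (R01 : 1 <= R0).
Context (mu_le : forall E, measurable E -> (mu E <= Mr%:E * @lebesgueC R E)%E).
Context (mu_disc : mu (~` disc R0) = 0%E).

Lemma measurable_affine_lg (a b : R[i]) (c : R) :
  measurable_fun setT (fun x : R[i] => `|lg (a - b * x) - c|%:E).
Proof.
apply/measurable_EFinP; apply: measurableT_comp => //; apply: measurable_funB => //.
apply: (measurableT_comp measurable_lg); apply: measurable_subC => //.
exact: measurable_mulC.
Qed.

(** If |a| >= 2 R0 |b|, then |a - b x| is within a factor 2 of |a| on [disc R0]. Otherwise the root
    g = a/b lies in [disc (2 * R0)], lg (a - b x) = lg b + lg (x - g) has a uniformly bounded second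
    logarithmic moment, and |b| is within a factor 2 R0 of the maximum. *)
Lemma affine_lg_bound : exists2 C : R, 0 <= C & forall a b : R[i],
  (\int[mu]_x `|lg (a - b * x) - ln (Num.max (nc a) (nc b))|%:E <= C%:E)%E.
Proof.
have [C C0 Ca] := mu_lg_sq Mr0 mu_le mu_disc (2 * R0).
have R01' := R01.
have lR0 : 0 <= ln (2 * R0) by apply: ln_ge0; lra.
exists (1 + C + ln (2 * R0)); first by rewrite !addr_ge0.
move=> a b.
have nonneg1 (c : R) : 0 <= c -> (\int[mu]_x c%:E = c%:E)%E.
  by move=> c0; rewrite integral_cst//= probability_setT mule1.
have [ab|ab] := leP (nc b * (2 * R0)) (nc a).
  have [a0|a0] := eqVneq a 0.
    have b0 : b = 0.
      apply/eqP; rewrite -nc_eq0 eq_le nc_ge0 andbT.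
      by move: ab; rewrite a0 nc0; have := nc_ge0 b; nra.
    rewrite integral0_eq ?lee_fin ?addr_ge0// => x _.
    by rewrite a0 b0 mul0r subr0 /lg !nc0 maxxx (ln0 (lexx 0)) subrr normr0.
  have mD : measurable (~` disc R0 : set R[i]).
    by apply: measurableC; exact: measurable_disc.
  have mf := measurable_affine_lg a b (ln (Num.max (nc a) (nc b))).
  rewrite (@ge0_negligible_integral _ _ _ _ setT (~` disc R0))//.
  rewrite setTD setCK.
  apply: (@le_trans _ _ (\int[mu]_(x in disc R0) 1)%E); last first.
    rewrite integral_cst ?mul1e; last exact: measurable_disc.
    apply: le_trans (probability_le1 _ _) _; first exact: measurable_disc.
    by rewrite lee_fin; lra.
  apply: ge0_le_integral => //; first exact: measurable_disc.
    exact: measurable_funTS.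
  move=> x; rewrite /disc /= => xR; rewrite lee_fin; apply: le_trans (ln2_le1 R).
  have a0' : 0 < nc a by rewrite nc_gt0.
  have nb := nc_ge0 b; have nx := nc_ge0 x.
  have ba : nc b <= nc a by nra.
  rewrite max_l// /lg.
  have bx : nc (b * x) <= nc a / 2 by rewrite ncM; nra.
  have t1 := nc_subr a (b * x).
  have t2 : nc a <= nc (a - b * x) + nc (b * x).
    by have := nc_triangle (a - b * x) (b * x); rewrite subrK.
  apply: ln_dist_le => //; lra.
have b0' : 0 < nc b by have := nc_ge0 a; nra.
have b0 : b != 0 by rewrite -nc_gt0.
pose g := a / b.
have gR : nc g <= 2 * R0.
  by rewrite /g ncM ComplexField.Normc.normcV ler_pdivrMr// mulrC ltW.
have abg x : a - b * x = - (b * (x - g)) by rewrite /g; field.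
have mf := measurable_affine_lg a b (ln (Num.max (nc a) (nc b))).
rewrite (@ge0_negligible_integral _ _ _ _ setT [set g])//; last 2 first.
- exact: measurable_set1C.
- exact: mu_set1 mu_le g.
have mTg : measurable (setT `\` [set g]) by apply: measurableD => //; exact: measurable_set1C.
apply: (@le_trans _ _ (\int[mu]_(x in setT `\` [set g]) ((1 + ln (2 * R0))%:E + (lg (x - g) ^+ 2)%:E))%E).
  apply: ge0_le_integral => //.
  - exact: measurable_funTS.
  - apply: measurable_funTS; apply: emeasurable_funD => //.
    by apply/measurable_EFinP; apply: measurable_funX; exact: measurable_lg_shift.
  move=> x [_ /eqP xg]; rewrite -EFinD lee_fin abg lgN lgM// ?subr_eq0//.
  have m0 : 0 < Num.max (nc a) (nc b) by rewrite lt_max b0' orbT.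
  have md : `|ln (Num.max (nc a) (nc b)) - ln (nc b)| <= ln (2 * R0).
    apply: ln_dist_le => //; first lra.
      by rewrite ge_max; apply/andP; split; [rewrite mulrC ltW|nra].
    by apply: (@le_trans _ _ (Num.max (nc a) (nc b))); [rewrite le_max lexx orbT|nra].
  rewrite (_ : _ - _ = lg (x - g) - (ln (Num.max (nc a) (nc b)) - ln (nc b))); last first.
    by rewrite /lg; ring.
  apply: le_trans (ler_normB _ _) _; have := ler_norm_sqr1 (lg (x - g)); lra.
have msq : measurable_fun setT (fun x : R[i] => (lg (x - g) ^+ 2)%:E).
  by apply/measurable_EFinP; apply: measurable_funX; exact: measurable_lg_shift.
apply: (@le_trans _ _ (\int[mu]_x ((1 + ln (2 * R0))%:E + (lg (x - g) ^+ 2)%:E))%E).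
  apply: ge0_subset_integral => //.
  - exact: emeasurable_funD.
  - by move=> x _; rewrite -EFinD lee_fin addr_ge0 ?sqr_ge0// addr_ge0.
rewrite ge0_integralD//; last 2 first.
- by move=> x _; rewrite lee_fin addr_ge0.
- by move=> x _; rewrite lee_fin sqr_ge0.
rewrite nonneg1 ?addr_ge0//.
have -> : 1 + C + ln (2 * R0) = (1 + ln (2 * R0)) + C by ring.
by rewrite (EFinD (1 + ln (2 * R0))) leeD2l//; exact: Ca.
Qed.

(** For a = p_n(u) and b = p_n(0), the affine function in the next variable has coefficients a u and
    a - b. Each maximum is at most 2 max(1, |u|) or 2 max(1, 1/|u|) times the other. *)
Lemma max_affine_ratio (a b u : R[i]) : u != 0 ->
  `|ln (Num.max (nc (a * u)) (nc (a - b))) - ln (Num.max (nc a) (nc b))| <= 1 + `|lg u|.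
Proof.
move=> u0; have up : 0 < nc u by rewrite nc_gt0.
have lu : 0 <= 1 + `|lg u| by rewrite addr_ge0.
pose m := Num.max (nc a) (nc b); pose m' := Num.max (nc (a * u)) (nc (a - b)).
have na := nc_ge0 a; have nb := nc_ge0 b.
have am : nc a <= m by rewrite /m le_max lexx.
have bm : nc b <= m by rewrite /m le_max lexx orbT.
have [m0|m0] := leP m 0.
  have a0 : a = 0 by apply/eqP; rewrite -nc_eq0 eq_le na andbT; lra.
  have b0 : b = 0 by apply/eqP; rewrite -nc_eq0 eq_le nb andbT; lra.
  by rewrite a0 b0 mul0r subr0 subrr normr0.
have um1 : nc (a * u) <= m' by rewrite /m' le_max lexx.
have um2 : nc (a - b) <= m' by rewrite /m' le_max lexx orbT.
have t1 := nc_subr a b.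
have t2 : nc b <= nc (a - b) + nc a.
  by have := nc_triangle (b - a) a; rewrite subrK ncB.
rewrite ncM in um1.
have low : m <= 2 * Num.max 1 (nc u)^-1 * m'.
  have x1 : 1 <= Num.max 1 (nc u)^-1 by rewrite le_max lexx.
  have x2 : (nc u)^-1 <= Num.max 1 (nc u)^-1 by rewrite le_max lexx orbT.
  have uV : nc u * (nc u)^-1 = 1 by rewrite mulfV// gt_eqF.
  set X := Num.max 1 _ in x1 x2 *; set v := (nc u)^-1 in x2 uV *.
  have v0 : 0 < v by rewrite invr_gt0.
  have m'0 : 0 <= m' by apply: le_trans um2; exact: nc_ge0.
  have am' : nc a <= X * m'.
    have -> : nc a = (nc a * nc u) * v by rewrite -mulrA uV mulr1.
    nra.
  rewrite /m ge_max; apply/andP; split; nra.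
have upp : m' <= 2 * Num.max 1 (nc u) * m.
  have x1 : 1 <= Num.max 1 (nc u) by rewrite le_max lexx.
  have x2 : nc u <= Num.max 1 (nc u) by rewrite le_max lexx orbT.
  rewrite /m' ge_max ncM; apply/andP; split; nra.
have m'0 : 0 < m'.
  rewrite ltNge; apply/negP => m'0; move: low; rewrite leNgt => /negP; apply.
  apply: le_lt_trans m0; rewrite mulr_ge0_le0// mulr_ge0// le_max ler01//.
have l2 := ln2_le1 R.
have max0 (c : R) : 0 < c -> 0 < Num.max 1 c by move=> c0; rewrite lt_max ltr01.
have lmax (c : R) : 0 < c -> ln (Num.max 1 c) <= `|ln c|.
  by move=> c0; rewrite /Num.max; case: ltP => _; [exact: ler_norm|rewrite ln1].
have lV : `|ln (nc u)^-1| = `|lg u| by rewrite lnV ?posrE// normrN.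
have lM (c t : R) : 0 < c -> 0 < t -> ln (2 * Num.max 1 c * t) = ln 2 + ln (Num.max 1 c) + ln t.
  by move=> c0 t0; rewrite !lnM ?posrE ?mulr_gt0 ?max0.
have vp : 0 < (nc u)^-1 by rewrite invr_gt0.
have h1 : ln m <= ln 2 + ln (Num.max 1 (nc u)^-1) + ln m'.
  by rewrite -lM// ler_ln ?posrE// !mulr_gt0 ?max0.
have h2 : ln m' <= ln 2 + ln (Num.max 1 (nc u)) + ln m.
  by rewrite -lM// ler_ln ?posrE// !mulr_gt0 ?max0.
have := lmax _ up; have := lmax _ vp; rewrite lV -/(lg u) => *.
rewrite ler_norml; apply/andP; split; rewrite -/m -/m'; lra.
Qed.

End affine_log.

(** * Logarithmic asymptotics of the level polynomial *)

Lemma dist_max_le (R : realDomainType) (s t s' t' : R) :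
  `|Num.max s t - Num.max s' t'| <= `|s - s'| + `|t - t'|.
Proof.
have := ler_norm (s - s'); have := ler_norm (s' - s); rewrite distrC => h1 h2.
have := ler_norm (t - t'); have := ler_norm (t' - t); rewrite distrC => h3 h4.
have h5 := normr_ge0 (s - s'); have h6 := normr_ge0 (t - t').
rewrite ler_norml /Num.max.
by case: (ltP s t) => ?; case: (ltP s' t') => ?; apply/andP; split; lra.
Qed.

Section mean_log_bound.
Context {R : realType} (mu : probability R[i] R) (Mr R0 : R).
Context (Mr0 : 0 <= Mr) (R01 : 1 <= R0).
Context (mu_le : forall E, measurable E -> (mu E <= Mr%:E * @lebesgueC R E)%E).
Context (mu_disc : mu (~` disc R0) = 0%E).
Context {d : measure_display} {T : measurableType d} (P : probability T R).
Context (Z : nat -> {RV P >-> R[i]}).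
Context (Zindep : mutually_independent P Z).
Context (Zlaw : forall k (E : set R[i]), measurable E -> distribution P (Z k) E = mu E).

Local Notation U := (logpotential mu).

(** Equal to log |p_n(u)| when no factor vanishes, and a sum of independent terms in all cases. *)
Definition logsum (n : nat) (u : R[i]) (w : T) : R := \sum_(k < n) lg (Z k w - u).

Definition prodZ (n : nat) (u : R[i]) (w : T) : R[i] := \prod_(k < n) (u - Z k w).

Definition maxpotential (u : R[i]) : R := Num.max (U u) (U 0).

Lemma integral_law k (g : R[i] -> \bar R) :
  (\int[distribution P (Z k)]_x g x = \int[mu]_x g x)%E.
Proof. by apply: eq_measure_integral => A mA _; exact: Zlaw. Qed.

Lemma measurable_RV k : measurable_fun setT (Z k).
Proof. exact: measurable_funP. Qed.

Lemma measurable_logsum n u : measurable_fun setT (logsum n u).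
Proof.
apply: measurable_sum => k; apply: (measurableT_comp measurable_lg).
by apply: measurable_subC => //; exact: measurable_RV.
Qed.

(** lg (x - u) - U u is centred, so the cross term vanishes, and the variance is at most the second
    moment. *)
Lemma second_moment_lg (y : R) (u : R[i]) (C : R) :
  (\int[mu]_x (lg (x - u) ^+ 2)%:E <= C%:E)%E ->
  (\int[mu]_x ((y + (lg (x - u) - U u)) ^+ 2)%:E <= (y ^+ 2)%:E + C%:E)%E.
Proof.
move=> CC.
have i2 := mu_integrable_lg_sq Mr0 mu_le mu_disc u.
have i1 := mu_integrable_lg Mr0 mu_le mu_disc u.
have i0 (c : R) := mu_integrable_cst mu c.
have i1c := integrableZl measurableT (2 * (y - U u)) i1.
have E : (\int[mu]_x ((y + (lg (x - u) - U u)) ^+ 2)%:E =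
    (\int[mu]_x (lg (x - u) ^+ 2) + (2 * (y - U u)) * U u + (y - U u) ^+ 2)%:E)%E.
  have -> : 2 * (y - U u) * U u = \int[mu]_x (2 * (y - U u) * lg (x - u)).
    by rewrite RintegralZl.
  have -> : (y - U u) ^+ 2 = \int[mu]_x ((y - U u) ^+ 2).
    by rewrite Rintegral_cst//= probability_setT mulr1.
  pose f1 (x : R[i]) := lg (x - u) ^+ 2.
  pose f2 (x : R[i]) := 2 * (y - U u) * lg (x - u).
  have i12 : mu.-integrable setT (EFin \o (fun x => f1 x + f2 x)).
    exact: (integrableD measurableT i2 i1c).
  rewrite -(@RintegralD _ _ _ mu setT f1 f2 measurableT i2 i1c).
  rewrite -(@RintegralD _ _ _ mu setT (fun x => f1 x + f2 x) (fun=> (y - U u) ^+ 2) measurableT i12 (i0 _)).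
  rewrite fineK; last first.
    by apply: integrable_fin_num => //; exact: (integrableD measurableT i12 (i0 _)).
  by apply: eq_integral => x _; congr (_%:E); rewrite /f1 /f2; ring.
have m2 : \int[mu]_x (lg (x - u) ^+ 2) <= C.
  by rewrite -lee_fin fineK//; exact: (integrable_fin_num measurableT i2).
rewrite E -EFinD lee_fin; nra.
Qed.

(** Freezing the past at each step makes the next centred term orthogonal to it, so the variances
    add. *)
Lemma second_moment_logsum (u : R[i]) (C : R) n :
  (\int[mu]_x (lg (x - u) ^+ 2)%:E <= C%:E)%E -> 0 <= C ->
  (\int[P]_w ((logsum n u w - n%:R * U u) ^+ 2)%:E <= (n%:R * C)%:E)%E.
Proof.
move=> CC C0; elim: n => [|n IH].
  rewrite (mul0r C) integral0_eq// => w _; rewrite /logsum big_ord0 mul0r subr0.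
  by rewrite expr0n.
pose h (p : R * R[i]) : \bar R := ((p.1 + (lg (p.2 - u) - U u)) ^+ 2)%:E.
have mh : measurable_fun setT h.
  apply/measurable_EFinP; apply: measurable_funX; apply: measurable_funD => //.
  apply: measurable_funB => //; apply: (measurableT_comp measurable_lg).
  exact: measurable_subC.
have h0 p : (0 <= h p)%E by rewrite lee_fin sqr_ge0.
pose Y w := logsum n u w - n%:R * U u.
have mY : measurable_fun [set: g_sigma_algebraType (past Z n)] Y.
  apply: measurable_funB => //; apply: measurable_sum => k.
  apply: (measurableT_comp measurable_lg); apply: measurable_subC => //.
  exact: measurable_past.
have -> : (\int[P]_w ((logsum n.+1 u w - n.+1%:R * U u) ^+ 2)%:E =
    \int[P]_w h (Y w, Z n w))%E.
  apply: eq_integral => w _; rewrite /h /Y /= /logsum big_ord_recr/= -natr1.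
  by congr (_%:E); ring.
rewrite (freezing Zindep mY mh h0).
apply: (@le_trans _ _ (\int[P]_w ((Y w ^+ 2)%:E + C%:E))%E).
  apply: ge0_le_integral => //.
  - by move=> w _; apply: integral_ge0.
  - have mYT : measurable_fun setT Y by apply: measurable_funB => //; exact: measurable_logsum.
    have mF := @measurable_fun_fubini_tonelli_F _ _ _ _ _ (distribution P (Z n)) h mh h0.
    exact: (measurableT_comp mF mYT).
  - apply: emeasurable_funD => //; apply/measurable_EFinP; apply: measurable_funX.
    by apply: measurable_funB => //; exact: measurable_logsum.
  by move=> w _; rewrite integral_law; exact: second_moment_lg.
rewrite ge0_integralD//; last 2 first.
- by move=> w _; rewrite lee_fin sqr_ge0.
- apply/measurable_EFinP; apply: measurable_funX.
  by apply: measurable_funB => //; exact: measurable_logsum.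
rewrite integral_cst//= probability_setT mule1 -natr1 mulrDl mul1r EFinD.
exact: leeD.
Qed.

Lemma first_moment_logsum (u : R[i]) (C : R) n :
  (\int[mu]_x (lg (x - u) ^+ 2)%:E <= C%:E)%E -> 0 <= C ->
  (\int[P]_w `|logsum n u w - n%:R * U u|%:E <= (Num.sqrt n%:R * (1 + C))%:E)%E.
Proof.
move=> CC C0; case: n => [|n].
  rewrite integral0_eq ?lee_fin ?mulr_ge0 ?addr_ge0// => w _.
  by rewrite /logsum big_ord0 mul0r subr0 normr0.
have mY : measurable_fun setT (fun w => logsum n.+1 u w - n.+1%:R * U u).
  by apply: measurable_funB => //; exact: measurable_logsum.
(* From |y| <= t + y^2 / t, where t = sqrt(n+1) balances the two terms against a second moment of
   order n + 1. *)
pose t : R := Num.sqrt n.+1%:R.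
have t0 : 0 < t by rewrite sqrtr_gt0 ltr0n.
have tt : t * t = n.+1%:R by rewrite -expr2 sqr_sqrtr.
apply: (@le_trans _ _ (\int[P]_w (t%:E + (t^-1)%:E * ((logsum n.+1 u w - n.+1%:R * U u) ^+ 2)%:E))%E).
  apply: ge0_le_integral => //.
  - by apply/measurable_EFinP; exact: measurableT_comp.
  - apply: emeasurable_funD => //; apply: measurable_funeM; apply/measurable_EFinP.
    exact: measurable_funX.
  move=> w _; rewrite -EFinM -EFinD lee_fin; set y := _ - _.
  rewrite -(ler_pM2l t0) mulrDr mulrA mulfV ?gt_eqF// mul1r.
  rewrite -(real_normK (num_real y)); have := normr_ge0 y.
  by have := sqr_ge0 (t - `|y|); nra.
rewrite ge0_integralD//; last 3 first.
- by move=> w _; rewrite lee_fin ltW.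
- by move=> w _; rewrite mule_ge0 ?lee_fin ?sqr_ge0 ?invr_ge0 ?(ltW t0).
- by apply: measurable_funeM; apply/measurable_EFinP; exact: measurable_funX.
rewrite integral_cst//= probability_setT mule1 ge0_integralZl_EFin ?invr_ge0 ?(ltW t0)//; last 2 first.
- by move=> w _; rewrite lee_fin sqr_ge0.
- by apply/measurable_EFinP; exact: measurable_funX.
rewrite mulrDr mulr1 EFinD leeD2l//.
apply: (@le_trans _ _ ((t^-1)%:E * (n.+1%:R * C)%:E)%E).
  by rewrite lee_wpmul2l ?lee_fin ?invr_ge0 ?(ltW t0)//; exact: second_moment_logsum.
rewrite -EFinM lee_fin -/t.
by have -> : t^-1 * (n.+1%:R * C) = t * C by rewrite -tt; field; rewrite gt_eqF.
Qed.

Lemma logpotential_bound (C : R) (u : R[i]) :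
  (\int[mu]_x (lg (x - u) ^+ 2)%:E <= C%:E)%E -> `|U u| <= 1 + C.
Proof.
move=> CC; apply: norm_Rintegral_le; first exact: measurable_lg_shift.
have msq : measurable_fun setT (fun x : R[i] => (lg (x - u) ^+ 2)%:E).
  by apply/measurable_EFinP; apply: measurable_funX; exact: measurable_lg_shift.
apply: (@le_trans _ _ (\int[mu]_x (1%:E + (lg (x - u) ^+ 2)%:E))%E).
  apply: ge0_le_integral => //.
  - apply/measurable_EFinP; apply: measurableT_comp => //; exact: measurable_lg_shift.
  - exact: emeasurable_funD.
  - by move=> x _; rewrite -EFinD lee_fin; exact: ler_norm_sqr1.
rewrite ge0_integralD//; last by move=> x _; rewrite lee_fin sqr_ge0.
by rewrite integral_cst//= probability_setT mule1 EFinD leeD2l.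
Qed.

Lemma measurable_prodZ n u : measurable_fun setT (prodZ n u).
Proof.
apply: measurable_prodC => k; apply: measurable_subC => //; exact: measurable_RV.
Qed.

Lemma negligible_hit (a : R[i]) k : P.-negligible (Z k @^-1` [set a]).
Proof.
have m1 := measurable_set1C a.
apply/negligibleP; first by rewrite -[X in measurable X]setTI; exact: measurable_RV.
exact: etrans (Zlaw k m1) (mu_set1 mu_le a).
Qed.

(** Almost surely no [Z k] equals u or 0; such coincidences would put [lg 0 = 0] among the factors
    and break the product formula. *)
Lemma ae_max_logsum n u : {ae P, forall w,
  ln (Num.max (nc (prodZ n u w)) (nc (prodZ n 0 w))) =
  Num.max (logsum n u w) (logsum n 0 w)}.
Proof.
have neg : P.-negligible (\bigcup_k (Z k @^-1` [set u] `|` Z k @^-1` [set 0])).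
  by apply: negligible_bigcup => k; apply: negligibleU; exact: negligible_hit.
apply: negligibleS neg => w /= bad; apply: contrapT => /= good; apply: bad.
have gu (v : R[i]) : (forall k, Z k w <> v) ->
    prodZ n v w != 0 /\ lg (prodZ n v w) = logsum n v w.
  move=> Zv; have Zv0 (k : nat) : v - Z k w != 0.
    by rewrite subr_eq0; apply/eqP => vZ; apply: (Zv k).
  split; first by apply/prodf_neq0 => k _; exact: Zv0.
  by rewrite /prodZ lg_prod//; apply: eq_bigr => k _; rewrite -lgN opprB.
have [pu lu] : prodZ n u w != 0 /\ lg (prodZ n u w) = logsum n u w.
  by apply: gu => k Zk; apply: good; exists k => //; left.
have [p0 l0] : prodZ n 0 w != 0 /\ lg (prodZ n 0 w) = logsum n 0 w.
  by apply: gu => k Zk; apply: good; exists k => //; right.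
rewrite -lu -l0 /lg; rewrite -nc_gt0 in pu; rewrite -nc_gt0 in p0.
by rewrite /Num.max ltr_ln ?posrE//; case: ifP.
Qed.

(* p_{n+1}(u) - p_{n+1}(0) = p_n(u) * u - (p_n(u) - p_n(0)) * Z_n is affine in
   Z_n, which is independent of p_n and has bounded density: in mean, its lg is
   within O(1) of the ln of the larger of its two coefficients, hence of
   ln (max |p_n(u)| |p_n(0)|). *)
Lemma freezing_mean_bound : exists2 C : R, 0 <= C & forall n (u : R[i]), u != 0 ->
  (\int[P]_w `|lg (prodZ n.+1 u w - prodZ n.+1 0 w) -
     ln (Num.max (nc (prodZ n u w)) (nc (prodZ n 0 w)))|%:E <= (C + `|lg u|)%:E)%E.
Proof.
have [C C0 CC] := affine_lg_bound Mr0 R01 mu_le mu_disc.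
exists (C + 1); first by rewrite addr_ge0.
move=> n u u0.
pose h (p : (R[i] * R[i]) * R[i]) : \bar R :=
  `|lg (p.1.1 * u - (p.1.1 - p.1.2) * p.2) - ln (Num.max (nc p.1.1) (nc p.1.2))|%:E.
have m11 : measurable_fun setT (fun p : (R[i] * R[i]) * R[i] => p.1.1).
  exact: (measurableT_comp measurable_fst measurable_fst).
have m12 : measurable_fun setT (fun p : (R[i] * R[i]) * R[i] => p.1.2).
  exact: (measurableT_comp measurable_snd measurable_fst).
have mnc : measurable_fun setT (@nc R) by exact: (continuous_measurableC (@continuous_nc R)).
have mh : measurable_fun setT h.
  apply/measurable_EFinP; apply: measurableT_comp => //; apply: measurable_funB.
    apply: (measurableT_comp measurable_lg); apply: measurable_subC.
      by apply: measurable_mulC => //; exact: measurable_cst.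
    by apply: measurable_mulC => //; exact: measurable_subC.
  apply: measurableT_comp; first exact: measurable_ln.
  by apply: measurable_maxr; exact: (measurableT_comp mnc).
have h0 p : (0 <= h p)%E by rewrite lee_fin.
pose Y w := (prodZ n u w, prodZ n 0 w).
have mpast v : measurable_fun [set: g_sigma_algebraType (past Z n)] (prodZ n v).
  by apply: measurable_prodC => k; apply: measurable_subC => //; exact: measurable_past.
have mY : measurable_fun [set: g_sigma_algebraType (past Z n)] Y by exact: measurable_fun_pair.
have -> : (\int[P]_w `|lg (prodZ n.+1 u w - prodZ n.+1 0 w) -
     ln (Num.max (nc (prodZ n u w)) (nc (prodZ n 0 w)))|%:E = \int[P]_w h (Y w, Z n w))%E.
  apply: eq_integral => w _; rewrite /h /Y /=; congr (`|lg _ - _|%:E).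
  by rewrite /prodZ !big_ord_recr /=; ring.
rewrite (freezing Zindep mY mh h0).
apply: (@le_trans _ _ (\int[P]_w (C + 1 + `|lg u|)%:E)%E); last first.
  by rewrite integral_cst//= probability_setT mule1.
apply: ge0_le_integral => //.
- by move=> w _; apply: integral_ge0.
- have mF := @measurable_fun_fubini_tonelli_F _ _ _ _ _ (distribution P (Z n)) h mh h0.
  apply: (measurableT_comp mF); apply: measurable_fun_pair; exact: measurable_prodZ.
move=> w _; rewrite integral_law /h /=; set a := prodZ n u w; set b := prodZ n 0 w.
pose c := ln (Num.max (nc (a * u)) (nc (a - b))).
have ma := measurable_affine_lg (a * u) (a - b) c.
apply: (@le_trans _ _ (\int[mu]_x (`|lg (a * u - (a - b) * x) - c|%:E + (1 + `|lg u|)%:E))%E).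
  apply: ge0_le_integral => //.
  - exact: measurable_affine_lg.
  - exact: emeasurable_funD.
  move=> x _; rewrite -EFinD lee_fin.
  have := max_affine_ratio a b u0; rewrite -/c.
  set v := ln (Num.max (nc a) _); set t := lg (_ - _) => cv.
  rewrite (_ : t - v = (t - c) + (c - v)); last by ring.
  by apply: le_trans (ler_normD _ _) _; rewrite lerD2l.
rewrite ge0_integralD//.
rewrite integral_cst//= probability_setT mule1 -(addrA C) (EFinD C) leeD2r//; exact: CC.
Qed.

(** An error of order sqrt n against a normalisation by n + 1. The term |lg u| reflects that q_{n+1}
    vanishes at u = 0; it is locally integrable. *)
Theorem mean_log_bound (M : R) : 0 <= M -> exists2 K : R, 0 <= K &
  forall n (u : R[i]), u != 0 -> nc u <= M ->
  (\int[P]_w `|lg (prodZ n.+1 u w - prodZ n.+1 0 w) - n.+1%:R * maxpotential u|%:E <=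
   (K * (1 + Num.sqrt n%:R) + `|lg u|)%:E)%E.
Proof.
move=> M0.
have [C C0 CC] := mu_lg_sq Mr0 mu_le mu_disc M.
have [C1 C10 C1C] := freezing_mean_bound.
exists (C1 + 2 * (1 + C) + (1 + C)); first by rewrite !addr_ge0// mulr_ge0// addr_ge0.
move=> n u u0 uM.
have Cu := CC u uM.
have C0' : (\int[mu]_x (lg (x - 0) ^+ 2)%:E <= C%:E)%E by apply: CC; rewrite nc0.
have Vb : `|maxpotential u| <= 1 + C.
  have := logpotential_bound Cu; have := logpotential_bound C0'.
  by rewrite /maxpotential /Num.max; case: ifP.
set V := maxpotential u in Vb *.
pose A w := lg (prodZ n.+1 u w - prodZ n.+1 0 w) -
  ln (Num.max (nc (prodZ n u w)) (nc (prodZ n 0 w))).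
pose B v w := logsum n v w - n%:R * U v.
have mnc : measurable_fun setT (@nc R) by exact: (continuous_measurableC (@continuous_nc R)).
have mlgq : measurable_fun setT (fun w => lg (prodZ n.+1 u w - prodZ n.+1 0 w)).
  by apply: (measurableT_comp measurable_lg); apply: measurable_subC; exact: measurable_prodZ.
have mA : measurable_fun setT (fun w => `|A w|%:E).
  apply/measurable_EFinP; apply: measurableT_comp => //; apply: measurable_funB => //.
  apply: measurableT_comp; first exact: measurable_ln.
  by apply: measurable_maxr; apply: (measurableT_comp mnc); exact: measurable_prodZ.
have mB v : measurable_fun setT (fun w => `|B v w|%:E).
  apply/measurable_EFinP; apply: measurableT_comp => //; apply: measurable_funB => //.
  exact: measurable_logsum.
(* [A] is the affine step and [B u], [B 0] are the law of large numbers at u and 0; the final 1 + C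
   pays for replacing n V by (n + 1) V. *)
apply: (@le_trans _ _ (\int[P]_w (`|A w|%:E + (`|B u w|%:E + (`|B 0 w|%:E + (1 + C)%:E))))%E).
  apply: ae_ge0_le_integral => //.
  - apply/measurable_EFinP; apply: measurableT_comp => //; exact: measurable_funB.
  - move=> w _; rewrite -!EFinD lee_fin !addr_ge0//.
  - by do ?[apply: emeasurable_funD => //].
  have := ae_max_logsum n u; apply: filterS => w ml _.
  rewrite -!EFinD lee_fin /A /B ml.
  set t := lg _; set s := Num.max _ _.
  rewrite (_ : t - _ = (t - s) + (s - n%:R * V) - V); last by rewrite -natr1; ring.
  apply: le_trans (ler_normB _ _) _.
  apply: le_trans (lerD (ler_normD _ _) Vb) _.
  have nV : n%:R * V = Num.max (n%:R * U u) (n%:R * U 0) by rewrite maxr_pMr.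
  have := dist_max_le (logsum n u w) (logsum n 0 w) (n%:R * U u) (n%:R * U 0).
  by rewrite -nV -/s !addrA !lerD2r => smax; rewrite -addrA lerD2l.
rewrite ge0_integralD//; last 2 first.
- by move=> w _; rewrite -!EFinD lee_fin !addr_ge0.
- by do ?[apply: emeasurable_funD => //].
rewrite ge0_integralD//; last 2 first.
- by move=> w _; rewrite -!EFinD lee_fin !addr_ge0.
- by do ?[apply: emeasurable_funD => //].
rewrite ge0_integralD//; last by move=> w _; rewrite lee_fin addr_ge0.
rewrite integral_cst//= probability_setT mule1.
have s0 : 0 <= Num.sqrt n%:R :> R by exact: sqrtr_ge0.
apply: (@le_trans _ _ ((C1 + `|lg u|)%:E + ((Num.sqrt n%:R * (1 + C))%:E +
    ((Num.sqrt n%:R * (1 + C))%:E + (1 + C)%:E)))%E).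
  apply: leeD; first exact: C1C.
  apply: leeD; first exact: first_moment_logsum.
  by apply: leeD => //; exact: first_moment_logsum.
rewrite -!EFinD lee_fin.
have := mulr_ge0 C10 s0; have := mulr_ge0 C0 s0; nra.
Qed.

End mean_log_bound.

(** * Level roots *)

Section level_set.
Context {R : realType}.
Local Notation lam := (@lebesgueC R).

Lemma random_poly_horner (z : nat -> R[i]) n u :
  (random_poly z n).[u] = \prod_(k < n) (u - z k).
Proof.
rewrite /random_poly (@horner_prod _ _ (index_enum _) predT).
by apply: eq_bigr => k _; rewrite hornerXsubC.
Qed.

Lemma level_roots_prod (z : nat -> R[i]) n :
  random_poly z n.+1 - ((random_poly z n.+1).[0])%:P =
  \prod_(a <- level_roots (random_poly z n.+1)) ('X - a%:P).
Proof.
have sz : size (random_poly z n.+1) = n.+2.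
  by rewrite /random_poly size_prod_XsubC -[index_enum _]enumT size_enum_ord.
have := svalP (closed_field_poly_normal (random_poly z n.+1 - ((random_poly z n.+1).[0])%:P)).
rewrite -/(level_roots _).
have -> : lead_coef (random_poly z n.+1 - ((random_poly z n.+1).[0])%:P) = 1.
  rewrite lead_coefDl; last by rewrite size_polyN sz; apply: leq_ltn_trans (size_polyC_leq1 _) _.
  by apply/eqP; rewrite -monicE /random_poly; exact: (@monic_prod_XsubC _ _ (index_enum _) predT).
by rewrite scale1r.
Qed.

Lemma size_level_roots (z : nat -> R[i]) n :
  size (level_roots (random_poly z n.+1)) = n.+1.
Proof.
have sz : size (random_poly z n.+1) = n.+2.
  by rewrite /random_poly size_prod_XsubC -[index_enum _]enumT size_enum_ord.
apply: succn_inj; rewrite -(size_prod_XsubC _ id) -level_roots_prod size_polyDl// sz.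
by rewrite size_polyN; apply: leq_ltn_trans (size_polyC_leq1 _) _.
Qed.

Lemma prod_level_roots (z : nat -> R[i]) n u :
  \prod_(k < n.+1) (u - z k) - \prod_(k < n.+1) (0 - z k) =
  \prod_(a <- level_roots (random_poly z n.+1)) (u - a).
Proof.
have /(congr1 (fun p => p.[u])) := level_roots_prod z n.
rewrite hornerD hornerN hornerC !random_poly_horner => ->.
by rewrite horner_prod; apply: eq_bigr => a _; rewrite hornerXsubC.
Qed.

(** If |a| > 2 M, then |a - z k| > M >= |z k| for every k, so |p(a)| > |p(0)|. *)
Lemma level_roots_bound (z : nat -> R[i]) n (M : R) :
  (forall k, (k < n.+1)%N -> nc (z k) <= M) ->
  forall a, a \in level_roots (random_poly z n.+1) -> nc a <= 2 * M.
Proof.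
move=> zM a /(nthP 0)[i isz ai].
have qa : \prod_(b <- level_roots (random_poly z n.+1)) (a - b) = 0.
  apply/eqP; rewrite prodf_seq_eq0; apply/hasP; exists a; rewrite ?subrr//=.
  by rewrite -ai mem_nth.
move: qa; rewrite -prod_level_roots => /subr0_eq/(congr1 (@nc R)); rewrite !nc_prod => E.
rewrite leNgt; apply/negP => aM.
suff : \prod_(0 <= k < n.+1) nc (0 - z k) < \prod_(0 <= k < n.+1) nc (a - z k).
  by rewrite !big_mkord E ltxx.
apply: ltr_prod_nat => // k /andP[_ kn]; rewrite nc_ge0 /= sub0r ncN.
have := zM k kn; have := nc_triangle (a - z k) (z k); rewrite subrK; lra.
Qed.

Lemma empirical_measure_integral (s : seq R[i]) (f : R[i] -> R) : measurable_fun setT f ->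
  \int[empirical_measure s]_z f z = (size s)%:R^-1 * \sum_(a <- s) f a.
Proof.
move=> mf.
have ge0_int (g : R[i] -> \bar R) : measurable_fun setT g -> (forall u, 0 <= g u)%E ->
    (\int[empirical_measure s]_z g z = ((size s)%:R^-1)%:E * \sum_(k < size s) g s`_k)%E.
  move=> mg g0; rewrite ge0_integral_mscale//= ge0_integral_measure_sum//; congr (_ * _)%E.
  by apply: eq_bigr => k _; rewrite integral_dirac// diracT mul1e.
have fsum (g : R[i] -> R) : (\sum_(k < size s) (g s`_k)%:E)%E = (\sum_(a <- s) g a)%:E.
  by rewrite (big_nth 0) big_mkord sumEFin.
rewrite /Rintegral integralE !ge0_int//; last 2 first.
- by apply: measurable_funeneg; exact/measurable_EFinP.
- by apply: measurable_funepos; exact/measurable_EFinP.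
have pE a : ((fun x => (f x)%:E)^\+ a)%E = (Num.max (f a) 0)%:E.
  by rewrite funeposE EFin_max.
have nE a : ((fun x => (f x)%:E)^\- a)%E = (Num.max (- f a) 0)%:E.
  by rewrite funenegE EFin_max.
rewrite (eq_bigr _ (fun (k : 'I_(size s)) _ => pE _)) (eq_bigr _ (fun (k : 'I_(size s)) _ => nE _)).
rewrite (fsum (fun a => Num.max (f a) 0)) (fsum (fun a => Num.max (- f a) 0)).
rewrite -!EFinM -EFinB /= -mulrBr -sumrB; congr (_ * _); apply: eq_bigr => a _.
rewrite /Num.max oppr_lt0; case: (ltrgtP (f a) 0) => [||->]; rewrite ?sub0r ?opprK ?subr0//.
Qed.

(** Off the roots, lg (q u) is the sum of the lg (u - a); the finitely many roots are Lebesgue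
    null. *)
Lemma logpot_level_roots (F : R[i] -> R) (z : nat -> R[i]) n : bounded_on_support F ->
  let q u := \prod_(k < n.+1) (u - z k) - \prod_(k < n.+1) (0 - z k) in
  lam.-integrable setT (fun u => (F u * lg (q u))%:E) /\
  \int[lam]_u (F u * lg (q u)) =
    \sum_(a <- level_roots (random_poly z n.+1)) logpot F a.
Proof.
move=> bF q; set s := level_roots _.
have [iF E] : lam.-integrable setT (fun u => (F u * \sum_(a <- s) lg (u - a))%:E) /\
    \int[lam]_u (F u * \sum_(a <- s) lg (u - a)) = \sum_(a <- s) logpot F a.
  elim: s => [|a s [IHi IH]].
    split; first by under eq_fun do rewrite big_nil mulr0; exact: integrable0.
    by rewrite big_nil /Rintegral integral0_eq// => u _; rewrite big_nil mulr0.
  have E : (fun u => F u * \sum_(b <- a :: s) lg (u - b)) =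
      (fun u => F u * lg (u - a) + F u * \sum_(b <- s) lg (u - b)).
    by apply/funext => u; rewrite big_cons mulrDr.
  have ia := bcs_integrable_lg a bF.
  split.
    rewrite (_ : (fun _ => _) = EFin \o (fun u => F u * \sum_(b <- a :: s) lg (u - b)))//.
    by rewrite E; exact: (integrableD measurableT ia IHi).
  by rewrite E RintegralD// IH big_cons.
have mq : measurable_fun setT (fun u => (F u * lg (q u))%:E).
  apply/measurable_EFinP; apply: measurable_funM; first exact: bcs_measurable.
  apply: (measurableT_comp measurable_lg); apply: measurable_subC; last exact: measurable_cst.
  by apply: measurable_prodC => k; apply: measurable_subC => //; exact: measurable_cst.
have mF : measurable_fun setT (fun u => (F u * \sum_(a <- s) lg (u - a))%:E).
  by case/integrableP: iF.
have Fq (G : R -> \bar R) : ae_eq lam setT (fun u => G (F u * lg (q u)))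
    (fun u => G (F u * \sum_(a <- s) lg (u - a))).
  (* Indices past the end of the list give the default value 0, which adds one harmless point. *)
  have neg : lam.-negligible (\bigcup_k [set s`_k]).
    apply: negligible_bigcup => k; apply/negligibleP; last exact: lebesgueC_set1.
    exact: measurable_set1C.
  apply: negligibleS neg => u /= bad; apply: contrapT => /= good; apply: bad => _.
  congr (G (_ * _)); rewrite /q prod_level_roots lg_prod// => a /(nthP 0)[i isz ai].
  by apply: contra_notN good => /eqP/subr0_eq ->; exists i.
split; last by rewrite -E; congr fine; apply: ae_eq_integral => //; exact: (Fq EFin).
apply/integrableP; split => //.
have -> : (\int[lam]_u `|(F u * lg (q u))%:E| =
    \int[lam]_u `|(F u * \sum_(a <- s) lg (u - a))%:E|)%E.
  apply: ae_eq_integral => //; last exact: (Fq (fun x => `|x%:E|%E)).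
  - exact: measurableT_comp mq.
  - exact: measurableT_comp mF.
by case/integrableP: iF.
Qed.

End level_set.

(** * From bounds in mean to convergence in probability *)

Section integral_in_probability.
Context {R : realType} {d d' : measure_display} {T : measurableType d}
  {X : measurableType d'} (P : probability T R)
  (m : {sigma_finite_measure set X -> \bar R}).

Lemma measurable_Rintegral_param (g : T * X -> R) : measurable_fun setT g ->
  measurable_fun setT (fun w => \int[m]_u g (w, u)).
Proof.
move=> /measurable_EFinP mg.
have mp := @measurable_fun_fubini_tonelli_F _ _ _ _ _ m _ (measurable_funepos mg) (fun p => funepos_ge0 _ p).
have mn := @measurable_fun_fubini_tonelli_F _ _ _ _ _ m _ (measurable_funeneg mg) (fun p => funeneg_ge0 _ p).
apply: (measurableT_comp (@fine_measurable R setT measurableT)).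
rewrite (_ : (fun _ => _) = (fun w => fubini_F m (EFin \o g)^\+ w - fubini_F m (EFin \o g)^\- w))%E.
  exact: emeasurable_funB.
apply/funext => w; rewrite integralE /fubini_F; congr (_ - _)%E.
  by apply: eq_integral => u _; rewrite !funeposE.
by apply: eq_integral => u _; rewrite !funenegE.
Qed.

(** Markov's inequality for the absolute value of the integral in u, followed by Tonelli to exchange
    the order of integration. *)
Lemma prob_Rintegral_ge (g : T * X -> R) (e C : R) : measurable_fun setT g -> 0 < e ->
  (\int[m]_u \int[P]_w `|g (w, u)|%:E <= C%:E)%E ->
  (P [set w | (e <= `|\int[m]_u g (w, u)|)%R] <= (e^-1 * C)%:E)%E.
Proof.
move=> mg e0 gC; have mY := measurable_Rintegral_param mg.
have mag : measurable_fun setT (fun p => `|g p|%:E).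
  by apply/measurable_EFinP; exact: measurableT_comp.
have := @le_integral_comp_abse _ _ _ P setT measurableT (fun w => (\int[m]_u g (w, u))%:E) e id
  (@measurable_id _ _ setT) (fun _ => id) (fun _ _ _ _ => id) ((measurable_EFinP _ _).2 mY) e0.
rewrite setTI => markov.
have PY : (e%:E * P [set w | (e <= `|\int[m]_u g (w, u)|)%R] <= C%:E)%E.
  apply: le_trans markov _; apply: le_trans gC; rewrite -(fubini_tonelli _ mag)//.
  apply: ge0_le_integral => //.
  - by apply: measurableT_comp => //; apply/measurable_EFinP.
  - exact: (@measurable_fun_fubini_tonelli_F _ _ _ _ _ m _ mag).
  move=> w _; have mgw : measurable_fun setT (fun u => g (w, u)).
    exact: measurableT_comp mg (pair1_measurable w).
  (* Where the section is not integrable the right-hand side is +oo, whatever default value its real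
     integral takes. *)
  case: (ltP (\int[m]_u `|g (w, u)|%:E)%E +oo%E) => [fin|]; last by rewrite leye_eq => /eqP ->; rewrite leey.
  rewrite -[leRHS]fineK ?ge0_fin_numE ?integral_ge0// lee_fin.
  by apply: norm_Rintegral_le => //; rewrite fineK ?ge0_fin_numE ?integral_ge0.
have fP : P [set w | (e <= `|\int[m]_u g (w, u)|)%R] \is a fin_num.
  apply: fin_num_measure.
  rewrite -[X in measurable X]setTI.
  have := measurableT_comp (@normr_measurable R setT) mY => mYa.
  have := mYa measurableT _ (measurable_itv `[e, +oo[); rewrite !setTI.
  by congr measurable; apply/seteqP; split => w /=; rewrite in_itv /= andbT.
by rewrite -(fineK fP) -EFinM in PY *; rewrite lee_fin in PY; rewrite lee_fin ler_pdivlMl.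
Qed.

End integral_in_probability.

Section averaged_convergence.
Context {R : realType} (mu : probability R[i] R) (Mr R0 : R).
Context (Mr0 : 0 <= Mr) (R01 : 1 <= R0).
Context (mu_le : forall E, measurable E -> (mu E <= Mr%:E * @lebesgueC R E)%E).
Context (mu_disc : mu (~` disc R0) = 0%E).
Context {d : measure_display} {T : measurableType d} (P : probability T R).
Context (Z : nat -> {RV P >-> R[i]}).
Context (Zindep : mutually_independent P Z).
Context (Zlaw : forall k (E : set R[i]), measurable E -> distribution P (Z k) E = mu E).

Local Notation lam := (@lebesgueC R).
Local Notation V := (maxpotential mu).

(* The degree is n.+1: the polynomial of degree 0 has no level roots to average
   over. *)
Definition root_average (f : R[i] -> R) (n : nat) (w : T) : R :=
  n.+1%:R^-1 * \sum_(a <- level_roots (random_poly (fun k => Z k w) n.+1)) f a.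

Lemma continuous_maxpotential : continuous V.
Proof.
have cU := continuous_logpotential Mr0 mu_le mu_disc.
by move=> u; exact: (continuous_max (cU u) (@cst_continuous _ _ _ _)).
Qed.

Lemma bcs_mul_continuous (F g : R[i] -> R) : bounded_on_support F -> continuous g ->
  bounded_on_support (fun u => F u * g u).
Proof.
move=> [mF [M [K [K0 FK]]]] cg; split.
  by apply: measurable_funM => //; exact: continuous_measurableC.
have [K' K'0 gK'] := @bounded_on_disc R g M cg.
exists M, (K * K'); split; first exact: mulr_ge0.
move=> u; have := FK u; rewrite normrM indicE; case: (boolP (u \in disc M)).
  rewrite inE !mulr1 => uM Fu; apply: ler_pM => //; exact: gK'.
by rewrite !mulr0 normr_le0 => _ /eqP ->; rewrite normr0 mul0r.
Qed.

Let qn n (p : T * R[i]) := prodZ Z n p.2 p.1 - prodZ Z n 0 p.1.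

Let measurable_qn n : measurable_fun setT (qn n).
Proof.
have mZ k : measurable_fun setT (fun p : T * R[i] => Z k p.1).
  exact: (measurableT_comp (measurable_RV Z k) measurable_fst).
apply: measurable_subC; apply: measurable_prodC => k; exact: measurable_subC.
Qed.

Let g (F : R[i] -> R) n (p : T * R[i]) :=
  F p.2 * (n.+1%:R^-1 * lg (qn n.+1 p) - V p.2).

Let measurable_g F n : bounded_on_support F -> measurable_fun setT (g F n).
Proof.
move=> bF; apply: measurable_funM.
  exact: measurableT_comp (bcs_measurable bF) _.
apply: measurable_funB; last first.
  by apply: measurableT_comp => //; exact: (continuous_measurableC continuous_maxpotential).
by apply: measurable_funM => //; apply: measurableT_comp (measurable_qn _); exact: measurable_lg.
Qed.

Let root_averageE F n w : bounded_on_support F ->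
  root_average (logpot F) n w - \int[lam]_u (F u * V u) = \int[lam]_u g F n (w, u).
Proof.
move=> bF.
have [iF E] := logpot_level_roots (fun k => Z k w) n bF.
have iV := bcs_integrable (bcs_mul_continuous bF continuous_maxpotential).
have iF' := integrableZl measurableT n.+1%:R^-1 iF.
rewrite /root_average -E.
rewrite -(RintegralZl n.+1%:R^-1 measurableT iF) -RintegralB//.
by apply: eq_Rintegral => u _; rewrite /g /qn /prodZ /=; ring.
Qed.

Lemma measurable_root_average_logpot F n : bounded_on_support F ->
  measurable_fun setT (root_average (logpot F) n).
Proof.
move=> bF.
rewrite (_ : root_average _ _ = fun w => \int[lam]_u g F n (w, u) + \int[lam]_u (F u * V u)).
  have mI := @measurable_Rintegral_param R _ _ T R[i] lam _ (measurable_g n bF).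
  exact: (measurable_funD mI (measurable_cst _)).
by apply/funext => w; rewrite -root_averageE// subrK.
Qed.

(** By [root_averageE] the deviation is an integral in u, whose mean absolute value is O(n^-1/2) by
    [mean_log_bound]. *)
Theorem cvg_root_average_logpot F : bounded_on_support F ->
  cvg_in_probability P (root_average (logpot F)) (\int[lam]_u (F u * V u)).
Proof.
move=> bF; have [mF [M' [K [K0 FK']]]] := bF.
pose M := Num.max M' 0.
have FK u : `|F u| <= K * \1_(disc M) u.
  by apply: le_trans (FK' u) _; rewrite ler_wpM2l// indic_disc_le// le_max lexx.
have M0 : 0 <= M by rewrite le_max lexx orbT.
have [K1 K10 bound] := mean_log_bound Mr0 R01 mu_le mu_disc Zindep Zlaw M0.
(* An integrable majorant in u that does not depend on n: the n-dependence of [mean_log_bound]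
   factors out as [c] below. *)
pose h u := K * \1_(disc M) u * (K1 + `|lg u|).
have ih : lam.-integrable setT (EFin \o h).
  have := integrableZl measurableT (K * (K1 + 1)) (integrable_disc_lg_sq M 0).
  apply: le_integrable => //.
    apply/measurable_EFinP; apply: measurable_funM.
      apply: measurable_funM => //; apply: measurable_indic; exact: measurable_disc.
    apply: measurable_funD => //; apply: measurableT_comp => //; exact: measurable_lg.
  move=> u _; rewrite /= lee_fin subr0 /h.
  have i0 : 0 <= \1_(disc M) u :> R by rewrite indicE ler0n.
  rewrite ger0_norm; last by rewrite !mulr_ge0// addr_ge0.
  apply: le_trans (ler_norm _).
  rewrite -!mulrA ler_wpM2l// mulrCA ler_wpM2l//.
  have := ler_norm_sqr1 (lg u); have := sqr_ge0 (lg u); have := normr_ge0 (lg u); nra.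
pose H := \int[lam]_u h u.
have hH : (\int[lam]_u (h u)%:E = H%:E)%E.
  by rewrite fineK//; exact: (integrable_fin_num measurableT ih).
move=> e e0.
have meanbound n : (\int[lam]_u \int[P]_w `|g F n (w, u)|%:E <=
    (2 * Num.sqrt n.+1%:R^-1 * H)%:E)%E.
  (* (1 + sqrt n) / (n + 1) <= 2 / sqrt(n + 1). *)
  pose c : R := n.+1%:R^-1 * (1 + Num.sqrt n%:R).
  have n0 : 0 < n.+1%:R :> R by rewrite ltr0n.
  have sn0 : 0 <= Num.sqrt n%:R :> R by exact: sqrtr_ge0.
  have c0 : 0 <= c by rewrite mulr_ge0// ?invr_ge0 ?addr_ge0.
  have H0 : 0 <= H.
    by apply: Rintegral_ge0 => // u _; rewrite !mulr_ge0 ?indicE ?ler0n ?addr_ge0.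
  have c2 : c <= 2 * Num.sqrt n.+1%:R^-1.
    rewrite sqrtrV ?ler0n// /c mulrC ler_pdivrMr// -mulrA.
    have s1 : 1 <= Num.sqrt n.+1%:R :> R by rewrite -[leLHS]sqrtr1 ler_wsqrtr// ler1n.
    have -> : (Num.sqrt n.+1%:R)^-1 * n.+1%:R = Num.sqrt n.+1%:R :> R.
      by rewrite -[X in _ * X]sqr_sqrtr ?ler0n// expr2 mulKf// gt_eqF// (lt_le_trans ltr01).
    have : Num.sqrt n%:R <= Num.sqrt n.+1%:R :> R by rewrite ler_wsqrtr// ler_nat.
    by move=> ?; lra.
  apply: (@le_trans _ _ (c * H)%:E); last by rewrite lee_fin ler_wpM2r.
  rewrite EFinM -hH -integralZl//.
  have mag : measurable_fun setT (fun p => `|g F n p|%:E).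
    by apply/measurable_EFinP; apply: measurableT_comp => //; exact: measurable_g.
  apply: ae_ge0_le_integral => //.
  - by move=> u _; apply: integral_ge0.
  - exact: (@measurable_fun_fubini_tonelli_G _ _ _ _ _ P _ mag).
  - by move=> u _; rewrite -EFinM lee_fin mulr_ge0// !mulr_ge0 ?indicE ?ler0n ?addr_ge0.
  - by apply: emeasurable_funM => //; case/integrableP: ih.
  have neg : lam.-negligible [set 0 : R[i]].
    by apply/negligibleP; [exact: measurable_set1C|exact: lebesgueC_set1].
  apply: negligibleS neg => u /= bad; apply: contrapT => /= /eqP u0; apply: bad => _.
  have mw : measurable_fun setT
      (fun w => `|lg (qn n.+1 (w, u)) - n.+1%:R * V u|%:E : \bar R).
    apply/measurable_EFinP; apply: measurableT_comp => //; apply: measurable_funB => //.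
    apply: (measurableT_comp measurable_lg).
    exact: measurableT_comp (measurable_qn _) (pair2_measurable u).
  have gE w : `|g F n (w, u)|%:E =
      ((`|F u| * n.+1%:R^-1)%:E * `|lg (qn n.+1 (w, u)) - n.+1%:R * V u|%:E)%E.
    rewrite /g /= -EFinM; congr (_%:E).
    rewrite normrM -mulrA; congr (_ * _).
    have nn : 0 <= n.+1%:R^-1 :> R by rewrite invr_ge0 ler0n.
    rewrite -{2}(ger0_norm nn) -normrM; congr (`|_|).
    by rewrite mulrBr mulKf// gt_eqF.
  under eq_integral do rewrite gE.
  rewrite ge0_integralZl//.
  case: (boolP (u \in disc M)) => uM; last first.
    have -> : F u = 0.
      apply/eqP; rewrite -normr_le0; apply: le_trans (FK u) _.
      by rewrite indicE (negbTE uM) mulr0.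
    by rewrite normr0 mul0r mul0e /h indicE (negbTE uM) mulr0 mul0r mule0.
  have := bound n u u0; rewrite inE in uM => /(_ uM) bnd.
  apply: (@le_trans _ _ ((`|F u| * n.+1%:R^-1)%:E * (K1 * (1 + Num.sqrt n%:R) + `|lg u|)%:E)%E).
    by apply: lee_wpmul2l => //; rewrite lee_fin mulr_ge0// invr_ge0.
  rewrite -!EFinM lee_fin /c /h indicE mem_set// mulr1.
  have Fu : `|F u| <= K by apply: le_trans (FK u) _; rewrite indicE mem_set// mulr1.
  rewrite -!mulrA mulrCA ler_wpM2l ?invr_ge0// mulrCA.
  apply: ler_pM => //; first by rewrite addr_ge0// mulr_ge0// addr_ge0.
  have := normr_ge0 (lg u); nra.
have cv0 : (e^-1 * (2 * Num.sqrt n.+1%:R^-1 * H))%:E @[n --> \oo] --> 0%:E.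
  apply: cvg_EFin; first by near=> n.
  rewrite [X in _ --> X](_ : 0 = e^-1 * (2 * Num.sqrt 0 * H)); last first.
    by rewrite sqrtr0 mulr0 mul0r mulr0.
  apply: cvgMl_tmp; apply: cvgMr_tmp; apply: cvgMl_tmp.
  by apply: continuous_cvg; [exact: sqrt_continuous|exact: cvg_harmonic].
apply: (squeeze_cvge _ (cvg_cst 0%E) cv0); near=> n.
rewrite measure_ge0 /=.
rewrite (_ : [set w | _] = [set w | e <= `|\int[lam]_u g F n (w, u)|]).
  exact: (@prob_Rintegral_ge R _ _ T R[i] P lam _ _ _ (measurable_g n bF) e0 (meanbound n)).
by apply/seteqP; split => w /=; rewrite root_averageE.
Unshelve. all: end_near. Qed.

End averaged_convergence.

(** * Limits in probability of root averages *)

Section in_probability.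
Context {R : realType} {d : measure_display} {T : measurableType d} (P : probability T R).
Context (G : set T) (G1 : P (~` G) = 0%E) (mG : measurable G).
Implicit Types X Y Z : nat -> T -> R.

Lemma measurable_dist_ge (X : T -> R) (a e : R) : measurable_fun setT X ->
  measurable [set w | e <= `|X w - a|].
Proof.
move=> mX; have mY : measurable_fun setT (fun w => `|X w - a|).
  by apply: measurableT_comp => //; exact: measurable_funB.
rewrite -[X in measurable X]setTI.
have := mY measurableT _ (measurable_itv `[e, +oo[); rewrite !setTI.
by congr measurable; apply/seteqP; split => w /=; rewrite in_itv /= andbT.
Qed.

(** Transfers convergence through a deterministic implication valid on the almost sure event [G].
    Two input sequences are allowed in order to treat sums. *)
Lemma prob_dist_ge_cvg0 X Y Z (a b c e e' : R) :
  (forall n, measurable_fun setT (X n)) -> (forall n, measurable_fun setT (Y n)) ->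
  (forall n, measurable_fun setT (Z n)) -> 0 < e' ->
  (forall n w, G w -> `|X n w - a| < e' -> `|Y n w - b| < e' -> `|Z n w - c| < e) ->
  cvg_in_probability P X a -> cvg_in_probability P Y b ->
  P [set w | e <= `|Z n w - c|] @[n --> \oo] --> 0%E.
Proof.
move=> mX mY mZ e'0 H Xa Yb.
have cv : (P [set w | (e' <= `|X n w - a|)%R] + P [set w | (e' <= `|Y n w - b|)%R])%E
    @[n --> \oo] --> (0 : \bar R)%E.
  by rewrite -(adde0 0%E); apply: cvgeD => //; [exact: Xa|exact: Yb].
apply: (squeeze_cvge _ (cvg_cst 0%E) cv); near=> n; rewrite measure_ge0 /=.
apply: (@le_trans _ _ (P ((~` G) `|` ([set w | (e' <= `|X n w - a|)%R] `|` [set w | (e' <= `|Y n w - b|)%R])))%E).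
  apply: le_measure; rewrite ?inE; first exact: measurable_dist_ge.
    apply: measurableU; first exact: measurableC.
    by apply: measurableU; exact: measurable_dist_ge.
  move=> w /= ew; have [Gw|] := pselect (G w); last by left.
  right; apply: contrapT => /not_orP[/negP]; rewrite -ltNge => Xw /negP; rewrite -ltNge => Yw.
  by have := H n w Gw Xw Yw; rewrite ltNge ew.
apply: le_trans (measureU2 _ _ _) _.
- exact: measurableC.
- by apply: measurableU; exact: measurable_dist_ge.
- rewrite [X in (X + _)%E](G1 : _ = _) add0e; apply: measureU2; exact: measurable_dist_ge.
Unshelve. all: end_near. Qed.

Lemma in_probability_joint X Y (a b e : R) :
  (forall n, measurable_fun setT (X n)) -> (forall n, measurable_fun setT (Y n)) ->
  cvg_in_probability P X a -> cvg_in_probability P Y b -> 0 < e ->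
  exists n w, [/\ G w, `|X n w - a| < e & `|Y n w - b| < e].
Proof.
move=> mX mY Xa Yb e0; apply: contrapT => H.
(* If no sample were close for both sequences, the constant 0 would converge in probability to 1:
   the implication holds vacuously, yet the event has probability 1. *)
have := prob_dist_ge_cvg0 (Z := fun _ _ => 0) (c := 1) (e := 1) mX mY
  (fun=> measurable_cst _) e0 _ Xa Yb.
have noG n w : G w -> `|X n w - a| < e -> `|Y n w - b| < e -> `|0 - 1| < 1 :> R.
  by move=> Gw Xw Yw; exfalso; apply: H; exists n, w.
move=> /(_ noG); rewrite (_ : [set w | _] = setT); last first.
  by apply/seteqP; split => w //= _; rewrite sub0r normrN normr1.
rewrite probability_setT => c1.
have c2 : (1%E : \bar R) @[_ --> \oo] --> (1%E : \bar R) by exact: cvg_cst.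
have E : (0 : \bar R)%E = 1%E by exact: (cvg_unique (@ereal_hausdorff R) c1 c2).
by have := @lte01 R; rewrite -E ltxx.
Qed.

Lemma in_probability_dist_le X Y (a b e : R) :
  (forall n, measurable_fun setT (X n)) -> (forall n, measurable_fun setT (Y n)) ->
  cvg_in_probability P X a -> cvg_in_probability P Y b ->
  (forall n w, G w -> `|X n w - Y n w| <= e) -> `|a - b| <= e.
Proof.
move=> mX mY Xa Yb XY; rewrite leNgt; apply/negP => ab.
have e0 : 0 < (`|a - b| - e) / 2 by rewrite divr_gt0// subr_gt0.
have [n [w [Gw Xw Yw]]] := in_probability_joint mX mY Xa Yb e0.
have := XY n w Gw.
have := ler_normD (a - X n w) (X n w - Y n w); have := ler_normD (a - Y n w) (Y n w - b).
rewrite !addrA !subrK => h1 h2; rewrite (distrC (X n w)) in Xw; lra.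
Qed.

End in_probability.

Lemma near_harmonic (R : realType) (e : R) : 0 < e -> \forall m \near \oo, m.+1%:R^-1 <= e.
Proof.
move=> e0; near=> m; rewrite -[leRHS]invrK lef_pV2 ?posrE ?invr_gt0 ?ltr0n//.
apply: (@le_trans _ _ m%:R); last by rewrite ler_nat.
by near: m; exact: nbhs_infty_ger.
Unshelve. all: end_near. Qed.

Lemma logpot_approx (R : realType) (f : R[i] -> R) (r d : R) : continuous f -> 0 < d ->
  exists F : R[i] -> R, bounded_on_support F /\ forall w, nc w <= r -> `|f w - logpot F w| <= d.
Proof.
(* A continuous cutoff, equal to 1 on [disc r] and to 0 beyond radius r + 1. *)
move=> cf d0; pose chi (u : R[i]) : R := Num.max 0 (Num.min 1 (r + 1 - nc u)).
have cchi : continuous chi.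
  have c1 : continuous (fun u : R[i] => Num.min 1 (r + 1 - nc u)).
    apply: continuous_minC; first exact: continuous_cstC.
    by apply: continuous_subC; [exact: continuous_cstC|exact: continuous_nc].
  by move=> u; exact: (continuous_max (@cst_continuous _ _ _ _) (c1 u)).
have f0 u : r + 1 < nc u -> f u * chi u = 0.
  move=> ru; rewrite /chi max_l ?mulr0// ge_min; apply/orP; right; lra.
have [F [bF _ _ Ff]] := @logpot_dense R _ _ _ r _ (continuous_mulC cf cchi) f0 ltr01 d0.
exists F; split => // w wr; have := Ff w wr.
rewrite (_ : chi w = 1) ?mulr1// /chi.
by rewrite min_l ?max_r ?ler01//; lra.
Qed.

(** * The limit functional on continuous functions *)

Section limit_functional.
Context {R : realType} (mu : probability R[i] R) (Mr R0 : R).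
Context (Mr0 : 0 <= Mr) (R01 : 1 <= R0).
Context (mu_le : forall E, measurable E -> (mu E <= Mr%:E * @lebesgueC R E)%E).
Context (mu_disc : mu (~` disc R0) = 0%E).
Context {d : measure_display} {T : measurableType d} (P : probability T R).
Context (Z : nat -> {RV P >-> R[i]}).
Context (Zindep : mutually_independent P Z).
Context (Zlaw : forall k (E : set R[i]), measurable E -> distribution P (Z k) E = mu E).

Local Notation lam := (@lebesgueC R).
Local Notation V := (maxpotential mu).

(** An almost sure event on which, for every n at once, the level roots lie in [disc (2 * R0)]. *)
Let good : set T := \bigcap_k (Z k @^-1` disc R0).

Let measurable_good : measurable good.
Proof.
apply: bigcapT_measurable => k; rewrite -[X in measurable X]setTI.
by apply: (measurable_RV Z k) => //; exact: measurable_disc.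
Qed.

Let good1 : P (~` good) = 0%E.
Proof.
apply/negligibleP; first exact: measurableC.
rewrite /good setC_bigcap; apply: negligible_bigcup => k.
apply/negligibleP.
  apply: measurableC; rewrite -[X in measurable X]setTI.
  by apply: (measurable_RV Z k) => //; exact: measurable_disc.
by have := Zlaw k (measurableC (@measurable_disc R R0)); rewrite mu_disc.
Qed.

Lemma root_average_ge0 (f : R[i] -> R) n w (M : R) :
  (forall k, (k < n.+1)%N -> nc (Z k w) <= M) ->
  (forall a, nc a <= 2 * M -> 0 <= f a) -> 0 <= root_average Z f n w.
Proof.
move=> ZM f0; apply: mulr_ge0; first by rewrite invr_ge0.
rewrite big_seq; apply: sumr_ge0 => a ar; apply: f0.
exact: (level_roots_bound ZM ar).
Qed.

Lemma root_averageD (f g : R[i] -> R) n w :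
  root_average Z (fun u => f u + g u) n w = root_average Z f n w + root_average Z g n w.
Proof. by rewrite /root_average big_split mulrDr. Qed.

Lemma root_averageZ (c : R) (f : R[i] -> R) n w :
  root_average Z (fun u => c * f u) n w = c * root_average Z f n w.
Proof. by rewrite /root_average -mulr_sumr mulrCA. Qed.

Lemma root_average_cst (c : R) n w : root_average Z (fun=> c) n w = c.
Proof.
rewrite /root_average big_const_seq count_predT size_level_roots iter_addr_0 -[c *+ _]mulr_natl.
by rewrite mulKf// pnatr_eq0.
Qed.

Lemma root_average_dist (f g : R[i] -> R) n w (M e : R) :
  (forall k, (k < n.+1)%N -> nc (Z k w) <= M) ->
  (forall a, nc a <= 2 * M -> `|f a - g a| <= e) ->
  `|root_average Z f n w - root_average Z g n w| <= e.
Proof.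
move=> ZM fg; have gN : root_average Z (fun u => f u + -1 * g u) n w =
    root_average Z f n w - root_average Z g n w.
  by rewrite root_averageD root_averageZ mulN1r.
have lo : 0 <= root_average Z (fun u => e + (f u + -1 * g u)) n w.
  by apply: (root_average_ge0 ZM) => a /fg; rewrite ler_norml mulN1r; lra.
have hi : 0 <= root_average Z (fun u => e + -1 * (f u + -1 * g u)) n w.
  by apply: (root_average_ge0 ZM) => a /fg; rewrite ler_norml !mulN1r; lra.
move: lo hi; rewrite !root_averageD root_averageZ root_average_cst.
rewrite (@root_averageZ (-1) (fun u => f u + -1 * g u)) gN ler_norml; lra.
Qed.

(* level_roots lists the roots in an unspecified order; measurability comes from
   the averages of potentials, which are integrals of explicit functions of Z. *)
Lemma measurable_root_average f n : continuous f -> measurable_fun setT (root_average Z f n).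
Proof.
move=> cf.
(* The radius grows with m because pointwise convergence is needed at every [w], also outside
   [good], where the roots have no common bound. *)
have /choice[F HF] (m : nat) : exists F : R[i] -> R, bounded_on_support F /\
    forall w, nc w <= 2 * m%:R -> `|f w - logpot F w| <= m.+1%:R^-1.
  by apply: logpot_approx => //; rewrite invr_gt0 ltr0n.
apply: (@measurable_fun_cvg _ _ _ setT (fun m => root_average Z (logpot (F m)) n)) => //.
  move=> m; apply: (measurable_root_average_logpot Mr0 mu_le mu_disc).
  by have [] := HF m.
move=> w _; apply/cvgrPdist_le => e e0.
pose M := \sum_(k < n.+1) nc (Z k w).
have ZM k : (k < n.+1)%N -> nc (Z k w) <= M.
  move=> kn; rewrite /M (bigD1 (Ordinal kn))//= lerDl.
  by apply: sumr_ge0 => i _; exact: nc_ge0.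
near=> m; have [_ Fm] := HF m.
apply: (@le_trans _ _ m.+1%:R^-1); last by near: m; exact: near_harmonic.
apply: (@root_average_dist _ _ _ _ m%:R) => //.
by move=> k kn; apply: le_trans (ZM k kn) _; near: m; exact: nbhs_infty_ger.
Unshelve. all: end_near. Qed.

Lemma root_average_limit_approx f c : continuous f ->
  cvg_in_probability P (root_average Z f) c ->
  forall F (e : R), bounded_on_support F ->
  (forall w, nc w <= 2 * R0 -> `|f w - logpot F w| <= e) ->
  `|c - \int[lam]_u (F u * V u)| <= e.
Proof.
move=> cf fc F e bF Fe.
apply: (in_probability_dist_le good1 measurable_good _ _ fc
  (cvg_root_average_logpot Mr0 R01 mu_le mu_disc Zindep Zlaw bF)).
- by move=> n; exact: measurable_root_average.
- by move=> n; exact: (measurable_root_average_logpot Mr0 mu_le mu_disc).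
- by move=> n w Gw; apply: (@root_average_dist _ _ _ _ R0) => // k _; exact: Gw.
Qed.

Lemma root_average_cvg f : continuous f -> exists c : R,
  cvg_in_probability P (root_average Z f) c.
Proof.
move=> cf.
have [dl dl0 dle] : exists2 dl : nat -> R, forall m, 0 < dl m &
    forall e : R, 0 < e -> exists m, dl m <= e.
  exists (fun m => m.+1%:R^-1) => [m|e /near_harmonic[m _ me]]; first by rewrite invr_gt0 ltr0n.
  by exists m; exact: me (leqnn m).
have /choice[F HF] (m : nat) : exists F : R[i] -> R, bounded_on_support F /\
    forall w, nc w <= 2 * R0 -> `|f w - logpot F w| <= dl m.
  by apply: logpot_approx.
pose l m := \int[lam]_u (F m u * V u).
have Fl m : cvg_in_probability P (root_average Z (logpot (F m))) (l m).
  by apply: (cvg_root_average_logpot Mr0 R01 mu_le mu_disc Zindep Zlaw); have [] := HF m.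
have mF m n : measurable_fun setT (root_average Z (logpot (F m)) n).
  by apply: (measurable_root_average_logpot Mr0 mu_le mu_disc); have [] := HF m.
have ll m k : `|l m - l k| <= dl m + dl k.
  apply: (in_probability_dist_le good1 measurable_good (mF m) (mF k) (Fl m) (Fl k)).
  move=> n w Gw; apply: (@root_average_dist _ _ _ _ R0) => [k' _|a aR]; first exact: Gw.
  have [_ /(_ _ aR) h1] := HF m; have [_ /(_ _ aR) h2] := HF k.
  by move: h1 h2; rewrite !ler_norml; lra.
(* By [ll] the intervals of centre l m and radius dl m meet pairwise, so the supremum of their left
   ends belongs to all of them. *)
pose S : set R := [set l m - dl m | m in setT].
have Sub m : ubound S (l m + dl m).
  by move=> _ [k _ <-]; have := ll m k; rewrite ler_norml; lra.
have S0 : S !=set0 by exists (l 0%N - dl 0%N), 0%N.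
have hS : has_sup S by split => //; exists (l 0%N + dl 0%N); exact: Sub.
have cl m : `|sup S - l m| <= dl m.
  have h1 : sup S <= l m + dl m by apply: sup_le_ub => //; exact: Sub.
  have h2 : l m - dl m <= sup S by apply: ub_le_sup; [case: hS|exists m].
  by rewrite ler_norml; lra.
exists (sup S) => e e0.
have e2 : 0 < e / 2 by rewrite divr_gt0.
have [m me] := dle (e / 4) ltac:(by rewrite divr_gt0).
apply: (prob_dist_ge_cvg0 good1 measurable_good (mF m) (mF m) _ e2 _ (Fl m) (Fl m)).
  by move=> n; exact: measurable_root_average.
move=> n w Gw Xw _.
have fF : `|root_average Z f n w - root_average Z (logpot (F m)) n w| <= dl m.
  apply: (@root_average_dist _ _ _ _ R0) => [k' _|a aR]; first exact: Gw.
  by have [_ ->] := HF m.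
by move: (cl m) Xw fF; rewrite !ler_norml !ltr_norml; lra.
Qed.


Lemma root_average_limit_unique f (a b : R) : continuous f ->
  cvg_in_probability P (root_average Z f) a ->
  cvg_in_probability P (root_average Z f) b -> a = b.
Proof.
move=> cf fa fb; apply/eqP; rewrite -subr_eq0 -normr_le0.
have mf n := measurable_root_average n cf.
by apply: (in_probability_dist_le good1 measurable_good mf mf fa fb) => n w _; rewrite subrr normr0.
Qed.

Theorem root_average_limit : exists nu : probability R[i] R,
  forall f : R[i] -> R, continuous f -> (exists M : R, forall u, `|f u| <= M) ->
  cvg_in_probability P (root_average Z f) (\int[nu]_u f u).
Proof.
(* A limit is chosen for each function, with an arbitrary value at discontinuous ones; uniqueness of
   limits makes the choice linear on continuous functions. *)
have /choice[Lam HLam] (f : R[i] -> R) : exists c : R, continuous f ->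
    cvg_in_probability P (root_average Z f) c.
  have [/root_average_cvg[c fc]|ncf] := pselect (continuous f); first by exists c.
  by exists 0 => /ncf.
suff [nu nuE] : exists nu : probability R[i] R, forall f : R[i] -> R, continuous f ->
    (exists M : R, forall u, `|f u| <= M) -> \int[nu]_u f u = Lam f.
  by exists nu => f cf bf; rewrite nuE//; exact: HLam.
have mf f n (cf : continuous f) := measurable_root_average n cf.
apply: (@riesz_probability R (2 * R0) Lam).
- move=> f g cf cg; have cfg := continuous_addC cf cg.
  apply: (root_average_limit_unique cfg (HLam _ cfg)) => e e0.
  have e2 : 0 < e / 2 by rewrite divr_gt0.
  apply: (prob_dist_ge_cvg0 good1 measurable_good _ _ _ e2 _ (HLam f cf) (HLam g cg)) => n.
  + exact: mf.
  + exact: mf.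
  + exact: mf.
  move=> w _; rewrite root_averageD !ltr_norml; lra.
- move=> c f cf; have ccf := continuous_mulC (@continuous_cstC R c) cf.
  apply: (root_average_limit_unique ccf (HLam _ ccf)) => e e0.
  have c1 : 0 < `|c| + 1 by rewrite ltr_wpDl.
  have ec : 0 < e / (`|c| + 1) by rewrite divr_gt0.
  apply: (prob_dist_ge_cvg0 good1 measurable_good _ _ _ ec _ (HLam f cf) (HLam f cf)) => n.
  + exact: mf.
  + exact: mf.
  + exact: mf.
  move=> w _ fw _; rewrite root_averageZ -mulrBr normrM.
  rewrite ltr_pdivlMr// in fw; apply: le_lt_trans fw.
  by rewrite mulrC ler_wpM2l// lerDl.
- move=> f cf f0; rewrite leNgt; apply/negP => Lf.
  have e0 : 0 < - Lam f by rewrite oppr_gt0.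
  have [n [w [Gw fw _]]] := in_probability_joint good1 measurable_good
    (fun n => mf f n cf) (fun n => mf f n cf) (HLam f cf) (HLam f cf) e0.
  have := root_average_ge0 (fun k _ => Gw k Logic.I) f0 (n := n).
  by move: fw; rewrite ltr_norml; lra.
have c1 := @continuous_cstC R 1.
apply: (root_average_limit_unique c1 (HLam _ c1)) => e e0.
rewrite (_ : (fun n => _) = cst 0%E); first exact: cvg_cst.
apply/funext => n; rewrite (_ : [set w | _] = set0) ?measure0//.
apply/seteqP; split => w //=; rewrite root_average_cst subrr normr0.
by rewrite leNgt e0.
Qed.

End limit_functional.

(** * Identification of the limit *)

Section potential_duality.
Context {R : realType} (mu : probability R[i] R) (Mr R0 : R).
Context (Mr0 : 0 <= Mr) (R01 : 1 <= R0).
Context (mu_le : forall E, measurable E -> (mu E <= Mr%:E * @lebesgueC R E)%E).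
Context (mu_disc : mu (~` disc R0) = 0%E).

Local Notation lam := (@lebesgueC R).
Local Notation U := (logpotential mu).

(** Fubini for F(u) lg (u - x), using the symmetry of the modulus. Joint integrability follows from
    the second moments of lg (x - u) under [mu], bounded uniformly for u in the support of F. *)
Lemma logpot_duality (F : R[i] -> R) : bounded_on_support F ->
  mu.-integrable setT (EFin \o logpot F) /\
  \int[lam]_u (F u * U u) = \int[mu]_x logpot F x.
Proof.
move=> bF; have [mF [M [K [K0 FK]]]] := bF.
pose h (p : R[i] * R[i]) : \bar R := (F p.2 * lg (p.2 - p.1))%:E.
have mh : measurable_fun setT h.
  apply/measurable_EFinP; apply: measurable_funM; first exact: measurableT_comp mF _.
  by apply: (measurableT_comp measurable_lg); exact: measurable_subC.
have mah : measurable_fun setT (fun p => `|h p|%E) by exact: measurableT_comp.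
have hL x : (\int[lam]_u h (x, u))%E = (logpot F x)%:E.
  by rewrite /logpot fineK//; apply: (integrable_fin_num measurableT); exact: bcs_integrable_lg.
have hR u : (\int[mu]_x h (x, u))%E = (F u * U u)%:E.
  have il := mu_integrable_lg Mr0 mu_le mu_disc u.
  transitivity (\int[mu]_x ((F u)%:E * (lg (x - u))%:E))%E.
    by apply: eq_integral => x _; rewrite -EFinM /h /= -(lgN (x - u)) opprB.
  rewrite integralZl// EFinM fineK//; exact: (integrable_fin_num measurableT il).
have ih : (mu \x lam)%E.-integrable setT h.
  apply/(integrable12ltyP _ _ mh).
  rewrite (@fubini_tonelli _ _ _ _ _ mu lam (fun p => `|h p|%E) mah)//.
  have [C C0 CC] := mu_lg_sq Mr0 mu_le mu_disc M.
  have iF := bcs_integrable bF.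
  apply: (@le_lt_trans _ _ (\int[lam]_u ((1 + C)%:E * `|(F u)%:E|))%E); last first.
    rewrite ge0_integralZl//; last by rewrite lee_fin addr_ge0.
      by apply: lte_mul_pinfty => //; [rewrite lee_fin addr_ge0|case/integrableP: iF].
    by apply: measurableT_comp => //; case/integrableP: iF.
  apply: ge0_le_integral => //.
  - by move=> u _; apply: integral_ge0.
  - exact: (@measurable_fun_fubini_tonelli_G _ _ _ _ _ mu _ mah).
  - by apply: emeasurable_funM => //; apply: measurableT_comp => //; case/integrableP: iF.
  move=> u _; case: (boolP (u \in disc M)) => uM; last first.
    have Fu0 : F u = 0.
      apply/eqP; rewrite -normr_le0; apply: le_trans (FK u) _.
      by rewrite indicE (negbTE uM) mulr0.
    rewrite integral0_eq => [|x _]; last by rewrite /h /= Fu0 mul0r normr0.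
    by rewrite mule_ge0// lee_fin addr_ge0.
  rewrite inE in uM.
  have mlu : measurable_fun setT (fun x : R[i] => lg (x - u)).
    by apply: (measurableT_comp measurable_lg); exact: measurable_subC.
  rewrite [leRHS]muleC.
  apply: (@le_trans _ _ (\int[mu]_x (`|(F u)%:E| * (1%:E + (lg (x - u) ^+ 2)%:E)))%E).
    apply: ge0_le_integral => //.
    - by apply: (measurableT_comp mah); exact: pair2_measurable.
    - apply: emeasurable_funM => //; apply: emeasurable_funD => //.
      by apply/measurable_EFinP; exact: measurable_funX.
    move=> x _; rewrite -EFinD -EFinM lee_fin normrM -(lgN (u - x)) opprB.
    by rewrite ler_wpM2l// ler_norm_sqr1.
  rewrite ge0_integralZl//; last 2 first.
  - apply: emeasurable_funD => //; apply/measurable_EFinP; exact: measurable_funX.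
  - by move=> x _; rewrite -EFinD lee_fin addr_ge0// sqr_ge0.
  apply: lee_wpmul2l => //; rewrite ge0_integralD//; last 2 first.
  - by move=> x _; rewrite lee_fin sqr_ge0.
  - by apply/measurable_EFinP; exact: measurable_funX.
  by rewrite integral_cst//= probability_setT mule1 EFinD leeD2l//; exact: CC.
split.
  have := integrable_fubini_F ih; congr (_.-integrable _ _).
  by apply/funext => x; exact: hL.
congr fine; transitivity (\int[lam]_u \int[mu]_x h (x, u))%E.
  by apply: eq_integral => u _; rewrite hR.
transitivity (\int[mu]_x \int[lam]_u h (x, u))%E; first exact: (esym (Fubini ih)).
by apply: eq_integral => x _; exact: hL.
Qed.

Lemma Rintegral_logpot_approx (f F : R[i] -> R) (e K : R) : bounded_on_support F ->
  continuous f -> (forall u, `|f u| <= K) ->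
  (forall w, nc w <= 2 * R0 -> `|f w - logpot F w| <= e) ->
  `|\int[mu]_x f x - \int[lam]_u (F u * U u)| <= e.
Proof.
move=> bF cf fK fF; have [iF ->] := logpot_duality bF.
have mf := continuous_measurableC cf.
have if_ : mu.-integrable setT (EFin \o f).
  apply: (le_integrable _ _ _ (mu_integrable_cst mu K)) => //; first exact/measurable_EFinP.
  by move=> u _; rewrite /= lee_fin (le_trans (fK u))// ler_norm.
rewrite -RintegralB//; apply: norm_Rintegral_le.
  by apply: measurable_funB => //; apply/measurable_EFinP; case/integrableP: iF.
have R01' := R01.
apply: (@le_trans _ _ (\int[mu]_x e%:E)%E); last by rewrite integral_cst//= probability_setT mule1.
have e0 : 0 <= e by apply: le_trans (fF 0 _) => //; rewrite nc0; lra.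
apply: ae_ge0_le_integral => //.
  apply/measurable_EFinP; apply: measurableT_comp => //.
  by apply: measurable_funB => //; apply/measurable_EFinP; case/integrableP: iF.
have neg : mu.-negligible (~` disc R0).
  by apply/negligibleP => //; apply: measurableC; exact: measurable_disc.
apply: negligibleS neg => u /= bad; rewrite /disc /= => uR; apply: bad => _.
by rewrite lee_fin; apply: fF; lra.
Qed.

End potential_duality.

Section identification.
Context {R : realType}.
Local Notation lam := (@lebesgueC R).

(** The density F spreads at most e/2 beyond the support of f; by uniform continuity of [dist], the
    margin [t] keeps it where [dist] is positive. *)
Lemma logpot_dense_local (f dist : R[i] -> R) (M t r d : R) : continuous f -> continuous dist ->
  (forall u, f u != 0 -> nc u <= M /\ t < dist u) -> 0 < t -> 0 < d ->
  exists F : R[i] -> R, [/\ bounded_on_support F, forall u, F u != 0 -> 0 < dist u,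
    \int[lam]_u F u = 0 & forall w, nc w <= r -> `|f w - logpot F w| <= d].
Proof.
move=> cf cdist fMt t0 d0.
have [e e0 de] := @unif_continuous_disc R dist M cdist t t0.
have f0 u : M < nc u -> f u = 0.
  by apply: contraTeq => /fMt[uM _]; rewrite -leNgt.
have [F [bF Fs F0 Ff]] := @logpot_dense R f M (e / 2) r d cf f0 ltac:(by rewrite divr_gt0) d0.
exists F; split => // u /Fs[u' u'u /fMt[u'M tu']].
have u'ue : nc (u' - u) < e by apply: le_lt_trans u'u _; rewrite ltr_pdivrMr// ltr_pMr// ltr1n.
by have := de u' u u'M u'ue; rewrite ltr_norml; lra.
Qed.

(** The j-th bump multiplies a cutoff supported at distance at least 1/(j+1) from the complement of
    W by one supported in radius j + 1. Both equal 1 at a given point of W for large j, and the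
    positive margin is what [logpot_dense_local] needs. *)
Lemma open_bumps (W : set R[i]) : open W -> exists f : nat -> R[i] -> R,
  [/\ forall j, continuous (f j), forall j u, 0 <= f j u <= 1,
     forall u, f j u @[j --> \oo] --> (\1_W u : R) &
     forall j (r d : R), 0 < d -> exists F : R[i] -> R, [/\ bounded_on_support F,
       forall u, F u != 0 -> W u, \int[lam]_u F u = 0 &
       forall w, nc w <= r -> `|f j w - logpot F w| <= d]].
Proof.
move=> oW; have [dist [cdist dist0 Wdist]] := open_distance oW.
pose a j u : R := Num.max 0 (Num.min 1 (j.+1%:R * dist u - 1)).
pose b j (u : R[i]) : R := Num.max 0 (Num.min 1 (j.+1%:R - nc u)).
have clamp (g : R[i] -> R) : continuous g -> continuous (fun u => Num.max 0 (Num.min 1 (g u)) : R).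
  move=> cg u; have c1 := continuous_minC (@continuous_cstC R 1) cg.
  exact: (continuous_max (@cst_continuous _ _ _ _) (c1 u)).
have ca j : continuous (a j).
  apply: clamp; apply: continuous_subC; last exact: continuous_cstC.
  by apply: continuous_mulC => //; exact: continuous_cstC.
have cb j : continuous (b j).
  by apply: clamp; apply: continuous_subC; [exact: continuous_cstC|exact: continuous_nc].
have c01 (x : R) : 0 <= Num.max 0 (Num.min 1 x) <= 1.
  by rewrite le_max lexx ge_max ler01 ge_min lexx.
have clamp_neq0 (x : R) : Num.max 0 (Num.min 1 x) != 0 -> 0 < x.
  by apply: contraNT; rewrite -leNgt => x0; rewrite max_l// ge_min x0 orbT.
have clamp1 (x : R) : 1 <= x -> Num.max 0 (Num.min 1 x) = 1.
  by move=> x1; rewrite min_l// max_r.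
exists (fun j u => a j u * b j u); split.
- by move=> j; exact: continuous_mulC.
- move=> j u; have /andP[a0 a1] := c01 (j.+1%:R * dist u - 1).
  have /andP[b0 b1] := c01 (j.+1%:R - nc u).
  by rewrite mulr_ge0//= mulr_ile1.
- move=> u; have [Wu|nWu] := pselect (W u).
    rewrite indicE mem_set//; apply: cvg_near_cst.
    have du : 0 < dist u by exact/Wdist.
    near=> j; rewrite /a /b !clamp1 ?mulr1//.
      have : nc u <= j%:R by near: j; exact: nbhs_infty_ger.
      by rewrite -[j.+1%:R]natr1; lra.
    have : 2 / dist u <= j%:R by near: j; exact: nbhs_infty_ger.
    by rewrite ler_pdivrMr// -[j.+1%:R]natr1 mulrDl mul1r; lra.
  rewrite indicE memNset//; apply: cvg_near_cst; near=> j.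
  have -> : a j u = 0; last by rewrite mul0r.
  apply/eqP; apply: contrapT => /negP/clamp_neq0 dj; apply: nWu; apply/Wdist.
  by rewrite lt_neqAle dist0 andbT; apply/eqP => d0; move: dj; rewrite -d0 mulr0; lra.
move=> j r d d0.
have j0 : 0 < j.+1%:R :> R by rewrite ltr0n.
have sup u : a j u * b j u != 0 -> nc u <= j.+1%:R /\ j.+1%:R^-1 < dist u.
  rewrite mulf_eq0 negb_or => /andP[/clamp_neq0 aj /clamp_neq0 bj]; split; first by lra.
  by rewrite -[_^-1]mul1r ltr_pdivrMr// mulrC; lra.
have ji : 0 < j.+1%:R^-1 :> R by rewrite invr_gt0.
have [F [bF FW F0 Ff]] := logpot_dense_local r (continuous_mulC (ca j) (cb j)) cdist sup ji d0.
by exists F; split => // u /FW/Wdist.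
Unshelve. all: end_near. Qed.

Lemma bumps_integral (m : probability R[i] R) (W : set R[i]) (f : nat -> R[i] -> R) :
  measurable W -> (forall j, measurable_fun setT (f j)) -> (forall j u, 0 <= f j u <= 1) ->
  (forall u, f j u @[j --> \oo] --> (\1_W u : R)) ->
  (\int[m]_u f j u)%:E @[j --> \oo] --> m W.
Proof.
move=> mW mf f01 fW.
have fin j : (\int[m]_u (f j u)%:E)%E \is a fin_num.
  apply: (integrable_fin_num measurableT).
  apply: (le_integrable _ _ _ (mu_integrable_cst m 1)) => //; first exact/measurable_EFinP.
  by move=> u _; have /andP[f0 f1] := f01 j u; rewrite /= lee_fin ger0_norm// normr1.
have -> : m W = (\int[m]_u (\1_W u)%:E)%E by rewrite integral_indic// setIT.
rewrite (_ : (fun j => _) = (fun j => \int[m]_u (f j u)%:E)%E); last first.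
  by apply/funext => j; rewrite fineK.
apply: (@dominated_cvg _ _ _ m setT measurableT (fun j u => (f j u)%:E) _ (fun=> 1%E)) => //.
- by move=> j; exact/measurable_EFinP.
- by move=> u _; apply: cvg_EFin; [near=> j|exact: fW].
- exact: (mu_integrable_cst m 1).
- by move=> j u _; have /andP[f0 f1] := f01 j u; rewrite lee_fin ger0_norm.
Unshelve. all: end_near. Qed.

End identification.

Section limit_measure.
Context {R : realType} (mu nu : probability R[i] R) (Mr R0 : R).
Context (Mr0 : 0 <= Mr) (R01 : 1 <= R0).
Context (mu_le : forall E, measurable E -> (mu E <= Mr%:E * @lebesgueC R E)%E).
Context (mu_disc : mu (~` disc R0) = 0%E).

Local Notation lam := (@lebesgueC R).
Local Notation U := (logpotential mu).
Local Notation V := (maxpotential mu).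

(** The only link between [nu] and the random roots used in identifying it. *)
Context (nu_approx : forall (f F : R[i] -> R) (e : R), continuous f ->
  (exists M : R, forall u, `|f u| <= M) -> bounded_on_support F ->
  (forall w, nc w <= 2 * R0 -> `|f w - logpot F w| <= e) ->
  `|\int[nu]_u f u - \int[lam]_u (F u * V u)| <= e).

Lemma small_dist_eq (x y : R) : (forall d : R, 0 < d -> `|x - y| <= d) -> x = y.
Proof.
move=> xy; apply/eqP; rewrite -subr_eq0 -normr_le0; apply/ler_addgt0Pr => e e0.
by rewrite add0r; exact: xy.
Qed.

(* The densities F approximating bumps in W are supported where V = U. *)
Lemma nu_open_above (W : set R[i]) : open W -> W `<=` [set u | U 0 < U u] -> nu W = mu W.
Proof.
move=> oW WA; have [f [cf f01 fW fF]] := open_bumps oW.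
have mW := open_measurableC oW; have mf j := continuous_measurableC (cf j).
have fint j : \int[nu]_u f j u = \int[mu]_u f j u.
  apply: small_dist_eq => d d0.
  have [F [bF FW _ Ff]] := fF j (2 * R0) (d / 2) ltac:(by rewrite divr_gt0).
  have f1 u : `|f j u| <= 1 by have /andP[f0 f1] := f01 j u; rewrite ger0_norm.
  have h1 := nu_approx (cf j) (ex_intro _ 1 f1) bF Ff.
  have h2 := Rintegral_logpot_approx Mr0 R01 mu_le mu_disc bF (cf j) f1 Ff.
  have E : \int[lam]_u (F u * V u) = \int[lam]_u (F u * U u).
    apply: eq_Rintegral => u _; have [->|/FW/WA Wu] := eqVneq (F u) 0; first by rewrite !mul0r.
    by rewrite /maxpotential max_l// ltW.
  by move: h1 h2; rewrite E !ler_norml; lra.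
have cn := bumps_integral (m := nu) mW mf f01 fW.
have cm := bumps_integral (m := mu) mW mf f01 fW.
have E : (fun j => (\int[nu]_u f j u)%:E) = (fun j => (\int[mu]_u f j u)%:E).
  by apply/funext => j; rewrite fint.
by rewrite E in cn; exact: (cvg_unique (@ereal_hausdorff R) cn cm).
Qed.

(* The densities F approximating bumps here have zero integral and are supported
   where V is the constant U 0. *)
Lemma nu_below : nu [set u | U u < U 0] = 0%E.
Proof.
set W := [set u | _].
have cU := continuous_logpotential Mr0 mu_le mu_disc.
have oW : open W.
  by apply: open_comp (@open_lt R (U 0)) => u _; exact: cU.
have [f [cf f01 fW fF]] := open_bumps oW.
have mW := open_measurableC oW; have mf j := continuous_measurableC (cf j).
have fint j : \int[nu]_u f j u = 0.
  apply: small_dist_eq => d d0.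
  have [F [bF FW F0 Ff]] := fF j (2 * R0) d d0.
  have f1 u : `|f j u| <= 1 by have /andP[f0 f1] := f01 j u; rewrite ger0_norm.
  have h1 := nu_approx (cf j) (ex_intro _ 1 f1) bF Ff.
  rewrite (_ : 0 = \int[lam]_u (F u * V u))//.
  have -> : \int[lam]_u (F u * V u) = \int[lam]_u (U 0 * F u).
    apply: eq_Rintegral => u _; have [->|/FW Wu] := eqVneq (F u) 0; first by rewrite mul0r mulr0.
    by rewrite /maxpotential max_r 1?mulrC// ltW.
  by rewrite (RintegralZl (U 0) measurableT (bcs_integrable bF)) F0 mulr0.
have cn := bumps_integral (m := nu) mW mf f01 fW.
have E : (fun j => (\int[nu]_u f j u)%:E) = (fun=> 0%E).
  by apply/funext => j; rewrite fint.
by rewrite E in cn; exact: (cvg_unique (@ereal_hausdorff R) cn (cvg_cst _)).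
Qed.

Lemma open_above : open [set u | U 0 < U u].
Proof.
have cU := continuous_logpotential Mr0 mu_le mu_disc.
by apply: open_comp (@open_gt R (U 0)) => u _; exact: cU.
Qed.

(** The restrictions of [nu] and [mu] to this open set agree on open sets, a pi-system generating
    the Borel sets. *)
Lemma nu_above (E : set R[i]) : measurable E ->
  nu (E `&` [set u | U 0 < U u]) = mu (E `&` [set u | U 0 < U u]).
Proof.
move=> mE; set A := [set u | _].
have mA : measurable A by exact: open_measurableC open_above.
apply: (@measure_unique _ R R[i] (@open R[i]) (fun=> setT) _ _ _ _
  (mrestr nu mA) (mrestr mu mA)) => //.
- by move=> X Y; exact: openI.
- by move=> _; exact: openT.
- by rewrite bigcup_const.
- move=> O oO; apply: nu_open_above; first exact: openI oO open_above.
  by move=> u [].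
- move=> _; change (nu (setT `&` A) < +oo)%E; rewrite setTI.
  by apply: le_lt_trans (ltry 1); exact: probability_le1.
Qed.

(** The level set is the complement of the regions above and below; the first carries its [mu] mass
    and the second none. *)
Lemma nu_level : nu [set u | U u = U 0] = (1 - mu [set u | U 0%R < U u]%R)%E.
Proof.
have cU := continuous_logpotential Mr0 mu_le mu_disc.
set A := [set u | U 0 < U u]; pose W := [set u | U u < U 0].
have mA : measurable A by exact: open_measurableC open_above.
have mW : measurable W.
  by apply: open_measurableC; apply: open_comp (@open_lt R (U 0)) => u _; exact: cU.
have -> : [set u | U u = U 0] = ~` (A `|` W).
  apply/seteqP; split => u /=; first by rewrite /A /W /= => ->; rewrite ltxx => -[].
  by move=> /not_orP[/negP + /negP]; rewrite -!leNgt => h1 h2; apply/eqP; rewrite eq_le h1.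
rewrite probability_setC; last exact: measurableU.
congr (1 - _)%E; rewrite measureU//; last first.
  by apply/seteqP; split => u // [] /= h1 h2; have := lt_trans h1 h2; rewrite ltxx.
have nW : nu W = 0%E := nu_below.
by rewrite [X in (_ + X)%E]nW adde0; have := nu_above measurableT; rewrite !setTI.
Qed.

End limit_measure.

Theorem theorem2 (R : realType) (mu : probability R[i] R) (rho : R[i] -> R)
    (rho_density : has_density mu rho)
    (rho_continuous : continuous rho)
    (rho_support : compactly_supported rho)
    (d : measure_display) (T : measurableType d) (P : probability T R)
    (Z : nat -> {RV P >-> R[i]})
    (Z_independent : mutually_independent P Z)
    (Z_law : forall k (E : set R[i]), measurable E ->
       distribution P (Z k) E = mu E) :
  let A := [set z : R[i] | (log_potential mu z > log_potential mu 0%R)%E] in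
  let B := [set z : R[i] | log_potential mu z = log_potential mu 0%R] in
  let p n w := random_poly (fun k => Z k w) n in
  let nu_ n w := empirical_measure (level_roots (p n w)) in
  exists nu : probability R[i] R,
    [/\ forall E : set R[i], measurable E -> nu (E `&` A) = mu (E `&` A),
        nu B = (1 - mu A)%E &
        forall f : R[i] -> R, continuous f ->
          (exists M : R, forall z, `|f z| <= M) ->
          cvg_in_probability P (fun n w => \int[nu_ n w]_z f z) (\int[nu]_z f z)].
Proof.
move=> A B p nu_.
have [Mr [R0 [Mr0 R01 mu_le mu_disc]]] := density_bounds rho_density rho_continuous rho_support.
have [nu nuZ] := root_average_limit Mr0 R01 mu_le mu_disc Z_independent Z_law.
have nu_approx (f F : R[i] -> R) (e : R) : continuous f ->
    (exists M : R, forall u, `|f u| <= M) -> bounded_on_support F ->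
    (forall w, nc w <= 2 * R0 -> `|f w - logpot F w| <= e) ->
    `|\int[nu]_u f u - \int[@lebesgueC R]_u (F u * maxpotential mu u)| <= e.
  move=> cf bf.
  exact: (root_average_limit_approx Mr0 R01 mu_le mu_disc Z_independent Z_law cf (nuZ f cf bf)).
have UE := log_potentialE Mr0 mu_le mu_disc.
have AE : A = [set u | logpotential mu 0 < logpotential mu u].
  by apply/seteqP; split => u; rewrite /A /= !UE lte_fin.
have BE : B = [set u | logpotential mu u = logpotential mu 0].
  by apply/seteqP; split => u; rewrite /B /= !UE; [exact: EFin_inj|move=> ->].
exists nu; split.
- by move=> E mE; rewrite AE; exact: (nu_above Mr0 R01 mu_le mu_disc nu_approx).
- by rewrite BE AE; exact: (nu_level Mr0 R01 mu_le mu_disc nu_approx).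
move=> f cf bf e e0; set c := \int[nu]_z f z.
(* [root_average] at index n concerns degree n + 1; the shift of index does not affect the limit. *)
have E : (fun n => P [set w | e <= `|root_average Z f n w - c|]) =
    (fun n => P [set w | e <= `|\int[nu_ n.+1 w]_z f z - c|]).
  apply/funext => n; congr (P _); apply/seteqP; split => w /=;
  by rewrite /nu_ empirical_measure_integral ?size_level_roots//; exact: continuous_measurableC.
have := nuZ f cf bf e e0; rewrite E => lim.
by rewrite -(cvg_shiftS (fun n => P [set w | e <= `|\int[nu_ n w]_z f z - c|])).
Qed.
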